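(* Let $f,g:A\to B$ be homotopic morphisms of $A_\infty$-algebras. Then there is an isomorphism of functors $\underline R_f\cong\underline R_g$, where $\underline R_f,\underline R_g:\underline{\mathrm{Mod}}_\infty\text{-}B\to\underline{\mathrm{Mod}}_\infty\text{-}A$ are the functors induced on the homotopy categories by the restriction functors $R_f,R_g:\mathrm{Mod}_\infty\text{-}B\to\mathrm{Mod}_\infty\text{-}A$. Moreover, any homotopy equivalence $f:A\to B$ of $A_\infty$-algebras determines an equivalence of categories $\underline R_f:\underline{\mathrm{Mod}}_\infty\text{-}B\to\underline{\mathrm{Mod}}_\infty\text{-}A$.
   Context: Conventions: $k$ is a field, $S$ is a finite-dimensional semisimple $k$-algebra such that $S\otimes_kS^{op}$ is semisimple; $k$ acts centrally on all algebras and bimodules; $S$ is graded concentrated in degree $0$. Graded means $\mathbb{Z}$-graded; a homogeneous morphism of degree $d$ shifts degrees by $d$; tensor products are over $S$ with the usual grading; $(f\otimes g)(x\otimes y)=(-1)^{|g||x|}f(x)\otimes g(y)$. An $A_\infty$-algebra is a graded $S$-$S$-bimodule $A$ with bimodule morphisms $m_n=m_n^A:A^{\otimes n}\to A$ of degree $2-n$ ($n\ge1$) with $\sum_{r+s+t=n,\ s\ge1;\,r,t\ge0}(-1)^{r+st}m_{r+1+t}(id^{\otimes r}\otimes m_s\otimes id^{\otimes t})=0$ for all $n\ge1$. Put $\mathrm{sgn}(i_1,\dots,i_r)=(r-1)(i_1-1)+(r-2)(i_2-1)+\cdots+2(i_{r-2}-1)+(i_{r-1}-1)$. A morphism $f:A\to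 B$ of $A_\infty$-algebras is a family of bimodule morphisms $f_n:A^{\otimes n}\to B$ of degree $1-n$ with, for all $n\ge1$, $\sum_{r+s+t=n;\,r,t\ge0,s\ge1}(-1)^{r+st}f_{r+1+t}(id^{\otimes r}\otimes m^A_s\otimes id^{\otimes t})=\sum_{1\le r\le n;\,i_1+\cdots+i_r=n}(-1)^{\mathrm{sgn}(i_1,\dots,i_r)}m^B_r(f_{i_1}\otimes\cdots\otimes f_{i_r})$, with all $i_j\ge1$. Composition: $(g\circ f)_n=\sum_{1\le s\le n;\,i_1+\cdots+i_s=n}(-1)^{\mathrm{sgn}(i_1,\dots,i_s)}g_s(f_{i_1}\otimes\cdots\otimes f_{i_s})$; the identity of $A$ is $(id_A,0,0,\dots)$. A homotopy from $f$ to $g$ (morphisms $A\to B$) is a family of bimodule morphisms $h_n:A^{\otimes n}\to B$ of degree $-n$ with, for all $n\ge1$, $$f_n-g_n=\sum_{\substack{r+s+t=n\\ r,t\ge0;\,s\ge1}}(-1)^{r+st}h_{r+1+t}(id^{\otimes r}\otimes m_s^A\otimes id^{\otimes t})+\sum(-1)^{\mathrm{sgn}}m^B_{r+1+t}(f_{i_1}\otimes\cdots\otimes f_{i_r}\otimes h_s\otimes g_{j_1}\otimes\cdots\otimes g_{j_t}),$$ the last sum over $r,t\ge0$, $s\ge1$, $i_u,j_v\ge1$ with $i_1+\cdots+i_r+s+j_1+\cdots+j_t=n$, and $\mathrm{sgn}=r(t+1)+st+\sum_{2\le\alpha\le r,\,1\le u<\alpha}(1-i_u)+t\sum_{u=1}^ri_u+\sum_{2\le\beta\le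 t,\,1\le v<\beta}(1-j_v)$. Then $f$ and $g$ are homotopic; this is an equivalence relation compatible with composition. A homotopy equivalence of $A_\infty$-algebras is a morphism $f:A\to B$ for which there is $g:B\to A$ with $g\circ f$ and $f\circ g$ homotopic to identities. $\mathrm{Mod}_\infty\text{-}A$: a right $A_\infty$-module over $A$ is a graded right $S$-module $M$ with morphisms of right $S$-modules $m_n^M:M\otimes A^{\otimes(n-1)}\to M$ of degree $2-n$ ($n\ge1$) such that for all $n\ge1$: $\sum_{r+s+t=n;\,r,s\ge1,t\ge0}(-1)^{r+st}m^M_{r+1+t}(id^{\otimes r}\otimes m_s\otimes id^{\otimes t})+\sum_{s+t=n;\,s\ge1,t\ge0}(-1)^{st}m^M_{1+t}(m^M_s\otimes id^{\otimes t})=0$, where $id^{\otimes r}$ ($r\ge1$) on the left abbreviates $id_M\otimes id_A^{\otimes(r-1)}$. A morphism $p:M\to N$ is a family of morphisms of graded right $S$-modules $p_n:M\otimes A^{\otimes(n-1)}\to N$ of degree $1-n$ with $\sum_{r+s+t=n;\,r,s\ge1,t\ge0}(-1)^{r+st}p_{r+1+t}(id^{\otimes r}\otimes m_s\otimes id^{\otimes t})+\sum_{s+t=n;\,s\ge1,t\ge0}(-1)^{st}p_{1+t}(m_s^M\otimes id^{\otimes t})-\sum_{r+s=n;\,r\ge1,s\ge0}(-1)^{(r+1)s}m^N_{1+s}(p_r\otimes id^{\otimes s})=0$; composition is $(q\circ p)_n=\sum_{r+s=n;\,r\ge1,s\ge0}(-1)^{(r+1)s}q_{1+s}(p_r\otimes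 id^{\otimes s})$. A homotopy from $p$ to $q$ is a family of right $S$-module morphisms $h_n:M\otimes A^{\otimes(n-1)}\to N$ of degree $-n$ with $p_n-q_n=\sum_{r+s=n;\,r\ge1,s\ge0}(-1)^{rs}m^N_{1+s}(h_r\otimes id^{\otimes s})+\sum_{s+t=n;\,s\ge1,t\ge0}(-1)^{st}h_{1+t}(m_s^M\otimes id^{\otimes t})+\sum_{r+s+t=n;\,r,s\ge1,t\ge0}(-1)^{r+st}h_{r+1+t}(id^{\otimes r}\otimes m_s\otimes id^{\otimes t})$ for all $n\ge1$. $\underline{\mathrm{Mod}}_\infty\text{-}A$ is the quotient category modulo homotopy. Restriction functor of a morphism $\phi:A\to B$ of $A_\infty$-algebras: for a family $p=\{p_n:M\otimes B^{\otimes(n-1)}\to N\}_{n\ge1}$ put $R_\phi(p)_1=p_1$ and, for $n\ge2$, $R_\phi(p)_n=\sum_{1\le r\le n-1;\,i_1+\cdots+i_r=n-1}(-1)^{\mathrm{sgn}(i_1,\dots,i_r)}p_{r+1}(id_M\otimes\phi_{i_1}\otimes\cdots\otimes\phi_{i_r})$. Then $R_\phi(M,\{m_n^M\})=(M,\{R_\phi(m^M)_n\})$ on objects and $p\mapsto R_\phi(p)$ on morphisms; $R_\phi$ preserves homotopy and $\underline R_\phi$ is the induced functor. *)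

(* Defs.v *)
From HB Require Import structures.
From mathcomp Require Import all_boot all_order all_algebra all_field.
From mathcomp Require Import boolp classical_sets functions cardinality fsbigop.
From mathcomp Require Import ring.

Set Implicit Arguments.
Unset Strict Implicit.
Unset Printing Implicit Defensive.

Import GRing.Theory.

Local Open Scope classical_set_scope.
Local Open Scope ring_scope.

Section Semisimple.
Variables (k : fieldType) (V : vectType k) (mul : V -> V -> V).

Definition left_ideal (U : {vspace V}) : Prop :=
  forall a u, u \in U -> mul a u \in U.

Definition simple_left_ideal (U : {vspace V}) : Prop :=
  [/\ left_ideal U, U != 0%VS &
      forall W : {vspace V}, left_ideal W -> (W <= U)%VS -> W = 0%VS \/ W = U].

(* The finite-dimensional algebra (V, mul) is semisimple: as a left module over
   itself it is a direct sum of simple submodules. *)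
Definition semisimple : Prop :=
  exists (n : nat) (I : 'I_n -> {vspace V}),
    [/\ forall i, simple_left_ideal (I i),
        (\sum_(i < n) I i)%VS = fullv & directv (\sum_(i < n) I i)%VS].

End Semisimple.

Section Enveloping.
Variables (k : fieldType) (S : falgType k).

Let d := \dim {:S}.
Let e : d.-tuple S := vbasis {:S}.

(* Elements of S (x)_k S^op are d x d matrices, x standing for
   \sum_(i, j) x i j *: (e_i (x) e_j) where e is a basis of S. *)
Definition env_tensor (a b : S) : 'M[k]_d :=
  \matrix_(i, j) (coord e i a * coord e j b).

Definition env_mul (x y : 'M[k]_d) : 'M[k]_d :=
  \sum_i \sum_j \sum_p \sum_q
    (x i j * y p q) *: env_tensor (e`_i * e`_p) (e`_q * e`_j).

Lemma env_mul_tensor (a b a' b' : S) :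
  env_mul (env_tensor a b) (env_tensor a' b') = env_tensor (a * a') (b' * b).
Proof.
have coordM c c' u : coord e u (c * c')
    = \sum_i \sum_p coord e i c * coord e p c' * coord e u (e`_i * e`_p).
  rewrite [in LHS](coord_vbasis (memvf c)) [in LHS](coord_vbasis (memvf c')).
  rewrite mulr_suml linear_sum; apply: eq_bigr => i _.
  rewrite mulr_sumr linear_sum; apply: eq_bigr => p _.
  by rewrite -scalerAl -scalerAr !linearZ /= mulrA.
apply/matrixP => u v; rewrite /env_mul !mxE summxE !coordM mulr_suml.
apply: eq_bigr => i _; rewrite summxE mulr_suml.
under eq_bigr => j _ do rewrite summxE.
rewrite exchange_big /=; apply: eq_bigr => p _.
under eq_bigr => j _ do rewrite summxE.
rewrite exchange_big /= mulr_sumr; apply: eq_bigr => q _.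
rewrite mulr_sumr; apply: eq_bigr => j _.
by rewrite !mxE; ring.
Qed.

End Enveloping.

Section Graded.
Variables (k : fieldType) (S : falgType k).

(* Right S-modules are left modules over the converse ring S^c.  The grading
   V = (+)_(i : int) V_i is given by the projections gproj i of V onto V_i. *)
Record grMod : Type := GrMod {
  gcar :> lmodType S^c;
  gproj : int -> {linear gcar -> gcar};
  gproj_proj : forall i j x,
    gproj i (gproj j x) = if i == j then gproj j x else 0;
  gproj_finite : forall x, finite_set [set i : int | gproj i x != 0];
  gproj_sum : forall x, x = \sum_(i \in [set: int]) gproj i x }.

Definition ract (M : grMod) (x : M) (s : S) : M := (s : S^c) *: x.

Definition homog (M : grMod) (i : int) (x : M) : bool := gproj M i x == x.

(* A bimodule is a right module with a left action by right-linear maps.  The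
   last two axioms say that k acts centrally and that S has degree 0. *)
Record grBimod : Type := GrBimod {
  gmod :> grMod;
  lact : S -> {linear gmod -> gmod};
  lact1 : forall x, lact 1 x = x;
  lactM : forall s t x, lact (s * t) x = lact s (lact t x);
  lactD : forall s t x, lact (s + t) x = lact s x + lact t x;
  lact_central : forall (c : k) x, lact c%:A x = ract x c%:A;
  lact_proj : forall s i x, gproj gmod i (lact s x) = lact s (gproj gmod i x) }.

(* [sg e] is the sign (-1)^e; [koszul e] multiplies by (-1)^(e * i) in degree i,
   hence is the sign picked up when a map of degree e moves past an element. *)
Definition sg (e : int) : int := (-1) ^ e.

Definition koszul (M : grMod) (e : int) (x : M) : M :=
  \sum_(i \in [set: int]) (gproj M i x *~ sg (e * i)).

Lemma koszul_homog (M : grMod) (e i : int) (x : M) :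
  homog i x -> koszul e x = x *~ sg (e * i).
Proof.
move=> /eqP xi; rewrite /koszul -(fsbig_widen [set i]).
- by rewrite fsbig_set1 xi.
- by [].
- move=> j [_ /= /eqP ji].
  by rewrite -xi gproj_proj (negbTE ji) mul0rz.
Qed.

(* By the universal property of the tensor product over S, a morphism of right
   S-modules M (x) A^(x)(n-1) -> N is an S-balanced multiadditive map which is
   S-linear in its last argument.  A function F : M -> seq A -> N stands for a
   whole family (F_n)_(n >= 1), where F_n is F restricted to sequences of size
   n - 1; [dg n] is the degree of F_n. *)
Record right_family (M : grMod) (A : grBimod) (N : grMod) (dg : nat -> int)
    (F : M -> seq A -> N) : Prop := RightFamily {
  rf_addl : forall x y a, F (x + y) a = F x a + F y a;
  rf_addr : forall x a y z b,
    F x (a ++ (y + z) :: b) = F x (a ++ y :: b) + F x (a ++ z :: b);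
  rf_ball : forall x s y b, F (ract x s) (y :: b) = F x (lact A s y :: b);
  rf_balr : forall x a y s z b,
    F x (a ++ ract y s :: z :: b) = F x (a ++ y :: lact A s z :: b);
  rf_lin1 : forall x s, F (ract x s) [::] = ract (F x [::]) s;
  rf_lin : forall x a y s,
    F x (rcons a (ract y s)) = ract (F x (rcons a y)) s;
  rf_deg : forall i x ds a, homog i x -> all2 (@homog A) ds a ->
    homog (i + \sum_(d <- ds) d + dg (size a).+1) (F x a) }.

(* Likewise F : seq A -> B stands for a family of bimodule morphisms
   F_n : A^(x)n -> B, n >= 1; the value of F at [::] is irrelevant. *)
Definition bimod_family (A B : grBimod) (dg : nat -> int) (F : seq A -> B) :
    Prop :=
  right_family dg (fun (x : A) a => F (x :: a)) /\
  (forall s x a, F (lact A s x :: a) = lact B s (F (x :: a))).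

(* A homogeneous map A^(x)arity -> B of degree odeg. *)
Record op (A B : grBimod) : Type :=
  Op { arity : nat; odeg : int; ofun : seq A -> B }.

Definition id_op (A : grBimod) : op A A := Op 1 0 (head 0).

Definition odegs (A B : grBimod) (os : seq (op A B)) : int :=
  \sum_(o <- os) odeg o.

(* The factors of (o_1 (x) ... (x) o_r)(x_1 (x) ... (x) x_n), using
   (f (x) g)(x (x) y) = (-1)^(|g||x|) f x (x) g y with f := o_1 and
   g := o_2 (x) ... (x) o_r. *)
Fixpoint tensor (A B : grBimod) (os : seq (op A B)) (xs : seq A) : seq B :=
  if os is o :: os' then
    ofun o (map (koszul (odegs os')) (take (arity o) xs))
      :: tensor os' (drop (arity o) xs)
  else [::].

(* G o (F (x) o_1 (x) ... (x) o_r) on M (x) A^(x)(n-1), where F takes the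
   factor M and the next i - 1 factors A. *)
Definition rtensor (M N P : grMod) (A B : grBimod) (G : N -> seq B -> P)
    (i : nat) (F : M -> seq A -> N) (os : seq (op A B)) (x : M) (a : seq A) : P :=
  G (F (koszul (odegs os) x) (map (koszul (odegs os)) (take i.-1 a)))
    (tensor os (drop i.-1 a)).

(* All sequences of positive integers with sum n (for n = 0, the empty one). *)
Definition compositions (n : nat) : seq (seq nat) :=
  flatten [seq [seq c <- [seq map val (t : seq 'I_n.+1) | t : r.-tuple 'I_n.+1]
                  | all (leq 1) c && (sumn c == n)] | r <- iota 0 n.+1].

(* sgn(i_1, ..., i_r) = (r-1)(i_1-1) + (r-2)(i_2-1) + ... + (i_(r-1)-1) *)
Definition sgn (c : seq nat) : int :=
  \sum_(u < size c) ((size c)%:Z - u.+1%:Z) * ((nth 0%N c u)%:Z - 1).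

Definition deg_m (n : nat) : int := 2 - n%:Z.
Definition deg_f (n : nat) : int := 1 - n%:Z.
Definition deg_h (n : nat) : int := - n%:Z.

Definition ops (A B : grBimod) (dg : nat -> int) (F : seq A -> B)
    (c : seq nat) : seq (op A B) := [seq Op i (dg i) F | i <- c].

(* \sum_(r+s+t=n) (-1)^(r+st) F_(r+1+t) (id^r (x) m_s (x) id^t) *)
Definition insert (A B : grBimod) (m : seq A -> A) (F : seq A -> B)
    (xs : seq A) : B :=
  let n := size xs in
  \sum_(r < n.+1) \sum_(s < n.+1 | (1 <= s)%N)
    \sum_(t < n.+1 | (r + s + t == n)%N)
    F (tensor (nseq r (id_op A) ++ Op s (deg_m s) m :: nseq t (id_op A)) xs)
      *~ sg (r + s * t)%N.

(* \sum_(i_1+...+i_r=n) (-1)^sgn(i_1,...,i_r) G_r (f_(i_1) (x) ... (x) f_(i_r)) *)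
Definition acomp (A B C : grBimod) (G : seq B -> C) (f : seq A -> B)
    (xs : seq A) : C :=
  \sum_(c <- compositions (size xs)) G (tensor (ops deg_f f c) xs) *~ sg (sgn c).

Definition aid (A : grBimod) (xs : seq A) : A := if xs is [:: x] then x else 0.

Record ainf_alg : Type := AinfAlg {
  acar :> grBimod;
  am : seq acar -> acar;
  am_family : bimod_family deg_m am;
  am_rel : forall xs, (1 <= size xs)%N -> insert am am xs = 0 }.

Record ainf_mor (A B : ainf_alg) : Type := AinfMor {
  afun :> seq A -> B;
  af_family : bimod_family deg_f afun;
  af_rel : forall xs, (1 <= size xs)%N ->
    insert (@am A) afun xs = acomp (@am B) afun xs }.

Definition ahtp_sgn (i : seq nat) (s : nat) (j : seq nat) : int :=
  let r := size i in let t := size j in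
  (r * t.+1)%N%:Z + (s * t)%N%:Z
  + \sum_(alpha < r) \sum_(u < alpha) (1 - (nth 0%N i u)%:Z)
  + t%:Z * \sum_(u < r) (nth 0%N i u)%:Z
  + \sum_(beta < t) \sum_(v < beta) (1 - (nth 0%N j v)%:Z).

(* \sum (-1)^sgn m_(r+1+t) (f_(i_1) (x) ... (x) f_(i_r) (x) h_s
     (x) g_(j_1) (x) ... (x) g_(j_t)), where p = i_1+...+i_r, q = j_1+...+j_t *)
Definition ahtp_insert (A B : ainf_alg) (f h g : seq A -> B) (xs : seq A) : B :=
  let n := size xs in
  \sum_(p < n.+1) \sum_(s < n.+1 | (1 <= s)%N)
    \sum_(q < n.+1 | (p + s + q == n)%N)
    \sum_(i <- compositions p) \sum_(j <- compositions q)
    am (tensor (ops deg_f f i ++ Op s (deg_h s) h :: ops deg_f g j) xs)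
      *~ sg (ahtp_sgn i s j).

Definition ainf_homotopic (A B : ainf_alg) (f g : seq A -> B) : Prop :=
  exists2 h : seq A -> B, bimod_family deg_h h &
    forall xs, (1 <= size xs)%N ->
      f xs - g xs = insert (@am A) h xs + ahtp_insert f h g xs.

Definition ainf_homotopy_equivalence (A B : ainf_alg) (f : ainf_mor A B) : Prop :=
  exists g : ainf_mor B A, ainf_homotopic (acomp g f) (@aid A) /\
                           ainf_homotopic (acomp f g) (@aid B).

Section Modules.
Variable A : ainf_alg.

(* The data of an A-infinity-module, without its axioms. *)
Record premod : Type := Premod { mcar :> grMod; mm : mcar -> seq A -> mcar }.

(* \sum_(r+s+t=n; r,s>=1) (-1)^(r+st) F_(r+1+t) (id^r (x) m_s (x) id^t) *)
Definition minsert (M N : grMod) (F : M -> seq A -> N) (x : M) (a : seq A) : N :=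
  let n := (size a).+1 in
  \sum_(r < n.+1 | (1 <= r)%N) \sum_(s < n.+1 | (1 <= s)%N)
    \sum_(t < n.+1 | (r + s + t == n)%N)
    rtensor F 1 (fun y _ => y)
      (nseq r.-1 (id_op A) ++ Op s (deg_m s) (@am A) :: nseq t (id_op A)) x a
      *~ sg (r + s * t)%N.

(* \sum_(r+s=n; r>=1) (-1)^(e r s) G_(1+s) (F_r (x) id^s) *)
Definition mcompose (M N P : grMod) (e : nat -> nat -> nat)
    (G : N -> seq A -> P) (F : M -> seq A -> N) (x : M) (a : seq A) : P :=
  let n := (size a).+1 in
  \sum_(r < n.+1 | (1 <= r)%N) \sum_(s < n.+1 | (r + s == n)%N)
    rtensor G r F (nseq s (id_op A)) x a *~ sg (e r s).

Definition is_ainf_mod (M : premod) : Prop :=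
  right_family deg_m (@mm M) /\
  forall x a, minsert (@mm M) x a
    + mcompose (fun s t => s * t)%N (@mm M) (@mm M) x a = 0.

Definition mcomp (M N P : premod) (q : N -> seq A -> P) (p : M -> seq A -> N) :
    M -> seq A -> P :=
  mcompose (fun r s => r.+1 * s)%N q p.

Definition mid (M : premod) (x : M) (a : seq A) : M :=
  if a is [::] then x else 0.

Definition is_mod_mor (M N : premod) (p : M -> seq A -> N) : Prop :=
  right_family deg_f p /\
  forall x a, minsert p x a + mcompose (fun s t => s * t)%N p (@mm M) x a
    - mcompose (fun r s => r.+1 * s)%N (@mm N) p x a = 0.

Definition mod_homotopic (M N : premod) (p q : M -> seq A -> N) : Prop :=
  exists2 h : M -> seq A -> N, right_family deg_h h &
    forall x a, p x a - q x a =
      mcompose (fun r s => r * s)%N (@mm N) h x a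
      + mcompose (fun s t => s * t)%N h (@mm M) x a
      + minsert h x a.

End Modules.

(* For a = [::] the only composition is the empty one, so that the formula also
   covers R_phi(p)_1 = p_1. *)
Definition restr (A B : ainf_alg) (phi : ainf_mor A B) (M N : grMod)
    (p : M -> seq B -> N) (x : M) (a : seq A) : N :=
  \sum_(c <- compositions (size a))
    rtensor p 1 (fun y (_ : seq A) => y) (ops deg_f phi c) x a *~ sg (sgn c).

Definition restr_mod (A B : ainf_alg) (phi : ainf_mor A B) (M : premod B) :
    premod A :=
  Premod (restr phi (@mm B M)).

End Graded.

(* The category whose objects are the x with [isob x], whose morphisms x -> y
   are the f with [isar f] modulo the relation [eqv].  The axioms are
   [is_category]. *)
Record precat : Type := Precat {
  ob : Type;
  isob : ob -> Prop;
  ar : ob -> ob -> Type;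
  isar : forall x y, ar x y -> Prop;
  eqv : forall x y, ar x y -> ar x y -> Prop;
  idc : forall x, ar x x;
  comp : forall x y z, ar y z -> ar x y -> ar x z }.

Record is_hom (C : precat) (x y : ob C) (f : ar x y) : Prop :=
  IsHom { hom_src : isob x; hom_tgt : isob y; hom_ar : isar f }.

Record is_category (C : precat) : Prop := IsCategory {
  cat_id : forall x : ob C, isob x -> is_hom (idc x);
  cat_comp : forall (x y z : ob C) (g : ar y z) (f : ar x y),
    is_hom g -> is_hom f -> is_hom (comp g f);
  cat_refl : forall (x y : ob C) (f : ar x y), is_hom f -> eqv f f;
  cat_sym : forall (x y : ob C) (f g : ar x y),
    is_hom f -> is_hom g -> eqv f g -> eqv g f;
  cat_trans : forall (x y : ob C) (f g h : ar x y),
    is_hom f -> is_hom g -> is_hom h -> eqv f g -> eqv g h -> eqv f h;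
  cat_eqv : forall (x y z : ob C) (g g' : ar y z) (f f' : ar x y),
    is_hom g -> is_hom g' -> is_hom f -> is_hom f' ->
    eqv g g' -> eqv f f' -> eqv (comp g f) (comp g' f');
  cat_idl : forall (x y : ob C) (f : ar x y),
    is_hom f -> eqv (comp (idc y) f) f;
  cat_idr : forall (x y : ob C) (f : ar x y),
    is_hom f -> eqv (comp f (idc x)) f;
  cat_assoc : forall (x y z w : ob C) (h : ar z w) (g : ar y z) (f : ar x y),
    is_hom h -> is_hom g -> is_hom f ->
    eqv (comp h (comp g f)) (comp (comp h g) f) }.

Record prefunctor (C D : precat) : Type := Prefunctor {
  fob :> ob C -> ob D;
  far : forall x y, ar x y -> ar (fob x) (fob y) }.

Record is_functor (C D : precat) (F : prefunctor C D) : Prop := IsFunctor {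
  fun_dom : is_category C;
  fun_cod : is_category D;
  fun_ob : forall x, isob x -> isob (F x);
  fun_ar : forall x y (f : ar x y), is_hom f -> is_hom (far F f);
  fun_eqv : forall x y (f g : ar x y),
    is_hom f -> is_hom g -> eqv f g -> eqv (far F f) (far F g);
  fun_id : forall x, isob x -> eqv (far F (idc x)) (idc (F x));
  fun_comp : forall x y z (g : ar y z) (f : ar x y),
    is_hom g -> is_hom f ->
    eqv (far F (comp g f)) (comp (far F g) (far F f)) }.

Definition id_functor (C : precat) : prefunctor C C :=
  Prefunctor (fob := fun x => x) (fun x y f => f).

Definition comp_functor (C D E : precat) (G : prefunctor D E)
    (F : prefunctor C D) : prefunctor C E :=
  Prefunctor (fob := fun x => G (F x)) (fun x y f => far G (far F f)).

Definition is_iso (C : precat) (x y : ob C) (f : ar x y) : Prop :=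
  is_hom f /\ exists g : ar y x,
    [/\ is_hom g, eqv (comp g f) (idc x) & eqv (comp f g) (idc y)].

Definition isomorphic_functors (C D : precat) (F G : prefunctor C D) : Prop :=
  [/\ is_functor F, is_functor G &
    exists theta : forall x, ar (F x) (G x),
      (forall x, isob x -> is_iso (theta x)) /\
      (forall x y (f : ar x y), is_hom f ->
         eqv (comp (theta y) (far F f)) (comp (far G f) (theta x)))].

Definition is_equivalence (C D : precat) (F : prefunctor C D) : Prop :=
  is_functor F /\ exists G : prefunctor D C,
    [/\ is_functor G,
        isomorphic_functors (comp_functor G F) (id_functor C) &
        isomorphic_functors (comp_functor F G) (id_functor D)].

Definition hMod (k : fieldType) (S : falgType k) (A : ainf_alg S) : precat :=
  {| ob := premod A;
     isob := @is_ainf_mod k S A;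
     ar := fun M N => M -> seq A -> N;
     isar := @is_mod_mor k S A;
     eqv := @mod_homotopic k S A;
     idc := @mid k S A;
     comp := @mcomp k S A |}.

Definition hRestr (k : fieldType) (S : falgType k) (A B : ainf_alg S)
    (phi : ainf_mor A B) : prefunctor (hMod B) (hMod A) :=
  @Prefunctor (hMod B) (hMod A) (@restr_mod k S A B phi)
    (fun M N => @restr k S A B phi M N).

(* Main.v *)
From HB Require Import structures.
Require Import Defs.
From mathcomp Require Import all_boot all_order all_algebra all_field.
From mathcomp Require Import boolp classical_sets functions cardinality fsbigop.
From mathcomp Require Import ring zify.

(* After conjugation by the involution [twist] (the bar construction) all signs
   are absorbed in the sign operator [susp_sgn] on letters.  A module becomes a
   solution mu of D mu + mu mu = 0, where the product [fmul] is the composition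
   of the comodule maps M (x) T(A) -> N (x) T(A), and D ([fam_dif]) is the odd
   derivation induced by the coderivation of T(A); a morphism is an even family
   p with D p = nu p - p mu, and homotopies are primitives for the resulting
   differential.  Restriction R_f is multiplicative and commutes with D.  A
   homotopy h from f to g induces an operator H ([fam_htp]) with
     H(q p) = R_g(q) H(p) +/- H(q) R_f(p)  and  R_f - R_g = D H + H D.
   Applied to D mu = - mu mu this shows that 1 - H(mu) is a morphism from
   R_f(mu) to R_g(mu), natural up to the homotopy H(p); it is invertible because
   H(mu) vanishes on the empty word, so that the geometric series is finite on
   every word.  The second part follows from R_g R_f = R_(f g), R_id = id. *)

Set Implicit Arguments.
Unset Strict Implicit.
Unset Printing Implicit Defensive.

Import GRing.Theory.

Local Open Scope classical_set_scope.
Local Open Scope ring_scope.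

(** * Sums over words *)

(** The involution is the suspension in disguise: s (x) ... (x) s multiplies x_1 (x) ... (x) x_n by
    (-1)^(sum of (n-i)|x_i|), and this diagonal sign can be put on words without building a shifted
    module. Families are functions on lists, so what a tensor product over S would give for free,
    namely that sums of composites are again additive, balanced, linear and of the right degree, has
    to be proved for each operation. The operations on words are sums over the ways to cut a word,
    and their rules are coalgebra identities: coalgebra maps and coderivations of T(A) are
    determined by their components on letters, so the A-infinity relations, which speak of letters,
    extend to all words by induction on the first block. A homotopy has [f]-blocks before and
    [g]-blocks after the block of [h], while in a product q p the factor p takes the leading
    letters; this order gives the rule for H(q p) its shape and the isomorphism its direction. *)

Inductive zmod_expr :=
  ZAtom of nat | ZZero | ZAdd of zmod_expr & zmod_expr | ZOpp of zmod_expr.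

Section ZmodExpr.
Variable V : zmodType.

Fixpoint zmod_eval (env : seq V) (e : zmod_expr) : V :=
  match e with
  | ZAtom i => nth 0 env i
  | ZZero => 0
  | ZAdd e1 e2 => zmod_eval env e1 + zmod_eval env e2
  | ZOpp e1 => - zmod_eval env e1
  end.

(** Families form abelian groups but no ring, since products join families between different
    modules; linear identities are therefore decided by comparing the coefficients of atoms. *)
Fixpoint zmod_coef (e : zmod_expr) (i : nat) : int :=
  match e with
  | ZAtom j => if i == j then 1 else 0
  | ZZero => 0
  | ZAdd e1 e2 => zmod_coef e1 i + zmod_coef e2 i
  | ZOpp e1 => - zmod_coef e1 i
  end.

Lemma zmod_evalE env e :
  zmod_eval env e = \sum_(i < size env) nth 0 env i *~ zmod_coef e i.
Proof.
elim: e => [j||e1 IH1 e2 IH2|e1 IH1] /=.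
- case: (ltnP j (size env)) => [lt_j|ge_j].
    rewrite (bigD1 (Ordinal lt_j)) //= eqxx mulr1z big1 ?addr0 // => i ij.
    by rewrite ifN // mulr0z.
  rewrite nth_default // big1 // => i _.
  by rewrite ifN ?mulr0z // neq_ltn (leq_trans (ltn_ord i)).
- by rewrite big1 // => i _; rewrite mulr0z.
- rewrite IH1 IH2 -big_split; apply: eq_bigr => i _; exact/esym/mulrzDr.
- rewrite IH1 -sumrN; apply: eq_bigr => i _; exact/esym/mulrNz.
Qed.

Lemma zmod_expr_correct env e1 e2 :
  all (fun i => zmod_coef e1 i == zmod_coef e2 i) (iota 0 (size env)) ->
  zmod_eval env e1 = zmod_eval env e2.
Proof.
move=> /allP e12; rewrite !zmod_evalE; apply: eq_bigr => i _.
by rewrite (eqP (e12 _ _)) // mem_iota ltn_ord.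
Qed.

End ZmodExpr.

(* Atoms are compared up to conversion, since they may differ by eta. *)
Ltac zmod_index x env :=
  lazymatch env with
  | ?y :: ?env' =>
      match env with
      | _ => let _ := match env with _ => unify x y end in constr:(O)
      | _ => let i := zmod_index x env' in constr:(S i)
      end
  end.

Ltac zmod_mem x env :=
  lazymatch env with
  | nil => constr:(false)
  | ?y :: ?env' =>
      match env with
      | _ => let _ := match env with _ => unify x y end in constr:(true)
      | _ => zmod_mem x env'
      end
  end.

Ltac zmod_atoms t env :=
  lazymatch t with
  | GRing.add ?a ?b => let env' := zmod_atoms a env in zmod_atoms b env'
  | GRing.opp ?a => zmod_atoms a env
  | GRing.zero => env
  | _ => lazymatch zmod_mem t env with
         | true => env
         | false => constr:(t :: env)
         end
  end.

Ltac zmod_reify t env :=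
  lazymatch t with
  | GRing.add ?a ?b =>
      let ea := zmod_reify a env in
      let eb := zmod_reify b env in constr:(ZAdd ea eb)
  | GRing.opp ?a => let ea := zmod_reify a env in constr:(ZOpp ea)
  | GRing.zero => constr:(ZZero)
  | _ => let i := zmod_index t env in constr:(ZAtom i)
  end.

(* Decides equalities that hold in every abelian group. *)
Ltac zmod :=
  lazymatch goal with
  | |- @eq ?T ?a ?b =>
      let env := zmod_atoms a (@nil T) in
      let env := zmod_atoms b env in
      let ea := zmod_reify a env in
      let eb := zmod_reify b env in
      exact: (@zmod_expr_correct _ env ea eb isT)
  end.

(** A predicate on bare functions, because it is applied to functions that arise by freezing all
    arguments but one. *)
Definition additive_fun (U V : zmodType) (phi : U -> V) : Prop :=
  forall x y, phi (x + y) = phi x + phi y.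

Section AdditiveFun.
Variables (U V : zmodType) (phi : U -> V) (phiD : additive_fun phi).

Lemma additive_fun0 : phi 0 = 0.
Proof. by apply: (addrI (phi 0)); rewrite -phiD !addr0. Qed.

Lemma additive_funN x : phi (- x) = - phi x.
Proof. by apply: (addrI (phi x)); rewrite -phiD !subrr additive_fun0. Qed.

Lemma additive_funB x y : phi (x - y) = phi x - phi y.
Proof. by rewrite phiD additive_funN. Qed.

Lemma additive_fun_sum I r (P : pred I) F :
  phi (\sum_(i <- r | P i) F i) = \sum_(i <- r | P i) phi (F i).
Proof. exact: (big_morph phi phiD additive_fun0). Qed.

Lemma additive_funMz x (n : int) : phi (x *~ n) = phi x *~ n.
Proof.
have phiMn m : phi (x *+ m) = phi x *+ m.
  by elim: m => [|m IH]; rewrite ?mulr0n ?additive_fun0 // !mulrS phiD IH.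
by case: n => n; rewrite ?NegzE ?mulrNz -!pmulrn ?additive_funN phiMn.
Qed.

End AdditiveFun.

(** * Deconcatenation of words *)

Section SplitSum.
Variables (A : Type) (V : zmodType).
Implicit Types (F G : seq A -> seq A -> V) (a : seq A).

(** This is [F] on the deconcatenation coproduct of [a]; either part may be empty. *)
Definition split_sum F a : V := \sum_(i < (size a).+1) F (take i a) (drop i a).

Lemma split_sum_nil F : split_sum F [::] = F [::] [::].
Proof. by rewrite /split_sum big_ord1. Qed.

Lemma split_sum_cons F y a :
  split_sum F (y :: a)
  = F [::] (y :: a) + split_sum (fun a1 a2 => F (y :: a1) a2) a.
Proof. by rewrite /split_sum big_ord_recl. Qed.

Lemma split_sum_cat_cons F u y v :
  split_sum F (u ++ y :: v)
  = split_sum (fun u1 u2 => F u1 (u2 ++ y :: v)) u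
    + split_sum (fun v1 v2 => F (u ++ y :: v1) v2) v.
Proof.
elim: u F => [|z u IH] F /=; first by rewrite split_sum_cons split_sum_nil.
by rewrite !split_sum_cons IH addrA.
Qed.

Lemma split_sum_rcons F u y :
  split_sum F (rcons u y)
  = split_sum (fun u1 u2 => F u1 (rcons u2 y)) u + F (rcons u y) [::].
Proof.
elim: u F => [|z u IH] F /=; first by rewrite split_sum_cons !split_sum_nil.
by rewrite !split_sum_cons IH addrA.
Qed.

Lemma eq_split_sum F G a :
  (forall a1 a2, a1 ++ a2 = a -> F a1 a2 = G a1 a2) ->
  split_sum F a = split_sum G a.
Proof. by move=> FG; apply: eq_bigr => i _; apply: FG; rewrite cat_take_drop. Qed.

Lemma split_sumD F G a :
  split_sum (fun a1 a2 => F a1 a2 + G a1 a2) a = split_sum F a + split_sum G a.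
Proof. exact: big_split. Qed.

Lemma split_sumN F a :
  split_sum (fun a1 a2 => - F a1 a2) a = - split_sum F a.
Proof. exact: sumrN. Qed.

Lemma split_sumB F G a :
  split_sum (fun a1 a2 => F a1 a2 - G a1 a2) a = split_sum F a - split_sum G a.
Proof. by rewrite split_sumD split_sumN. Qed.

Lemma split_sum0 F a :
  (forall a1 a2, a1 ++ a2 = a -> F a1 a2 = 0) -> split_sum F a = 0.
Proof. by move=> F0; apply: big1 => i _; apply: F0; rewrite cat_take_drop. Qed.

(** Coassociativity: both sides run over the cuts of [a] into three parts. *)
Lemma split_sumA (F : seq A -> seq A -> seq A -> V) a :
  split_sum (fun a1 a2 => split_sum (fun b1 b2 => F b1 b2 a2) a1) a
  = split_sum (fun a1 a2 => split_sum (fun b1 b2 => F a1 b1 b2) a2) a.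
Proof.
elim: a F => [|y a IH] F; first by rewrite !split_sum_nil.
rewrite !split_sum_cons split_sum_nil.
under eq_split_sum do rewrite split_sum_cons.
by rewrite split_sumD IH addrA.
Qed.

End SplitSum.

Lemma exchange_split_sum (A B : Type) (V : zmodType)
    (F : seq A -> seq A -> seq B -> seq B -> V) a b :
  split_sum (fun a1 a2 => split_sum (F a1 a2) b) a
  = split_sum (fun b1 b2 => split_sum (fun a1 a2 => F a1 a2 b1 b2) a) b.
Proof. exact: exchange_big. Qed.

Lemma additive_split_sum (A : Type) (V W : zmodType) (phi : V -> W)
    (phiD : additive_fun phi) (F : seq A -> seq A -> V) a :
  phi (split_sum F a) = split_sum (fun a1 a2 => phi (F a1 a2)) a.
Proof. exact: additive_fun_sum. Qed.

(** * Compositions of an integer and blocks of a word *)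

Lemma mem_compositions n c :
  (c \in compositions n) = all (leq 1) c && (sumn c == n).
Proof.
apply/flatten_mapP/idP => [[r _]|/andP[c_pos /eqP c_n]].
  by rewrite mem_filter => /andP[].
exists (size c).
  rewrite mem_iota /= ltnS -c_n.
  elim: c c_pos {c_n} => //= i c IH /andP[i_pos /IH]; lia.
rewrite mem_filter c_pos c_n eqxx /=.
have c_lt : all (fun i => (i < n.+1)%N) c.
  rewrite -c_n; elim: c {c_pos c_n} => //= i c IH.
  rewrite ltnS leq_addr /=; apply: sub_all IH => j; lia.
have sz : size (map (inord : nat -> 'I_n.+1) c) == size c by rewrite size_map.
apply/mapP; exists (Tuple sz); first by rewrite mem_enum.
rewrite /= -map_comp -[LHS]map_id; apply/eq_in_map => i ic /=.
by rewrite inordK // (allP c_lt).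
Qed.

Lemma uniq_compositions n : uniq (compositions n).
Proof.
have size_mem r c : c \in [seq c <- [seq map val (t : seq 'I_n.+1)
    | t : r.-tuple 'I_n.+1] | all (leq 1) c && (sumn c == n)] -> size c = r.
  by rewrite mem_filter => /andP[_ /mapP[t _ ->]]; rewrite size_map size_tuple.
rewrite /compositions; elim: (iota 0 n.+1) (iota_uniq 0 n.+1) => //= r s IH.
move=> /andP[rs s_uniq]; rewrite cat_uniq IH // andbT; apply/andP; split.
  rewrite filter_uniq // map_inj_uniq ?enum_uniq // => t1 t2.
  by move/inj_map => /(_ val_inj) t12; apply: val_inj.
apply/hasPn => c /flatten_mapP[q qs cq]; apply/negP => cr.
by move: rs; rewrite -(size_mem _ _ cr) (size_mem _ _ cq) qs.
Qed.

Lemma compositions0 : compositions 0 = [:: [::]].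
Proof.
apply: perm_small_eq => //; apply: uniq_perm => [||c].
- exact: uniq_compositions.
- by [].
- by case: c => [|[|i] c]; rewrite mem_compositions inE /= ?addSn ?andbF.
Qed.

(** This turns the filtered enumeration of tuples into the recursion on the first block that later
    inductions use. Both lists are free of duplicates and have the same members, hence are
    permutations of each other. *)
Lemma sum_compositions_recl (V : zmodType) (F : seq nat -> V) n :
  \sum_(c <- compositions n.+1) F c
  = \sum_(i < n.+1) \sum_(c <- compositions (n - i)) F (i.+1 :: c).
Proof.
transitivity (\sum_(i <- iota 0 n.+1)
    \sum_(c <- map (cons i.+1) (compositions (n - i))) F c); last first.
  rewrite -[iota 0 n.+1]/(index_iota 0 n.+1) big_mkord.
  by apply: eq_bigr => i _; rewrite big_map.
rewrite -(big_map (fun i => map (cons i.+1) (compositions (n - i))) predT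
  (fun s => \sum_(c <- s) F c)) -big_flatten.
apply/perm_big/uniq_perm => [||c].
- exact: uniq_compositions.
- elim: (iota 0 n.+1) (iota_uniq 0 n.+1) => //= r s IH /andP[rs s_uniq].
  rewrite cat_uniq IH // andbT map_inj_uniq ?uniq_compositions => [/=|? ? []//].
  apply/hasPn => c /flatten_mapP[q qs /mapP[c' _ ->]]; apply/negP.
  by move=> /mapP[c'' _ [qr _]]; rewrite -qr qs in rs.
rewrite mem_compositions; apply/idP/flatten_mapP.
  case: c => [|[|i] c] //= /andP[c_pos /eqP [c_n]].
  exists i; first by rewrite (mem_iota 0 n.+1); lia.
  by apply/mapP; exists c => //; rewrite mem_compositions c_pos; lia.
move=> [i]; rewrite mem_iota => i_n /mapP[c' + ->].
rewrite mem_compositions => /andP[/= -> /eqP ->]; lia.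
Qed.

Section BlockSum.
Variables (A B : Type) (V : zmodType) (f : seq A -> B).
Implicit Types (K : seq B -> V) (a : seq A).

(* The sum of K [:: f a_1; ...; f a_r] over all ways to cut a into nonempty
   blocks a_1, ..., a_r. *)
Definition block_sum K a : V :=
  \sum_(c <- compositions (size a)) K (map f (reshape c a)).

Lemma block_sum_nil K : block_sum K [::] = K [::].
Proof. by rewrite /block_sum compositions0 big_seq1. Qed.

Lemma block_sum_cons K y a :
  block_sum K (y :: a)
  = split_sum (fun a1 a2 => block_sum (fun w => K (f (y :: a1) :: w)) a2) a.
Proof.
rewrite /block_sum sum_compositions_recl; apply: eq_bigr => i _.
by rewrite size_drop.
Qed.

Lemma eq_block_sum K K' a :
  (forall w, K w = K' w) -> block_sum K a = block_sum K' a.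
Proof. by move=> KK'; apply: eq_bigr. Qed.

Lemma block_sumD K K' a :
  block_sum (fun w => K w + K' w) a = block_sum K a + block_sum K' a.
Proof. exact: big_split. Qed.

Lemma block_sumN K a : block_sum (fun w => - K w) a = - block_sum K a.
Proof. exact: sumrN. Qed.

Lemma block_sum0 K a : (forall w, K w = 0) -> block_sum K a = 0.
Proof. by move=> K0; apply: big1. Qed.

Lemma block_sum_split_sum C (F : seq B -> seq C -> seq C -> V) a b :
  block_sum (fun w => split_sum (F w) b) a
  = split_sum (fun b1 b2 => block_sum (fun w => F w b1 b2) a) b.
Proof. exact: exchange_big. Qed.

End BlockSum.

Lemma block_sum_block_sum (A B C D : Type) (V : zmodType) (f : seq A -> B)
    (g : seq C -> D) (F : seq B -> seq D -> V) a b :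
  block_sum f (fun w => block_sum g (F w) b) a
  = block_sum g (fun w' => block_sum f (F^~ w') a) b.
Proof. exact: exchange_big. Qed.

Lemma additive_block_sum (A B : Type) (V W : zmodType) (phi : V -> W)
    (phiD : additive_fun phi) (f : seq A -> B) (K : seq B -> V) a :
  phi (block_sum f K a) = block_sum f (fun w => phi (K w)) a.
Proof. exact: additive_fun_sum. Qed.

(** Removing the first block shortens a word by an unknown amount, so inductions on blocks need the
    hypothesis for all shorter words. *)
Lemma size_ind (A : Type) (P : seq A -> Prop) :
  P [::] ->
  (forall y a, (forall a', (size a' <= size a)%N -> P a') -> P (y :: a)) ->
  forall a, P a.
Proof.
move=> P0 PS a; have [n le_an] := ubnP (size a).
elim: n a le_an => // n IH [|y a] //= /ltnSE le_an.
by apply: PS => a' le_a'; apply: IH; apply: leq_ltn_trans le_an.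
Qed.

Lemma split_sum_size (A : Type) (V : zmodType) (F G : seq A -> seq A -> V) a :
  (forall a1 a2, (size a2 <= size a)%N -> F a1 a2 = G a1 a2) ->
  split_sum F a = split_sum G a.
Proof.
move=> FG; apply: eq_split_sum => a1 a2 a12; apply: FG.
by rewrite -a12 size_cat leq_addl.
Qed.

(** The map T(A) -> T(B) induced by [f] respects deconcatenation: a cut between blocks is a cut of
    the word followed by a division of each part. *)
Lemma block_sum_split (A B : Type) (V : zmodType) (f : seq A -> B)
    (F : seq B -> seq B -> V) a :
  block_sum f (split_sum F) a
  = split_sum (fun a1 a2 =>
      block_sum f (fun w1 => block_sum f (F w1) a2) a1) a.
Proof.
elim/size_ind: a F => [|y a IH] F.
  by rewrite split_sum_nil !block_sum_nil split_sum_nil.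
rewrite block_sum_cons split_sum_cons block_sum_nil.
under eq_split_sum do under eq_block_sum do rewrite split_sum_cons.
under eq_split_sum do rewrite block_sumD.
rewrite split_sumD block_sum_cons; congr (_ + _).
under split_sum_size => a1 a2 le_a2 do rewrite IH //.
under [RHS]eq_split_sum do rewrite block_sum_cons.
by rewrite split_sumA.
Qed.

Definition multiadditive (A V : zmodType) (K : seq A -> V) : Prop :=
  forall u v, additive_fun (fun y => K (u ++ y :: v)).

Lemma multiadditive_cons (A V : zmodType) (K : seq A -> V) x :
  multiadditive K -> multiadditive (fun w => K (x :: w)).
Proof. by move=> KD u v; apply: (KD (x :: u) v). Qed.

(** * Coderivations of the tensor coalgebra *)

Section Insertion.
Variables (A : Type) (s : A -> A) (b : seq A -> A).

(* \sum K (s a_1 ++ b a_2 :: a_3) over a = a_1 ++ a_2 ++ a_3, a_2 nonempty *)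
Fixpoint insert_sum (V : zmodType) (K : seq A -> V) (a : seq A) : V :=
  if a is y :: a' then
    split_sum (fun a1 a2 => K (b (y :: a1) :: a2)) a'
    + insert_sum (fun w => K (s y :: w)) a'
  else 0.

Variable V : zmodType.
Implicit Types (K : seq A -> V) (a : seq A).

(** The recursive form suits inductions; this closed form is the one matched with the triple sums of
    the A-infinity relations. *)
Lemma insert_sumE K a :
  insert_sum K a
  = split_sum (fun a1 a' => if a' is y :: a'' then
      split_sum (fun a2 a3 => K (map s a1 ++ b (y :: a2) :: a3)) a''
      else 0) a.
Proof.
elim: a K => [|y a IH] K; first by rewrite split_sum_nil.
by rewrite /= split_sum_cons IH.
Qed.

Lemma eq_insert_sum K K' a :
  (forall w, K w = K' w) -> insert_sum K a = insert_sum K' a.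
Proof. by move=> KK'; congr insert_sum; apply: funext. Qed.

Lemma insert_sumD K K' a :
  insert_sum (fun w => K w + K' w) a = insert_sum K a + insert_sum K' a.
Proof.
by elim: a K K' => [|y a IH] K K' /=; rewrite ?addr0 // split_sumD IH; zmod.
Qed.

Lemma insert_sum0 K a : (forall w, (0 < size w)%N -> K w = 0) -> insert_sum K a = 0.
Proof.
elim: a K => //= y a IH K K0; rewrite IH ?addr0 => [|w _]; last exact: K0.
by apply: split_sum0 => a1 a2 _; apply: K0.
Qed.

(** The coderivation rule: the letter made by [b] lies left or right of the cut, and in the second
    case [b] has passed all letters on the left, whence [map s a1]. *)
Lemma insert_sum_split (F : seq A -> seq A -> V) a :
  insert_sum (split_sum F) a
  = split_sum (fun a1 a2 => insert_sum (F^~ a2) a1) a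
    + split_sum (fun a1 a2 => insert_sum (F (map s a1)) a2) a.
Proof.
elim: a F => [|y a IH] F; first by rewrite !split_sum_nil addr0.
rewrite /= !split_sum_cons /=.
under eq_split_sum do rewrite split_sum_cons.
under eq_insert_sum do rewrite split_sum_cons.
rewrite insert_sumD IH !split_sumD split_sumA /=; zmod.
Qed.

End Insertion.

Lemma additive_insert_sum (A : Type) (s : A -> A) b (V W : zmodType)
    (phi : V -> W) (phiD : additive_fun phi) (K : seq A -> V) a :
  phi (insert_sum s b K a) = insert_sum s b (fun w => phi (K w)) a.
Proof.
elim: a K => [|y a IH] K /=; first exact: additive_fun0.
by rewrite phiD additive_split_sum // IH.
Qed.

Lemma insert_sumN (A : Type) (s : A -> A) b (V : zmodType)
    (K : seq A -> V) a :
  insert_sum s b (fun w => - K w) a = - insert_sum s b K a.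
Proof.
by rewrite -(additive_insert_sum s b (phi := -%R)) // => x y; rewrite opprD.
Qed.

Section Restriction.
Variables (A : Type) (B V : zmodType) (sA : A -> A) (sB : B -> B).
Variables (bA : seq A -> A) (bB : seq B -> B) (f : seq A -> B).
Hypothesis f_even : forall y a, f (sA y :: map sA a) = sB (f (y :: a)).
Hypothesis f_mor : forall y a,
  insert_sum sA bA f (y :: a) = block_sum f bB (y :: a).

(** A coalgebra map that intertwines two coderivations on letters, as [f_mor] says, does so on
    words. If the insertion meets the first block, this is [f_mor] in the first slot of [K];
    otherwise the sign passes that block by [f_even] and induction applies to the rest. *)
Lemma insert_block_sum (K : seq B -> V) a : multiadditive K ->
  block_sum f (insert_sum sB bB K) a = insert_sum sA bA (block_sum f K) a.
Proof.
elim/size_ind: a K => [|y a IH] K KD; first by rewrite block_sum_nil.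
have KD1 w : additive_fun (fun x => K (x :: w)) by apply: (KD [::] w).
rewrite block_sum_cons /=.
under eq_split_sum do rewrite block_sumD block_sum_split.
rewrite split_sumD.
under [X in _ + X]split_sum_size => a1 a2 le_a2
  do rewrite (IH _ le_a2 _ (multiadditive_cons _ KD)).
under [in RHS]eq_split_sum do rewrite block_sum_cons.
under [in RHS]eq_insert_sum do rewrite block_sum_cons.
rewrite insert_sum_split addrA; congr (_ + _); last first.
  by apply: eq_split_sum => a1 a2 _; rewrite f_even.
rewrite -!split_sumA -split_sumD; apply: eq_split_sum => u v _.
(* The insertion now meets the first block. With [y :: u] the part of the word that ends up in the
   first letter, [bB] collects all blocks of [y :: u], and [f_mor] trades this for insertions inside
   it. *)
transitivity (block_sum f (fun w => K (block_sum f bB (y :: u) :: w)) v).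
  rewrite block_sum_cons.
  under [RHS]eq_block_sum => w do rewrite (additive_split_sum (KD1 w)).
  rewrite block_sum_split_sum; apply: eq_split_sum => u1 u2 _.
  rewrite block_sum_block_sum; apply: eq_block_sum => w.
  by rewrite (additive_block_sum (KD1 w)).
have bsD : additive_fun (fun x => block_sum f (fun w => K (x :: w)) v).
  by move=> x x'; rewrite -block_sumD; apply: eq_block_sum => w; apply: KD1.
rewrite -f_mor /= bsD (additive_split_sum bsD).
by rewrite (additive_insert_sum _ _ bsD).
Qed.

End Restriction.

(** * Homotopies between coalgebra maps *)

Section Homotopy.
Variables (A : Type) (B : zmodType) (sB : B -> B) (f h g : seq A -> B).

(* \sum K (s f a_1, ..., s f a_r, h a', g a''_1, ..., g a''_t) *)
Definition htp_sum (V : zmodType) (K : seq B -> V) (a : seq A) : V :=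
  split_sum (fun a1 a' => if a' is y :: a'' then
    split_sum (fun a2 a3 =>
      block_sum f (fun w => block_sum g (fun w' =>
        K (map sB w ++ h (y :: a2) :: w')) a3) a1) a''
    else 0) a.

Variable V : zmodType.
Implicit Types (K : seq B -> V) (a : seq A).

Lemma htp_sum_nil K : htp_sum K [::] = 0.
Proof. by rewrite /htp_sum split_sum_nil. Qed.

Lemma htp_sum_cons K y a :
  htp_sum K (y :: a)
  = split_sum (fun a1 a2 => block_sum g (fun w => K (h (y :: a1) :: w)) a2) a
    + split_sum (fun a1 a2 => htp_sum (fun w => K (sB (f (y :: a1)) :: w)) a2) a.
Proof.
rewrite {1}/htp_sum split_sum_cons; congr (_ + _).
  by apply: eq_split_sum => a1 a2 _; rewrite block_sum_nil.
rewrite /htp_sum -split_sumA; apply: eq_split_sum => a1 [|z a2] _.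
  by rewrite split_sum0.
rewrite exchange_split_sum; apply: eq_split_sum => a3 a4 _.
by rewrite block_sum_cons.
Qed.

Lemma htp_sumD K K' a :
  htp_sum (fun w => K w + K' w) a = htp_sum K a + htp_sum K' a.
Proof.
rewrite /htp_sum -split_sumD; apply: eq_split_sum => a1 [|y a'] _.
  by rewrite addr0.
rewrite -split_sumD; apply: eq_split_sum => a2 a3 _.
by rewrite -block_sumD; apply: eq_block_sum => w; rewrite -block_sumD.
Qed.

Lemma eq_htp_sum K K' a :
  (forall w, K w = K' w) -> htp_sum K a = htp_sum K' a.
Proof. by move=> KK'; congr htp_sum; apply: funext. Qed.

(** The single letter made by [h] lies before or after the cut; the other part then consists of
    [g]-blocks behind it or of signed [f]-blocks in front of it. *)
Lemma htp_sum_split (F : seq B -> seq B -> V) a :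
  htp_sum (split_sum F) a
  = split_sum (fun a1 a2 =>
      htp_sum (fun w => block_sum g (F w) a2) a1) a
    + split_sum (fun a1 a2 =>
        block_sum f (fun w => htp_sum (F (map sB w)) a2) a1) a.
Proof.
elim/size_ind: a F => [|y a IH] F.
  by rewrite !split_sum_nil block_sum_nil !htp_sum_nil addr0.
rewrite htp_sum_cons !split_sum_cons htp_sum_nil block_sum_nil /= htp_sum_cons.
under eq_split_sum do under eq_block_sum do rewrite split_sum_cons.
under eq_split_sum do rewrite block_sumD block_sum_split.
under [X in _ + X = _]eq_split_sum do under eq_htp_sum do rewrite split_sum_cons.
under [X in _ + X = _]split_sum_size => a1 a2 le_a2 do rewrite htp_sumD IH //.
under [X in _ = _ + X + _]eq_split_sum do rewrite htp_sum_cons.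
under [X in _ = _ + _ + (_ + X)]eq_split_sum do rewrite block_sum_cons.
rewrite !split_sumD !split_sumA; zmod.
Qed.

End Homotopy.

Lemma additive_htp_sum (A : Type) (B : zmodType) (sB : B -> B)
    (f h g : seq A -> B) (V W : zmodType)
    (phi : V -> W) (phiD : additive_fun phi) (K : seq B -> V) a :
  phi (htp_sum sB f h g K a) = htp_sum sB f h g (fun w => phi (K w)) a.
Proof.
rewrite /htp_sum additive_split_sum //; apply: eq_split_sum => a1 [|y a'] _.
  exact: additive_fun0.
rewrite additive_split_sum //; apply: eq_split_sum => a2 a3 _.
rewrite (additive_block_sum phiD); apply: eq_block_sum => w.
exact: additive_block_sum.
Qed.

Lemma htp_sumN (A : Type) (B : zmodType) (sB : B -> B) (f h g : seq A -> B)
   (V : zmodType) (K : seq B -> V) a :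
  htp_sum sB f h g (fun w => - K w) a = - htp_sum sB f h g K a.
Proof.
by rewrite -(additive_htp_sum _ _ _ _ (phi := -%R)) // => x y; rewrite opprD.
Qed.

Section HomotopyFormula.
Variables (A : Type) (B V : zmodType) (sA : A -> A) (sB : B -> B).
Variables (bA : seq A -> A) (bB : seq B -> B) (f h g : seq A -> B).
Hypothesis sBD : additive_fun sB.
Hypothesis sBK : involutive sB.
Hypothesis bB_odd : forall y a, bB (sB y :: map sB a) = - sB (bB (y :: a)).
Hypothesis f_even : forall y a, f (sA y :: map sA a) = sB (f (y :: a)).
Hypothesis g_even : forall y a, g (sA y :: map sA a) = sB (g (y :: a)).
Hypothesis h_odd : forall y a, h (sA y :: map sA a) = - sB (h (y :: a)).
Hypothesis f_mor : forall y a,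
  insert_sum sA bA f (y :: a) = block_sum f bB (y :: a).
Hypothesis g_mor : forall y a,
  insert_sum sA bA g (y :: a) = block_sum g bB (y :: a).
Hypothesis h_htp : forall y a, f (y :: a) - g (y :: a) =
  insert_sum sA bA h (y :: a) + htp_sum sB f h g bB (y :: a).

(** For the coalgebra maps F and G of [f] and [g], both sides are coderivations along F and G, so
    the identity is forced by its component on letters, [h_htp]. *)
Lemma block_sum_homotopy (K : seq B -> V) a : multiadditive K ->
  block_sum f K a - block_sum g K a
  = insert_sum sA bA (htp_sum sB f h g K) a
    + htp_sum sB f h g (insert_sum sB bB K) a.
Proof.
elim/size_ind: a K => [|y a IH] K KD.
  by rewrite htp_sum_nil !block_sum_nil subrr addr0.
have KD1 w : additive_fun (fun x => K (x :: w)) by apply: (KD [::] w).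
pose Gs v x := block_sum g (fun w => K (x :: w)) v.
pose Hs v x := htp_sum sB f h g (fun w => K (x :: w)) v.
have GsD v : additive_fun (Gs v).
  by move=> x x'; rewrite -block_sumD; apply: eq_block_sum => w; apply: KD1.
have HsD v : additive_fun (Hs v).
  by move=> x x'; rewrite -htp_sumD; apply: eq_htp_sum => w; apply: KD1.
(* The terms by their first letter: [T1] is an [h]-block containing an insertion, [T2] is [bB] of
   blocks one of which is made by [h], [T3] is an [f]-block containing an insertion with [h] later,
   [T4] an [h]-block with an insertion later, [T5] an [f]-block with both later. [T3] and [T4]
   cancel, [T1 + T2] puts [f - g] into the first slot by [h_htp], and [T5] is absorbed by
   induction. *)
pose T1 := split_sum (fun u v => Gs v (insert_sum sA bA h (y :: u))) a.
pose T2 := split_sum (fun u v => Gs v (htp_sum sB f h g bB (y :: u))) a.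
pose T3 := split_sum (fun u v => Hs v (sB (insert_sum sA bA f (y :: u)))) a.
pose T4 := split_sum (fun u v => insert_sum sA bA (Gs^~ (sB (h (y :: u)))) v) a.
pose T5 := split_sum (fun u v => insert_sum sA bA (Hs^~ (f (y :: u))) v) a.
have -> : insert_sum sA bA (htp_sum sB f h g K) (y :: a) = T1 + T3 - T4 + T5.
  rewrite /=; under eq_split_sum do rewrite htp_sum_cons.
  under eq_insert_sum do rewrite htp_sum_cons.
  rewrite insert_sumD !insert_sum_split !split_sumD -!split_sumA.
  have -> : T1 = split_sum (fun u v => split_sum (fun u1 u2 =>
      Gs v (h (bA (y :: u1) :: u2))) u) a
      + split_sum (fun u v => insert_sum sA bA (fun w => Gs v (h (sA y :: w))) u) a.
    rewrite -split_sumD; apply: eq_split_sum => u v _ /=.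
    by rewrite GsD additive_split_sum // (additive_insert_sum _ _ (GsD v)).
  have -> : T3 = split_sum (fun u v => split_sum (fun u1 u2 =>
      Hs v (sB (f (bA (y :: u1) :: u2)))) u) a
      + split_sum (fun u v =>
          insert_sum sA bA (fun w => Hs v (sB (f (sA y :: w)))) u) a.
    rewrite -split_sumD; apply: eq_split_sum => u v _ /=.
    have HssD : additive_fun (fun x => Hs v (sB x)).
      by move=> x x'; rewrite sBD HsD.
    rewrite HssD (additive_split_sum HssD).
    by rewrite (additive_insert_sum _ _ HssD).
  have -> : T4 = - split_sum (fun u v =>
      insert_sum sA bA (Gs^~ (h (sA y :: map sA u))) v) a.
    rewrite -split_sumN; apply: eq_split_sum => u v _.
    rewrite -insert_sumN; apply: eq_insert_sum => w.
    by rewrite h_odd (additive_funN (GsD _)) opprK.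
  have -> : T5 = split_sum (fun u v =>
      insert_sum sA bA (Hs^~ (sB (f (sA y :: map sA u)))) v) a.
    apply: eq_split_sum => u v _; apply: eq_insert_sum => w.
    by rewrite f_even sBK.
  rewrite /Gs /Hs; zmod.
have -> : htp_sum sB f h g (insert_sum sB bB K) (y :: a)
    = T2 + T4 - T3 + (split_sum (fun u v =>
        block_sum f (fun w => K (f (y :: u) :: w)) v - Gs v (f (y :: u))) a - T5).
  rewrite htp_sum_cons /=.
  under eq_split_sum do rewrite block_sumD block_sum_split.
  under [X in _ + X = _]eq_split_sum do rewrite htp_sumD htp_sum_split.
  have -> : T2 = split_sum (fun u v => split_sum (fun u1 u2 =>
        Gs v (block_sum g (fun w => bB (h (y :: u1) :: w)) u2)) u) a
      + split_sum (fun u v => split_sum (fun u1 u2 =>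
        Gs v (htp_sum sB f h g (fun w => bB (sB (f (y :: u1)) :: w)) u2)) u) a.
    rewrite -split_sumD; apply: eq_split_sum => u v _ /=.
    by rewrite htp_sum_cons GsD !(additive_split_sum (GsD v)).
  have -> : T3 = split_sum (fun u v => split_sum (fun u1 u2 =>
        Hs v (sB (block_sum f (fun w => bB (f (y :: u1) :: w)) u2))) u) a.
    apply: eq_split_sum => u v _.
    have HssD : additive_fun (fun x => Hs v (sB x)).
      by move=> x x'; rewrite sBD HsD.
    by rewrite f_mor block_sum_cons (additive_split_sum HssD).
  rewrite !split_sumA !split_sumD.
  have rearrange (a1 a2 a3 a4 a5 b1 b2 b3 b4 b5 : V) :
      a1 = b1 -> a2 = b3 -> a3 = b2 -> a4 = - b4 -> a5 = b5 ->
      a1 + a2 + (a3 + a4 + a5) = b1 + b2 + b3 - b4 + b5.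
    by move=> -> -> -> -> ->; zmod.
  apply: rearrange.
  - apply: eq_split_sum => u v _; apply: eq_split_sum => v1 v2 _.
    by rewrite (additive_block_sum (GsD v2)).
  - apply: eq_split_sum => u v _.
    by rewrite (insert_block_sum g_even g_mor) //; apply: multiadditive_cons.
  - apply: eq_split_sum => u v _; apply: eq_split_sum => v1 v2 _.
    rewrite (additive_htp_sum _ _ _ _ (GsD v2)); exact: eq_htp_sum.
  - rewrite -split_sumN; apply: eq_split_sum => u v _.
    rewrite -split_sumN; apply: eq_split_sum => v1 v2 _.
    rewrite -(additive_funN (HsD v2)) -(additive_funN sBD).
    have HssD : additive_fun (fun x => Hs v2 (sB x)).
      by move=> x x'; rewrite sBD HsD.
    rewrite -block_sumN (additive_block_sum HssD); apply: eq_block_sum => w.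
    by apply: eq_htp_sum => w'; rewrite bB_odd (additive_funN sBD).
  - rewrite -split_sumD -split_sumB; apply: split_sum_size => u v le_v.
    have KfD := multiadditive_cons (f (y :: u)) KD.
    (* The first block is passed by both [h] and [bB], and the two signs cancel. *)
    rewrite sBK; apply: (addrI (insert_sum sA bA (Hs^~ (f (y :: u))) v)).
    by rewrite -IH // /Gs; zmod.
rewrite !block_sum_cons.
have -> : split_sum (fun a1 a2 =>
      block_sum g (fun w => K (g (y :: a1) :: w)) a2) a
    = split_sum (fun u v => Gs v (f (y :: u))) a - T1 - T2.
  rewrite -!split_sumB; apply: eq_split_sum => u v _.
  rewrite -!(additive_funB (GsD v)) -addrA -opprD -h_htp; congr Gs; zmod.
rewrite split_sumB; zmod.
Qed.

End HomotopyFormula.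

(** Dividing a word into blocks and each of these into smaller ones is the same as dividing it into
    small blocks and grouping those. Additivity of [K] opens the sum hidden in each letter. *)
Lemma block_sum_comp (A : Type) (B C V : zmodType) (f : seq A -> B)
    (g : seq B -> C) (K : seq C -> V) a : multiadditive K ->
  block_sum (block_sum f g) K a = block_sum f (block_sum g K) a.
Proof.
elim/size_ind: a K => [|y a IH] K KD; first by rewrite !block_sum_nil.
have KsD v : additive_fun
    (fun x => block_sum f (block_sum g (fun w => K (x :: w))) v).
  move=> x x'; rewrite -block_sumD; apply: eq_block_sum => w.
  by rewrite -block_sumD; apply: eq_block_sum => w'; apply: (KD [::]).
rewrite !block_sum_cons.
under [RHS]eq_split_sum do under eq_block_sum do rewrite block_sum_cons.
under [RHS]eq_split_sum do rewrite block_sum_split.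
rewrite -split_sumA; apply: split_sum_size => u v le_v.
rewrite (IH _ le_v _ (multiadditive_cons _ KD)) block_sum_cons.
rewrite (additive_split_sum (KsD v)); apply: eq_split_sum => u1 u2 _.
by rewrite (additive_block_sum (KsD v)).
Qed.

(** * Product, differential, restriction and homotopy operator on families *)

Section FamilyAlgebra.
Variables (A : Type).

Definition fmul (M N P : zmodType) (q : N -> seq A -> P) (p : M -> seq A -> N) :
    M -> seq A -> P :=
  fun x a => split_sum (fun a1 a2 => q (p x a1) a2) a.

Definition fid (M : zmodType) (x : M) (a : seq A) : M :=
  if a is [::] then x else 0.

(** The left factor of [fmul] is applied to values of the right one, so distributivity on the right
    and associativity need additivity of the left factor in its module variable. *)
Definition left_additive (M N : zmodType) (p : M -> seq A -> N) : Prop :=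
  forall a, additive_fun (p^~ a).

Lemma fmulDl (M N P : zmodType) (q q' : N -> seq A -> P) (p : M -> seq A -> N) :
  fmul (q + q') p = fmul q p + fmul q' p.
Proof. by apply/funext => x; apply/funext => a; apply: split_sumD. Qed.

Lemma fmulNl (M N P : zmodType) (q : N -> seq A -> P) (p : M -> seq A -> N) :
  fmul (- q) p = - fmul q p.
Proof. by apply/funext => x; apply/funext => a; apply: split_sumN. Qed.

Lemma fmulBl (M N P : zmodType) (q q' : N -> seq A -> P) (p : M -> seq A -> N) :
  fmul (q - q') p = fmul q p - fmul q' p.
Proof. by rewrite fmulDl fmulNl. Qed.

Lemma fmul0l (M N P : zmodType) (p : M -> seq A -> N) :
  fmul (0 : N -> seq A -> P) p = 0.
Proof. by apply/funext => x; apply/funext => a; apply: split_sum0. Qed.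

Lemma fmul1l (M N : zmodType) (p : M -> seq A -> N) : fmul (@fid N) p = p.
Proof.
apply/funext => x; apply/funext => a; rewrite /fmul.
case/lastP: a => [|a y]; first by rewrite split_sum_nil.
rewrite split_sum_rcons split_sum0 ?add0r // => a1 a2 _.
by case: a2.
Qed.

Section LeftAdditive.
Variables (M N P : zmodType) (q : N -> seq A -> P) (qD : left_additive q).
Implicit Types p : M -> seq A -> N.

Lemma fmulDr p p' : fmul q (p + p') = fmul q p + fmul q p'.
Proof.
apply/funext => x; apply/funext => a; apply: etrans (split_sumD _ _ _).
by apply: eq_split_sum => a1 a2 _; apply: qD.
Qed.

Lemma fmulNr p : fmul q (- p) = - fmul q p.
Proof.
apply/funext => x; apply/funext => a; apply: etrans (split_sumN _ _).
by apply: eq_split_sum => a1 a2 _; apply: (additive_funN (qD _)).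
Qed.

Lemma fmulBr p p' : fmul q (p - p') = fmul q p - fmul q p'.
Proof. by rewrite fmulDr fmulNr. Qed.

Lemma fmul0r : fmul q (0 : M -> seq A -> N) = 0.
Proof.
apply/funext => x; apply/funext => a; apply: split_sum0 => a1 a2 _.
exact: (additive_fun0 (qD _)).
Qed.

Lemma fmul1r : fmul q (@fid N) = q.
Proof.
apply/funext => x; apply/funext => -[|y a]; rewrite /fmul.
  by rewrite split_sum_nil.
rewrite split_sum_cons split_sum0 ?addr0 // => a1 a2 _.
exact: (additive_fun0 (qD _)).
Qed.

Lemma fmulA (L : zmodType) p (r : L -> seq A -> M) :
  fmul q (fmul p r) = fmul (fmul q p) r.
Proof.
apply/funext => x; apply/funext => a; rewrite /fmul.
under eq_split_sum do rewrite (additive_split_sum (qD _)).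
by rewrite split_sumA.
Qed.

End LeftAdditive.

Section Differential.
Variables (sA : A -> A) (bA : seq A -> A).

(** The insertion acts to the right of [x], so it passes [x] and turns it into [sM x]. *)
Definition fdif (M N : zmodType) (sM : M -> M) (p : M -> seq A -> N) :
    M -> seq A -> N :=
  fun x a => insert_sum sA bA (p (sM x)) a.

Section Additivity.
Variables (M N : zmodType) (sM : M -> M).
Implicit Types p : M -> seq A -> N.

Lemma fdifD p p' : fdif sM (p + p') = fdif sM p + fdif sM p'.
Proof. by apply/funext => x; apply/funext => a; apply: insert_sumD. Qed.

Lemma fdifN p : fdif sM (- p) = - fdif sM p.
Proof. by apply/funext => x; apply/funext => a; apply: insert_sumN. Qed.

Lemma fdif0 : fdif sM (0 : M -> seq A -> N) = 0.
Proof. by apply/funext => x; apply/funext => a; apply: insert_sum0. Qed.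

Lemma fdif1 : fdif sM (@fid M) = 0.
Proof.
by apply/funext => x; apply/funext => a; apply: insert_sum0 => -[].
Qed.

End Additivity.

Variables (M N P : zmodType) (sM : M -> M) (sN : N -> N).
Variables (q : N -> seq A -> P) (p : M -> seq A -> N) (qD : left_additive q).

(** An insertion among the letters left to [q] passes [x] and all letters of [p]; the parity of [p]
    decides with which sign this becomes a passage past [p x a1]. *)
Lemma fdif_mul_even :
  (forall x a, p (sM x) (map sA a) = sN (p x a)) ->
  fdif sM (fmul q p) = fmul q (fdif sM p) + fmul (fdif sN q) p.
Proof.
move=> p_even; apply/funext => x; apply/funext => a.
rewrite [LHS]insert_sum_split; congr (_ + _); apply: eq_split_sum => a1 a2 _.
  by rewrite -(additive_insert_sum _ _ (qD a2)).
by rewrite p_even.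
Qed.

Lemma fdif_mul_odd :
  (forall x a, p (sM x) (map sA a) = - sN (p x a)) ->
  fdif sM (fmul q p) = fmul q (fdif sM p) - fmul (fdif sN q) p.
Proof.
move=> p_odd; apply/funext => x; apply/funext => a.
rewrite [LHS]insert_sum_split; congr (_ + _).
  apply: eq_split_sum => a1 a2 _.
  by rewrite -(additive_insert_sum _ _ (qD a2)).
apply: etrans (split_sumN _ _); apply: eq_split_sum => a1 a2 _.
rewrite p_odd -insert_sumN; apply: eq_insert_sum => w.
exact: (additive_funN (qD _)).
Qed.

End Differential.
End FamilyAlgebra.

Section RestrictFamily.
Variables (A : Type) (B : zmodType) (f : seq A -> B).

Definition fres (M N : zmodType) (p : M -> seq B -> N) : M -> seq A -> N :=
  fun x a => block_sum f (p x) a.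

Lemma fresD (M N : zmodType) (p p' : M -> seq B -> N) :
  fres (p + p') = fres p + fres p'.
Proof. by apply/funext => x; apply/funext => a; apply: block_sumD. Qed.

Lemma fresN (M N : zmodType) (p : M -> seq B -> N) : fres (- p) = - fres p.
Proof. by apply/funext => x; apply/funext => a; apply: block_sumN. Qed.

Lemma fres0 (M N : zmodType) : fres (0 : M -> seq B -> N) = 0.
Proof. by apply/funext => x; apply/funext => a; apply: block_sum0. Qed.

Lemma fres1 (M : zmodType) : fres (@fid B M) = @fid A M.
Proof.
apply/funext => x; apply/funext => -[|y a]; rewrite /fres.
  by rewrite block_sum_nil.
rewrite block_sum_cons split_sum0 // => a1 a2 _; exact: block_sum0.
Qed.

Lemma fres_mul (M N P : zmodType) (q : N -> seq B -> P) (p : M -> seq B -> N) :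
  left_additive q -> fres (fmul q p) = fmul (fres q) (fres p).
Proof.
move=> qD; apply/funext => x; apply/funext => a.
rewrite [LHS]block_sum_split; apply: eq_split_sum => a1 a2 _.
rewrite /fres block_sum_block_sum; apply: eq_block_sum => w.
by rewrite (additive_block_sum (qD w)).
Qed.

Lemma fres_fdif (sA : A -> A) (bA : seq A -> A) (sB : B -> B) (bB : seq B -> B)
    (M N : zmodType) (sM : M -> M) (p : M -> seq B -> N) :
  (forall y a, f (sA y :: map sA a) = sB (f (y :: a))) ->
  (forall y a, insert_sum sA bA f (y :: a) = block_sum f bB (y :: a)) ->
  (forall x, multiadditive (p x)) ->
  fres (fdif sB bB sM p) = fdif sA bA sM (fres p).
Proof.
move=> f_even f_mor pD; apply/funext => x; apply/funext => a.
exact: insert_block_sum.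
Qed.

End RestrictFamily.

Section HomotopyFamily.
Variables (A : Type) (B : zmodType) (sB : B -> B) (f h g : seq A -> B).

Definition fhtp (M N : zmodType) (sM : M -> M) (p : M -> seq B -> N) :
    M -> seq A -> N :=
  fun x a => htp_sum sB f h g (p (sM x)) a.

Lemma fhtpD (M N : zmodType) (sM : M -> M) (p p' : M -> seq B -> N) :
  fhtp sM (p + p') = fhtp sM p + fhtp sM p'.
Proof. by apply/funext => x; apply/funext => a; apply: htp_sumD. Qed.

Lemma fhtpN (M N : zmodType) (sM : M -> M) (p : M -> seq B -> N) :
  fhtp sM (- p) = - fhtp sM p.
Proof. by apply/funext => x; apply/funext => a; apply: htp_sumN. Qed.

Section Multiplicativity.
Variables (M N P : zmodType) (sM : M -> M) (sN : N -> N).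
Variables (q : N -> seq B -> P) (p : M -> seq B -> N) (qD : left_additive q).

Let first_part x a1 a2 :
  htp_sum sB f h g (fun w => block_sum g (q (p (sM x) w)) a2) a1
  = fres g q (fhtp sM p x a1) a2.
Proof.
have gqD : additive_fun (fun y => block_sum g (q y) a2).
  by move=> y y'; rewrite -block_sumD; apply: eq_block_sum => w; apply: qD.
by rewrite -(additive_htp_sum _ _ _ _ gqD).
Qed.

Let second_partD a2 : additive_fun (fun y => htp_sum sB f h g (q (sN y)) a2) ->
  forall x a1, block_sum f (fun w => htp_sum sB f h g (q (sN (p x w))) a2) a1
  = fhtp sN q (fres f p x a1) a2.
Proof. by move=> sqD x a1; rewrite -(additive_block_sum sqD). Qed.

Hypothesis sND : additive_fun sN.

(** If [h] acts among the letters of [p], those of [q] lie behind it and are restricted along [g];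
    if it acts among those of [q], the letters of [p] lie in front and are restricted along [f]. *)
Lemma fhtp_mul_even : (forall x w, p (sM x) (map sB w) = sN (p x w)) ->
  fhtp sM (fmul q p)
  = fmul (fres g q) (fhtp sM p) + fmul (fhtp sN q) (fres f p).
Proof.
move=> p_even; apply/funext => x; apply/funext => a.
rewrite [LHS]htp_sum_split; congr (_ + _); apply: eq_split_sum => a1 a2 _.
  exact: first_part.
under eq_block_sum do rewrite p_even.
apply: second_partD => y y'; rewrite -htp_sumD; apply: eq_htp_sum => w.
by rewrite sND qD.
Qed.

Lemma fhtp_mul_odd : (forall x w, p (sM x) (map sB w) = - sN (p x w)) ->
  fhtp sM (fmul q p)
  = fmul (fres g q) (fhtp sM p) - fmul (fhtp sN q) (fres f p).
Proof.
move=> p_odd; apply/funext => x; apply/funext => a.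
rewrite [LHS]htp_sum_split; congr (_ + _).
  by apply: eq_split_sum => a1 a2 _; exact: first_part.
apply: etrans (split_sumN _ _); apply: eq_split_sum => a1 a2 _.
rewrite -second_partD; last first.
  move=> y y'; rewrite -htp_sumD; apply: eq_htp_sum => w.
  by rewrite sND qD.
rewrite -block_sumN; apply: eq_block_sum => w; rewrite p_odd -htp_sumN.
by apply: eq_htp_sum => w'; rewrite (additive_funN (qD _)).
Qed.

End Multiplicativity.
End HomotopyFamily.

(** * The Koszul sign and graded modules *)

Lemma sgD d e : sg (d + e) = sg d * sg e.
Proof. by rewrite /sg exprzDr ?unitrN1. Qed.

Lemma sg_even d : sg (2 * d) = 1.
Proof. by rewrite /sg -exprz_exp [X in X ^ d](_ : _ = 1) ?exp1rz. Qed.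

Lemma sg_eq c d e : d = e + 2 * c -> sg d = sg e.
Proof. by move=> ->; rewrite sgD sg_even mulr1. Qed.

Section Grading.
Variables (k : fieldType) (S : falgType k).
Implicit Types (M N : grMod S) (A B : grBimod S).

Lemma gproj_inj M (x y : M) : (forall i, gproj M i x = gproj M i y) -> x = y.
Proof.
move=> xy; rewrite (gproj_sum x) (gproj_sum y); apply: eq_fsbigr => i _.
exact: xy.
Qed.

(** Together with [gproj_inj] this replaces the sum over all degrees in [koszul] by a check on
    components. *)
Lemma gproj_koszul M e j (x : M) :
  gproj M j (koszul e x) = gproj M j x *~ sg (e * j).
Proof.
have fin := gproj_finite x.
rewrite /koszul -(fsbig_widen [set i | gproj M i x != 0]) //; last first.
  by move=> i [_ /= /negP /negPn /eqP ->]; rewrite mul0rz.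
rewrite fsbig_finite // raddf_sum /=.
have [xj0|xj0] := eqVneq (gproj M j x) 0.
  rewrite xj0 mul0rz big1 // => i _; rewrite raddfMz /= gproj_proj.
  by case: eqP => [<-|_]; rewrite ?xj0 mul0rz.
rewrite (bigD1_seq j) /=; last exact: finmap.fset_uniq; last first.
  by rewrite in_fset_set // inE.
rewrite raddfMz /= gproj_proj eqxx big1 ?addr0 // => i ij.
by rewrite raddfMz /= gproj_proj eq_sym (negbTE ij) mul0rz.
Qed.

Lemma koszul_is_zmod_morphism M e : zmod_morphism (@koszul k S M e).
Proof.
move=> x y; apply: gproj_inj => i.
by rewrite gproj_koszul !raddfB /= !gproj_koszul mulrzBl.
Qed.

HB.instance Definition _ M e :=
  GRing.isZmodMorphism.Build M M (@koszul k S M e) (@koszul_is_zmod_morphism M e).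

Lemma koszulD M d e (x : M) : koszul d (koszul e x) = koszul (d + e) x.
Proof.
apply: gproj_inj => i; rewrite !gproj_koszul -mulrzA; congr (_ *~ _).
by rewrite mulrDl sgD mulrC.
Qed.

Lemma koszul_even M e (x : M) : koszul (2 * e) x = x.
Proof. by apply: gproj_inj => i; rewrite gproj_koszul -mulrA sg_even. Qed.

Lemma koszul0 M (x : M) : koszul 0 x = x.
Proof. by rewrite -[0](mulr0 2) koszul_even. Qed.

Lemma koszul_eq c M d e (x : M) : d = e + 2 * c -> koszul d x = koszul e x.
Proof. by move=> ->; rewrite -koszulD koszul_even. Qed.

Lemma koszul_ract M e (x : M) s : koszul e (ract x s) = ract (koszul e x) s.
Proof.
apply: gproj_inj => i; rewrite /ract linearZ /= !gproj_koszul linearZ /=.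
by rewrite scalerMzr.
Qed.

Lemma koszul_lact A e s (x : A) : koszul e (lact A s x) = lact A s (koszul e x).
Proof.
by apply: gproj_inj => i; rewrite gproj_koszul !lact_proj gproj_koszul raddfMz.
Qed.

Lemma ractD M (x y : M) s : ract (x + y) s = ract x s + ract y s.
Proof. exact: scalerDr. Qed.

Lemma ractN M (x : M) s : ract (- x) s = - ract x s.
Proof. exact: scalerN. Qed.

Lemma ract0 M s : ract (0 : M) s = 0.
Proof. exact: scaler0. Qed.

Lemma homogD M i (x y : M) : homog i x -> homog i y -> homog i (x + y).
Proof. by rewrite /homog => /eqP xi /eqP yi; rewrite raddfD /= xi yi. Qed.

Lemma homogN M i (x : M) : homog i x -> homog i (- x).
Proof. by rewrite /homog => /eqP xi; rewrite raddfN /= xi. Qed.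

Lemma homog0 M i : homog i (0 : M).
Proof. by rewrite /homog raddf0. Qed.

Lemma homogMz M i (x : M) (n : int) : homog i x -> homog i (x *~ n).
Proof. by rewrite /homog => /eqP xi; rewrite raddfMz /= xi. Qed.

Lemma homog_koszul M e i (x : M) : homog i x -> homog i (koszul e x).
Proof. by move=> xi; rewrite (koszul_homog _ xi) homogMz. Qed.

Lemma homog_gproj M i (x : M) : homog i (gproj M i x).
Proof. by rewrite /homog gproj_proj eqxx. Qed.

Lemma homog_split_sum (T : Type) M i (F : seq T -> seq T -> M) a :
  (forall a1 a2, a1 ++ a2 = a -> homog i (F a1 a2)) -> homog i (split_sum F a).
Proof.
move=> Fi; apply: (big_ind (homog i)) => [|x y|j _].
- exact: homog0.
- exact: homogD.
- by apply: Fi; rewrite cat_take_drop.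
Qed.

(* The sign operator of the suspension of M. *)
Definition susp_sgn M (x : M) : M := - koszul 1 x.

Lemma susp_sgnD M : additive_fun (@susp_sgn M).
Proof. by move=> x y; rewrite /susp_sgn raddfD opprD. Qed.

Lemma susp_sgnK M : involutive (@susp_sgn M).
Proof.
by move=> x; rewrite /susp_sgn raddfN /= opprK koszulD (koszul_even 1).
Qed.

Lemma susp_sgn_ract M (x : M) s : susp_sgn (ract x s) = ract (susp_sgn x) s.
Proof. by rewrite /susp_sgn koszul_ract ractN. Qed.

Lemma susp_sgn_lact A (x : A) s :
  susp_sgn (lact A s x) = lact A s (susp_sgn x).
Proof. by rewrite /susp_sgn koszul_lact raddfN. Qed.

Lemma homog_susp_sgn M i (x : M) : homog i x -> homog i (susp_sgn x).
Proof. by move=> xi; apply/homogN/homog_koszul. Qed.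

End Grading.

(** * Additivity, balance and linearity of families *)

Section Laws.
Variables (k : fieldType) (S : falgType k).
Implicit Types (L M N P : grMod S) (A B : grBimod S).

(* The laws of a right_family other than the one on degrees, for words of size
   at most n; the bound makes inductions on the size of the word possible. *)
Record lawful (n : nat) M A N (F : M -> seq A -> N) : Prop := Lawful {
  law_addl : forall (x y : M) (a : seq A), (size a <= n)%N ->
    F (x + y) a = F x a + F y a;
  law_addr : forall (x : M) (u : seq A) (y z : A) (v : seq A),
    (size u + size v < n)%N ->
    F x (u ++ (y + z) :: v) = F x (u ++ y :: v) + F x (u ++ z :: v);
  law_ball : forall (x : M) s (y : A) (v : seq A), (size v < n)%N ->
    F (ract x s) (y :: v) = F x (lact A s y :: v);
  law_balr : forall (x : M) (u : seq A) (y : A) s (z : A) (v : seq A),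
    (size u + (size v).+1 < n)%N ->
    F x (u ++ ract y s :: z :: v) = F x (u ++ y :: lact A s z :: v);
  law_lin1 : forall (x : M) s, F (ract x s) [::] = ract (F x [::]) s;
  law_lin : forall (x : M) (u : seq A) (y : A) s, (size u < n)%N ->
    F x (rcons u (ract y s)) = ract (F x (rcons u y)) s }.

(** Each letter counts one less than its degree, as after suspension. One number [e] then serves all
    arities of a family: [1] for structure maps, [0] for morphisms, [-1] for homotopies. *)
Definition word_degree A N (e : int) (K : seq A -> N) : Prop :=
  forall ds (a : seq A), all2 (@homog k S A) ds a ->
    homog (e + \sum_(d <- ds) d - (size a)%:Z) (K a).

Definition family_degree M A N (e : int) (F : M -> seq A -> N) : Prop :=
  forall i (x : M), homog i x -> word_degree (i + e) (F x).

Lemma right_familyP M A N (dg : nat -> int) (e : int) (F : M -> seq A -> N) :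
  (forall n, dg n.+1 = e - n%:Z) ->
  right_family dg F <-> (forall n, lawful n F) /\ family_degree e F.
Proof.
move=> dgE; split=> [[addl addr ball balr lin1 lin deg]|[FL Fe]].
  split=> [n|i x xi ds a dsa]; first by split=> * //; apply: lin.
  by have := deg i x ds a xi dsa; rewrite dgE; congr homog; ring.
split.
- by move=> x y a; apply: (law_addl (FL (size a))).
- by move=> x u y z v; apply: (law_addr (FL _)); apply: ltnSn.
- by move=> x s y v; apply: (law_ball (FL _)); apply: ltnSn.
- by move=> x u y s z v; apply: (law_balr (FL _)); apply: ltnSn.
- by move=> x s; apply: (law_lin1 (FL 0)).
- by move=> x u y s; apply: (law_lin (FL _)); apply: ltnSn.
- move=> i x ds a xi dsa; have := Fe i x xi ds a dsa.
  by rewrite dgE; congr homog; ring.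
Qed.

Lemma eq_lawful n M A N (F G : M -> seq A -> N) :
  (forall (x : M) (a : seq A), (size a <= n)%N -> F x a = G x a) ->
  lawful n F -> lawful n G.
Proof.
move=> FG [addl addr ball balr lin1 lin]; split.
- by move=> x y a le_a; rewrite -!FG ?addl.
- by move=> x u y z v lt_n; rewrite -!FG ?addr // ?size_cat /=; lia.
- by move=> x s y v lt_n; rewrite -!FG ?ball //=; lia.
- by move=> x u y s z v lt_n; rewrite -!FG ?balr // ?size_cat /=; lia.
- by move=> x s; rewrite -!FG ?lin1.
- by move=> x u y s lt_n; rewrite -!FG ?lin // ?size_rcons.
Qed.

(** The first letter takes over the part of the module element, [A] being a right module itself;
    this lowers the bound and drives the inductions. *)
Lemma lawful_cons n M A N (F : M -> seq A -> N) :
  lawful n.+1 F <->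
  [/\ forall (x y : M) (a : seq A), (size a <= n.+1)%N -> F (x + y) a = F x a + F y a,
      forall x s, F (ract x s) [::] = ract (F x [::]) s,
      forall (x : M) s (y : A) (v : seq A), (size v <= n)%N ->
        F (ract x s) (y :: v) = F x (lact A s y :: v) &
      forall x : M, lawful n (fun (y : A) (a : seq A) => F x (y :: a))].
Proof.
split=> [[addl addr ball balr lin1 lin]|[addl lin1 ball FL]].
  split=> // x; split.
  - by move=> y z a le_a; apply: (addr x [::]).
  - by move=> y u z z' v lt_n; apply: (addr x (y :: u)).
  - by move=> y s z v lt_n; apply: (balr x [::]).
  - by move=> y u z s z' v lt_n; apply: (balr x (y :: u)).
  - by move=> y s; apply: (lin x [::]).
  - by move=> y u z s lt_n; apply: (lin x (y :: u)).
split=> //.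
- move=> x [|y u] z z' v lt_n; first by apply: (law_addl (FL x)).
  exact: (law_addr (FL x)).
- move=> x [|y u] z s z' v lt_n; first by apply: (law_ball (FL x)).
  exact: (law_balr (FL x)).
- move=> x [|y u] z s lt_n; first by apply: (law_lin1 (FL x)).
  exact: (law_lin (FL x)).
Qed.

Lemma lawful0 n M A N : lawful n (0 : M -> seq A -> N).
Proof. by split=> *; rewrite /= ?ract0 ?addr0. Qed.

Lemma lawfulD n M A N (F G : M -> seq A -> N) :
  lawful n F -> lawful n G -> lawful n (F + G).
Proof.
case=> addl addr ball balr lin1 lin [addl' addr' ball' balr' lin1' lin'].
apply: (@eq_lawful _ _ _ _ (fun x a => F x a + G x a)) => //; split=> * /=.
- by rewrite addl ?addl' // addrACA.
- by rewrite addr ?addr' // addrACA.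
- by rewrite ball ?ball'.
- by rewrite balr ?balr'.
- by rewrite lin1 ?lin1' ?ractD.
- by rewrite lin ?lin' ?ractD.
Qed.

Lemma lawfulN n M A N (F : M -> seq A -> N) : lawful n F -> lawful n (- F).
Proof.
case=> addl addr ball balr lin1 lin.
apply: (@eq_lawful _ _ _ _ (fun x a => - F x a)) => //; split=> * /=.
- by rewrite addl ?opprD.
- by rewrite addr ?opprD.
- by rewrite ball.
- by rewrite balr.
- by rewrite lin1 ?ractN.
- by rewrite lin ?ractN.
Qed.

Lemma lawful1 n M A : lawful n (@fid A M).
Proof.
split=> //.
- by move=> x y [|z a] _ //=; rewrite addr0.
- by move=> x [|z u] y z' v _ /=; rewrite addr0.
- by move=> x [|z u].
- by move=> x [|z u] y s _ /=; rewrite ract0.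
Qed.

Lemma lawful_comp n L M A N (F : M -> seq A -> N) (s : L -> M) :
  additive_fun s -> (forall x c, s (ract x c) = ract (s x) c) ->
  lawful n F -> lawful n (fun x => F (s x)).
Proof.
move=> sD sS [addl addr ball balr lin1 lin].
split=> *; rewrite ?sD ?sS.
- exact: addl.
- exact: addr.
- exact: ball.
- exact: balr.
- exact: lin1.
- exact: lin.
Qed.

Lemma comp_lawful n M A N P (F : M -> seq A -> N) (s : N -> P) :
  additive_fun s -> (forall x c, s (ract x c) = ract (s x) c) ->
  lawful n F -> lawful n (fun x a => s (F x a)).
Proof.
move=> sD sS [addl addr ball balr lin1 lin].
split=> *.
- by rewrite addl.
- by rewrite addr.
- by rewrite ball.
- by rewrite balr.
- by rewrite lin1.
- by rewrite lin.
Qed.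

Lemma lawful_mul n M A N P (q : N -> seq A -> P) (p : M -> seq A -> N) :
  lawful n q -> lawful n p -> lawful n (fmul q p).
Proof.
move=> [addl addr ball balr lin1 lin] [addl' addr' ball' balr' lin1' lin'].
have le_split (a a1 a2 : seq A) : a1 ++ a2 = a -> (size a1 + size a2 = size a)%N.
  by move=> <-; rewrite size_cat.
rewrite /fmul; split.
- move=> x y a le_a; rewrite -split_sumD; apply: eq_split_sum => a1 a2 /le_split e.
  by rewrite addl' ?addl //; lia.
- move=> x u y z v lt_n; rewrite !split_sum_cat_cons addrACA -!split_sumD.
  congr (_ + _); apply: eq_split_sum => a1 a2 /le_split e.
    by rewrite addr //; lia.
  by rewrite addr' ?addl //; lia.
- move=> x s y v lt_n; rewrite !split_sum_cons; congr (_ + _).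
    by rewrite lin1' ball.
  by apply: eq_split_sum => a1 a2 /le_split e; rewrite ball' //; lia.
- move=> x u y s z v lt_n.
  rewrite !split_sum_cat_cons !split_sum_cons; congr (_ + (_ + _)).
  + by apply: eq_split_sum => a1 a2 /le_split e; rewrite balr //; lia.
  (* The cut falls between the two letters: linearity of [p] in its last letter releases the scalar,
     and balance of [q] hands it to [z]. *)
  + by rewrite !cats1 lin' ?ball //; lia.
  + by apply: eq_split_sum => a1 a2 /le_split e; rewrite balr' //; lia.
- by move=> x s; rewrite !split_sum_nil lin1' lin1.
- move=> x u y s lt_n; rewrite !split_sum_rcons ractD lin' ?lin1 //.
  congr (_ + _); rewrite (additive_split_sum (phi := fun z => ract z s)).
    by apply: eq_split_sum => a1 a2 /le_split e; rewrite lin //; lia.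
  by move=> z z'; rewrite ractD.
Qed.

(* A family of bimodule maps, the first letter being split off. *)
Definition bilawful A B (f : seq A -> B) : Prop :=
  (forall n, lawful n (fun (y : A) a => f (y :: a))) /\
  (forall s (y : A) (a : seq A), f (lact A s y :: a) = lact B s (f (y :: a))).

Lemma lawful_res n M A B N (f : seq A -> B) (F : M -> seq B -> N) :
  bilawful f -> (forall m, lawful m F) -> lawful n (fres f F).
Proof.
move=> [fL fl]; elim: n M F => [|n IH] M F FL.
  split=> // *; last by rewrite /fres !block_sum_nil (law_lin1 (FL 0)).
  by rewrite -block_sumD; apply: eq_block_sum => w; apply: (law_addl (FL _)).
apply/lawful_cons; split.
- move=> x y a _; rewrite -block_sumD; apply: eq_block_sum => w.
  exact: (law_addl (FL _)).
- by move=> x s; rewrite /fres !block_sum_nil (law_lin1 (FL 0)).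
- move=> x s y v _; rewrite /fres !block_sum_cons; apply: eq_split_sum => a1 a2 _.
  by apply: eq_block_sum => w; rewrite fl (law_ball (FL _) _ _ _ (ltnSn _)).
(* With the first letter as module variable, splitting off the first block exhibits the restricted
   family as a product, to which [lawful_mul] applies. *)
move=> x; have /eq_lawful : forall (y : A) (a : seq A), (size a <= n)%N ->
    fmul (fres f (fun b w => F x (b :: w))) (fun y a => f (y :: a)) y a
    = fres f F x (y :: a).
  by move=> y a _; rewrite /fres block_sum_cons.
apply; apply: lawful_mul => //; apply: IH => m.
by have /lawful_cons[] := FL m.+1.
Qed.

Lemma lawful_htp n M A B N (f h g : seq A -> B) (F : M -> seq B -> N) :
  bilawful f -> bilawful h -> bilawful g -> (forall m, lawful m F) ->
  lawful n (fun x => htp_sum (@susp_sgn k S B) f h g (F x)).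
Proof.
move=> fL hL gL; elim: n M F => [|n IH] M F FL.
  split=> //.
    move=> x y a _; rewrite -htp_sumD; apply: eq_htp_sum => w.
    exact: (law_addl (FL _)).
  by move=> x s; rewrite !htp_sum_nil ract0.
apply/lawful_cons; split.
- move=> x y a _; rewrite -htp_sumD; apply: eq_htp_sum => w.
  exact: (law_addl (FL _)).
- by move=> x s; rewrite !htp_sum_nil ract0.
- move=> x s y v _; rewrite !htp_sum_cons.
  congr (_ + _); apply: eq_split_sum => a1 a2 _.
    apply: eq_block_sum => w; case: hL => _ ->.
    by rewrite (law_ball (FL _) _ _ _ (ltnSn _)).
  apply: eq_htp_sum => w; case: fL => _ ->; rewrite susp_sgn_lact.
  by rewrite (law_ball (FL _) _ _ _ (ltnSn _)).
move=> x; have /eq_lawful : forall (y : A) (a : seq A), (size a <= n)%N ->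
    (fmul (fres g (fun b w => F x (b :: w))) (fun y a => h (y :: a))
     + fmul (fun b => htp_sum (@susp_sgn k S B) f h g (fun w => F x (b :: w)))
         (fun y a => susp_sgn (f (y :: a)))) y a
    = htp_sum (@susp_sgn k S B) f h g (F x) (y :: a).
  by move=> y a _; rewrite htp_sum_cons.
have FxL m : lawful m (fun b w => F x (b :: w)).
  by have /lawful_cons[] := FL m.+1.
apply; apply: lawfulD; apply: lawful_mul.
- exact: lawful_res.
- by case: hL.
- exact: IH.
- apply: comp_lawful; [exact: susp_sgnD|exact: susp_sgn_ract|by case: fL].
Qed.

End Laws.

(** * Degrees of families *)

Section Degrees.
Variables (k : fieldType) (S : falgType k).
Implicit Types (L M N P : grMod S) (A B C : grBimod S).

Lemma all2_homog_cat A ds (a1 a2 : seq A) :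
  all2 (@homog k S A) ds (a1 ++ a2) ->
  exists ds1 ds2, [/\ ds = ds1 ++ ds2, all2 (@homog k S A) ds1 a1 &
                       all2 (@homog k S A) ds2 a2].
Proof.
elim: a1 ds => [|y a1 IH] [|d ds] //=.
- by exists [::], [::].
- by exists [::], (d :: ds).
- move=> /andP[yd /IH[ds1 [ds2 [-> h1 h2]]]].
  by exists (d :: ds1), ds2; rewrite /= yd h1.
Qed.

Lemma all2_homog_size A ds (a : seq A) :
  all2 (@homog k S A) ds a -> size ds = size a.
Proof. by elim: a ds => [|y a IH] [|d ds] //= /andP[_ /IH ->]. Qed.

Lemma family_degree0 M A N e : family_degree e (0 : M -> seq A -> N).
Proof. by move=> i x xi ds a dsa; apply: homog0. Qed.

Lemma family_degreeD M A N e (F G : M -> seq A -> N) :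
  family_degree e F -> family_degree e G -> family_degree e (F + G).
Proof. by move=> Fe Ge i x xi ds a dsa; apply: homogD; [apply: Fe|apply: Ge]. Qed.

Lemma family_degreeN M A N e (F : M -> seq A -> N) :
  family_degree e F -> family_degree e (- F).
Proof. by move=> Fe i x xi ds a dsa; apply/homogN/Fe. Qed.

Lemma family_degree1 M A : family_degree 0 (@fid A M).
Proof.
move=> i x xi [|d ds] [|y a] //= _; last exact: homog0.
by rewrite big_nil; move: xi; congr homog; ring.
Qed.

Lemma family_degree_mul M A N P d e (q : N -> seq A -> P) (p : M -> seq A -> N) :
  family_degree d q -> family_degree e p -> family_degree (d + e) (fmul q p).
Proof.
move=> qd pe i x xi ds a dsa; apply: homog_split_sum => a1 a2 aE.
move: dsa; rewrite -aE => /all2_homog_cat[ds1 [ds2 [-> ds1a ds2a]]].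
have := qd _ _ (pe i x xi ds1 a1 ds1a) ds2 a2 ds2a.
by rewrite size_cat big_cat PoszD /=; congr homog; ring.
Qed.

Lemma word_degree_cons A N c d (K : seq A -> N) (y : A) :
  word_degree c K -> homog d y -> word_degree (c + d - 1) (fun w => K (y :: w)).
Proof.
move=> Kc yd ds a dsa; have := Kc (d :: ds) (y :: a); rewrite /= yd dsa.
by move=> /(_ isT); rewrite big_cons -[(size a).+1]addn1 PoszD; congr homog; ring.
Qed.

Lemma word_degree_res A B N c (f : seq A -> B) (K : seq B -> N) :
  family_degree 0 (fun (y : A) a => f (y :: a)) -> word_degree c K ->
  word_degree c (block_sum f K).
Proof.
move=> f0 Kc ds a; elim/size_ind: a ds c K Kc => [|y a IH] ds c K Kc.
  by rewrite block_sum_nil; case: ds => // _; apply: (Kc [::] [::]).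
case: ds => //= d ds /andP[yd dsa]; rewrite block_sum_cons.
apply: homog_split_sum => a1 a2 aE.
move: dsa; rewrite -aE => /all2_homog_cat[ds1 [ds2 [-> ds1a ds2a]]].
have le_a2 : (size a2 <= size a)%N by rewrite -aE size_cat leq_addl.
have := IH a2 le_a2 ds2 _ _ (word_degree_cons Kc (f0 _ _ yd ds1 a1 ds1a)) ds2a.
rewrite size_cat big_cons big_cat -[(_ + _).+1]addn1 !PoszD /=.
by congr homog; ring.
Qed.

Lemma word_degree_htp A B N c (f h g : seq A -> B) (K : seq B -> N) :
  family_degree 0 (fun (y : A) a => f (y :: a)) ->
  family_degree (-1) (fun (y : A) a => h (y :: a)) ->
  family_degree 0 (fun (y : A) a => g (y :: a)) -> word_degree c K ->
  word_degree (c - 1) (htp_sum (@susp_sgn k S B) f h g K).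
Proof.
move=> f0 h1 g0 Kc ds a; elim/size_ind: a ds c K Kc => [|y a IH] ds c K Kc.
  by rewrite htp_sum_nil => _; apply: homog0.
case: ds => //= d ds /andP[yd dsa]; rewrite htp_sum_cons.
apply: homogD; apply: homog_split_sum => a1 a2 aE;
  move: dsa; rewrite -aE => /all2_homog_cat[ds1 [ds2 [-> ds1a ds2a]]].
  have := word_degree_res g0 (word_degree_cons Kc (h1 _ _ yd ds1 a1 ds1a)) ds2a.
  rewrite size_cat big_cons big_cat -[(_ + _).+1]addn1 !PoszD /=.
  by congr homog; ring.
have le_a2 : (size a2 <= size a)%N by rewrite -aE size_cat leq_addl.
have := IH a2 le_a2 ds2 _ _ (word_degree_cons Kc
  (homog_susp_sgn (f0 _ _ yd ds1 a1 ds1a))) ds2a.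
rewrite size_cat big_cons big_cat -[(_ + _).+1]addn1 !PoszD /=.
by congr homog; ring.
Qed.

End Degrees.

Section Families.
Variables (k : fieldType) (S : falgType k).
Implicit Types (L M N P : grMod S) (A B C : grBimod S).

Definition rfamily M A N (e : int) (F : M -> seq A -> N) : Prop :=
  (forall n, lawful n F) /\ family_degree e F.

Definition bifamily A B (e : int) (f : seq A -> B) : Prop :=
  bilawful f /\ family_degree e (fun (y : A) a => f (y :: a)).

Lemma bimod_familyP A B (dg : nat -> int) (e : int) (f : seq A -> B) :
  (forall n, dg n.+1 = e - n%:Z) -> bimod_family dg f <-> bifamily e f.
Proof.
move=> dgE; rewrite /bimod_family (right_familyP _ dgE).
by split=> [[[fL fe] fl]|[[fL fl] fe]].
Qed.

Lemma rfamily_left_additive M A N e (F : M -> seq A -> N) :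
  rfamily e F -> left_additive F.
Proof. by move=> [FL _] a x y; apply: (law_addl (FL (size a))). Qed.

Lemma rfamily_multiadditive M A N e (F : M -> seq A -> N) x :
  rfamily e F -> multiadditive (F x).
Proof. by move=> [FL _] u v y z; apply: (law_addr (FL _)); apply: ltnSn. Qed.

Lemma rfamily0 M A N e : rfamily e (0 : M -> seq A -> N).
Proof. by split=> [n|]; [apply: lawful0|apply: family_degree0]. Qed.

Lemma rfamilyD M A N e (F G : M -> seq A -> N) :
  rfamily e F -> rfamily e G -> rfamily e (F + G).
Proof.
by case=> FL Fe [GL Ge]; split=> [n|]; [apply: lawfulD|apply: family_degreeD].
Qed.

Lemma rfamilyN M A N e (F : M -> seq A -> N) : rfamily e F -> rfamily e (- F).
Proof.
by case=> FL Fe; split=> [n|]; [apply: lawfulN|apply: family_degreeN].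
Qed.

Lemma rfamily1 M A : rfamily 0 (@fid A M).
Proof. by split=> [n|]; [apply: lawful1|apply: family_degree1]. Qed.

Lemma rfamily_mul M A N P d e (q : N -> seq A -> P) (p : M -> seq A -> N) :
  rfamily d q -> rfamily e p -> rfamily (d + e) (fmul q p).
Proof.
by case=> qL qd [pL pe]; split=> [n|]; [apply: lawful_mul|apply: family_degree_mul].
Qed.

Lemma rfamily_res M A B N e (f : seq A -> B) (F : M -> seq B -> N) :
  bifamily 0 f -> rfamily e F -> rfamily e (fres f F).
Proof.
move=> [fL f0] [FL Fe]; split=> [n|i x xi]; first exact: lawful_res.
by apply: word_degree_res => //; apply: Fe.
Qed.

Lemma bifamily_res A B C e (f : seq A -> B) (g : seq B -> C) :
  bifamily 0 f -> bifamily e g -> bifamily e (block_sum f g).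
Proof.
move=> [fL f0] [[gL gl] ge].
have E : (fun (y : A) a => block_sum f g (y :: a))
    = fmul (fres f (fun b w => g (b :: w))) (fun y a => f (y :: a)).
  by apply/funext => y; apply/funext => a; rewrite block_sum_cons.
have [ResL Rese] : rfamily e (fres f (fun b w => g (b :: w))).
  by apply: rfamily_res.
split; last by rewrite E -[e]addr0; apply: family_degree_mul.
split=> [n|s y a]; first by rewrite E; apply: lawful_mul => //; case: fL.
rewrite !block_sum_cons; case: fL => _ fl.
rewrite (additive_split_sum (phi := lact C s)); last by move=> x x'; rewrite raddfD.
apply: eq_split_sum => a1 a2 _.
rewrite (additive_block_sum (phi := lact C s)); last by move=> x x'; rewrite raddfD.
by apply: eq_block_sum => w; rewrite fl gl.
Qed.

Lemma rfamily_htp M A B N e (f h g : seq A -> B) (F : M -> seq B -> N) :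
  bifamily 0 f -> bifamily (-1) h -> bifamily 0 g -> rfamily e F ->
  rfamily (e - 1) (fhtp (@susp_sgn k S B) f h g (@susp_sgn k S M) F).
Proof.
move=> [fL f0] [hL h1] [gL g0] [FL Fe]; split=> [n|i x xi].
  apply: (lawful_comp (F := fun x => htp_sum (@susp_sgn k S B) f h g (F x))).
  - exact: susp_sgnD.
  - exact: susp_sgn_ract.
  - exact: lawful_htp.
rewrite addrA.
exact: (word_degree_htp f0 h1 g0 (Fe _ _ (homog_susp_sgn xi))).
Qed.

(** Koszul signs are explicit only on homogeneous elements, and these span [M]. *)
Lemma additive_ext M (V : zmodType) (phi psi : M -> V) :
  additive_fun phi -> additive_fun psi ->
  (forall i x, homog i x -> phi x = psi x) -> phi =1 psi.
Proof.
move=> phiD psiD eq_homog x; have fin := gproj_finite x.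
rewrite (gproj_sum x) -(fsbig_widen [set i | gproj M i x != 0]) //; last first.
  by move=> i [_ /= /negP /negPn /eqP ->].
rewrite fsbig_finite // (additive_fun_sum phiD) (additive_fun_sum psiD).
by apply: eq_bigr => i _; apply: eq_homog (homog_gproj _ _).
Qed.

Lemma multiadditive_ext A (V : zmodType) (K K' : seq A -> V) :
  multiadditive K -> multiadditive K' ->
  (forall ds a, all2 (@homog k S A) ds a -> K a = K' a) -> K =1 K'.
Proof.
move=> KD KD' eqK a.
(* Letters are made homogeneous from left to right: [u] is the homogeneous prefix, [v] the arbitrary
   rest. *)
suff eqKu v : forall ds u, all2 (@homog k S A) ds u -> K (u ++ v) = K' (u ++ v).
  exact: (eqKu a [::] [::]).
elim: v => [|y v IH] ds u dsu; first by rewrite cats0; apply: eqK dsu.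
apply: (additive_ext (KD u v) (KD' u v)) => d {}y yd.
rewrite -cat_rcons; apply: (IH (rcons ds d)).
by elim: u ds dsu {IH} => [|z u IH] [|e ds] //=; rewrite ?yd // => /andP[-> /IH].
Qed.

Lemma multiadditive_sg A (V : zmodType) (K : seq A -> V) (s : A -> A)
    (phi : int -> int) ds a :
  multiadditive K -> (forall d y, homog d y -> s y = y *~ sg (phi d)) ->
  all2 (@homog k S A) ds a ->
  K (map s a) = K a *~ sg (\sum_(d <- ds) phi d).
Proof.
move=> + sE; elim: a ds K => [|y a IH] [|d ds] //= K KD.
  by rewrite big_nil.
move=> /andP[yd dsa]; rewrite (sE _ _ yd) (additive_funMz (KD [::] _)) /=.
rewrite (IH ds _ (multiadditive_cons _ KD) dsa) big_cons sgD.
by rewrite -mulrzA mulrC.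
Qed.

Lemma multiadditive_map A (V : zmodType) (K : seq A -> V) (s : A -> A) :
  multiadditive K -> additive_fun s -> multiadditive (fun a => K (map s a)).
Proof. by move=> KD sD u v y z; rewrite !map_cat /= sD KD. Qed.

Lemma multiadditive_Mz A (V : zmodType) (K : seq A -> V) (c : nat -> int) :
  multiadditive K -> multiadditive (fun a => K a *~ c (size a)).
Proof. by move=> KD u v y z; rewrite KD mulrzDl !size_cat. Qed.

Section Parity.
Variables (M : grMod S) (A : grBimod S) (N : grMod S) (e : int).
Variables (F : M -> seq A -> N) (Fe : rfamily e F).

(** A common form for [koszul c] and [susp_sgn]: both act in degree [d] by the sign of an exponent
    [phi d], and the hypothesis on [phi] compares the exponents of inputs and output. *)
Lemma rfamily_sgn_map (sM : M -> M) (sA : A -> A) (sN : N -> N)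
    (phi : int -> int) (c : nat -> int) :
  additive_fun sM -> additive_fun sA -> additive_fun sN ->
  (forall d x, homog d x -> sM x = x *~ sg (phi d)) ->
  (forall d x, homog d x -> sA x = x *~ sg (phi d)) ->
  (forall d x, homog d x -> sN x = x *~ sg (phi d)) ->
  (forall i ds, sg (phi i + \sum_(d <- ds) phi d)
    = sg (phi (i + e + \sum_(d <- ds) d - (size ds)%:Z)) * sg (c (size ds))) ->
  forall x a, F (sM x) (map sA a) = sN (F x a) *~ sg (c (size a)).
Proof.
move=> sMD sAD sND sME sAE sNE phiE x a.
have FlD := rfamily_left_additive Fe; have FD x' := rfamily_multiadditive x' Fe.
apply: (additive_ext (phi := fun x => F (sM x) (map sA a))
    (psi := fun x => sN (F x a) *~ sg (c (size a)))) => [y z|y z|i {}x xi].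
- by rewrite sMD FlD.
- by rewrite FlD sND mulrzDl.
apply: (multiadditive_ext (K := fun a => F (sM x) (map sA a))
    (K' := fun a => sN (F x a) *~ sg (c (size a)))).
- exact: multiadditive_map.
- have sFD : multiadditive (fun a => sN (F x a)).
    by move=> u v y z; rewrite FD sND.
  exact: (multiadditive_Mz (fun n => sg (c n)) sFD).
move=> ds {}a dsa; case: Fe => _ /(_ i x xi ds a dsa) FH.
rewrite (sNE _ _ FH) (multiadditive_sg (FD _) sAE dsa) (sME _ _ xi).
rewrite (additive_funMz (FlD a)) -!mulrzA -sgD phiE; congr (_ *~ _).
by rewrite (all2_homog_size dsa).
Qed.

(** The usual Koszul rule, [e - size a] being the degree of the component of [F] that is
    evaluated. *)
Lemma rfamily_koszul c x a :
  F (koszul c x) (map (koszul c) a)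
  = koszul c (F x a) *~ sg (c * (e - (size a)%:Z)).
Proof.
apply: (rfamily_sgn_map (phi := fun d => c * d)
  (c := fun n => c * (e - n%:Z))); try by move=> *; rewrite raddfD.
1-3: by move=> d y yd; rewrite (koszul_homog c yd).
move=> i ds; rewrite -sgD -mulr_sumr; apply: (sg_eq (c := c * ((size ds)%:Z - e))).
ring.
Qed.

Lemma susp_sgn_homog (P : grMod S) d (x : P) :
  homog d x -> susp_sgn x = x *~ sg (d + 1).
Proof.
by move=> xd; rewrite /susp_sgn (koszul_homog 1 xd) mul1r sgD mulrN1 mulrNz.
Qed.

Lemma rfamily_susp x a :
  F (susp_sgn x) (map (@susp_sgn k S A) a) = susp_sgn (F x a) *~ sg e.
Proof.
apply: (rfamily_sgn_map (phi := fun d => d + 1) (c := fun n => e));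
  try exact: susp_sgnD; try exact: susp_sgn_homog.
move=> i ds; have size_sum : \sum_(d <- ds) 1 = (size ds)%:Z.
  elim: ds => [|d ds IH]; first by rewrite big_nil.
  by rewrite big_cons IH -PoszD add1n.
rewrite -sgD big_split /= size_sum; apply: (sg_eq (c := (size ds)%:Z - e)).
ring.
Qed.

End Parity.

End Families.

(** * Removing the signs *)

Section Twist.
Variables (k : fieldType) (S : falgType k).
Implicit Types (L M N P : grMod S) (A B C : grBimod S).

(* Conjugating by this involution turns the signs of the A-infinity formulas
   into the signs susp_sgn on letters. *)
Fixpoint twist A (a : seq A) : seq A :=
  if a is y :: a' then koszul (size a')%:Z y :: twist a' else [::].

Lemma size_twist A (a : seq A) : size (twist a) = size a.
Proof. by elim: a => //= y a ->. Qed.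

Lemma twist_cat A (u v : seq A) :
  twist (u ++ v) = map (koszul (size v)%:Z) (twist u) ++ twist v.
Proof. by elim: u => //= y u ->; rewrite koszulD size_cat addnC. Qed.

Lemma twistK A : involutive (@twist A).
Proof.
elim=> //= y a ->; rewrite size_twist koszulD.
by rewrite -[_ + _]mulr2n -mulr_natl koszul_even.
Qed.

(** The module element counts as the first letter of the word, hence the exponent [size a]. *)
Definition twf M A N (F : M -> seq A -> N) : M -> seq A -> N :=
  fun x a => F (koszul (size a)%:Z x) (twist a).

Lemma twfK M A N (F : M -> seq A -> N) : twf (twf F) = F.
Proof.
apply/funext => x; apply/funext => a; rewrite /twf twistK size_twist koszulD.
by rewrite -[_ + _]mulr2n -mulr_natl koszul_even.
Qed.

Lemma lawful_twf n M A N (F : M -> seq A -> N) : lawful n F -> lawful n (twf F).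
Proof.
case=> addl addr ball balr lin1 lin; rewrite /twf; split.
- by move=> x y a le_a; rewrite raddfD addl ?size_twist.
- move=> x u y z v lt_n; rewrite !twist_cat !size_cat /= [koszul _ (y + z)]raddfD.
  by rewrite addr // size_map !size_twist.
- move=> x s y v lt_n /=.
  by rewrite koszul_ract ball ?size_twist // koszul_lact.
- move=> x u y s z v lt_n; rewrite !twist_cat !size_cat /=.
  by rewrite koszul_ract koszul_lact balr // size_map !size_twist.
- by move=> x s; rewrite koszul_ract lin1.
- move=> x u y s lt_n; rewrite -!cats1 !twist_cat !size_cat /= koszul_ract !cats1.
  by rewrite lin // size_map size_twist.
Qed.

Lemma all2_homog_twist A ds (a : seq A) :
  all2 (@homog k S A) ds a -> all2 (@homog k S A) ds (twist a).
Proof.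
by elim: a ds => [|y a IH] [|d ds] //= /andP[/homog_koszul -> /IH].
Qed.

Lemma rfamily_twf M A N e (F : M -> seq A -> N) : rfamily e F -> rfamily e (twf F).
Proof.
case=> FL Fe; split=> [n|i x xi ds a dsa]; first exact: lawful_twf.
by rewrite -(size_twist a); apply: Fe (homog_koszul _ xi) _ _ (all2_homog_twist _).
Qed.

Lemma bifamily_twist A B e (f : seq A -> B) :
  bifamily e f -> bifamily e (fun a => f (twist a)).
Proof.
case=> [[fL fl] fe]; split; last by have [] := rfamily_twf (conj fL fe).
split=> [n|s y a /=]; last by rewrite koszul_lact fl.
exact: (lawful_twf (fL n)).
Qed.

Lemma bifamily_multiadditive A B e (f : seq A -> B) :
  bifamily e f -> multiadditive f.
Proof.
case=> [[fL _] fe] [|y u] v; first exact: (rfamily_left_additive (conj fL fe)).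
exact: (rfamily_multiadditive y (conj fL fe)).
Qed.

Lemma multiadditive_susp A (V : zmodType) (K : seq A -> V) u v :
  multiadditive K ->
  K (map (@susp_sgn k S A) u ++ v)
  = K (map (koszul 1) u ++ v) *~ sg (size u)%:Z.
Proof.
elim: u K => [|y u IH] K KD /=; first by rewrite mulr1z.
rewrite (additive_funN (KD [::] _)) /= (IH (fun w => K (koszul 1 y :: w))).
  by rewrite -addn1 PoszD sgD mulrN1 mulrNz.
exact: multiadditive_cons.
Qed.

End Twist.

(** * Tensor products of operations after twisting *)

Section TensorTwist.
Variables (k : fieldType) (S : falgType k) (A B : grBimod S).
Implicit Types (o : op A B) (os : seq (op A B)) (a : seq A).

(* Twisting shifts the degree of a factor by its arity, so that this is the
   degree picked up by a letter that moves past the twisted factors os. *)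
Definition opsize os : int := \sum_(o <- os) ((arity o)%:Z + odeg o).

Definition arities os : nat := sumn (map (@arity k S A B) os).

(** The sign that twisting leaves over: pulling [koszul (opsize os')] out of a factor [o] costs
    [opsize os' * odeg o]. *)
Fixpoint tensor_sgn os : int :=
  if os is o :: os' then opsize os' * odeg o + tensor_sgn os' else 0.

Fixpoint blocks os a : seq B :=
  if os is o :: os' then
    ofun o (twist (take (arity o) a)) :: blocks os' (drop (arity o) a)
  else [::].

(** Modulo 2 the exponent is the sum of the suspended degrees [arity + odeg - 1] of the later
    factors. *)
Fixpoint twisted_blocks os a : seq B :=
  if os is o :: os' then
    koszul (opsize os' + (size os')%:Z) (ofun o (twist (take (arity o) a)))
      :: twisted_blocks os' (drop (arity o) a)
  else [::].

Definition op_law o : Prop := forall c a, size a = arity o ->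
  ofun o (map (koszul c) a) = koszul c (ofun o a) *~ sg (c * odeg o).

(** Suspended degree 0, as for identities and for the components of morphisms. *)
Definition op_even o : Prop := (arity o)%:Z + odeg o = 1.

Lemma opsize_cons o os : opsize (o :: os) = (arity o)%:Z + odeg o + opsize os.
Proof. by rewrite /opsize big_cons. Qed.

Lemma opsize_cat os os' : opsize (os ++ os') = opsize os + opsize os'.
Proof. by rewrite /opsize big_cat. Qed.

Lemma opsizeE os : opsize os = (arities os)%:Z + odegs os.
Proof.
rewrite /opsize /odegs big_split /=; congr (_ + _).
by elim: os => [|o os IH]; rewrite ?big_nil // big_cons IH.
Qed.

Lemma opsize_even os : List.Forall op_even os -> opsize os = (size os)%:Z.
Proof.
elim=> [|o os' oE _ IH]; first by rewrite /opsize big_nil.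
by rewrite opsize_cons IH oE.
Qed.

Lemma size_tensor os a : size (tensor os a) = size os.
Proof. by elim: os a => //= o os IH a; rewrite IH. Qed.

Lemma size_blocks os a : size (blocks os a) = size os.
Proof. by elim: os a => //= o os IH a; rewrite IH. Qed.

Lemma take_twist n a : (n <= size a)%N ->
  take n (twist a) = map (koszul (size a - n)%N%:Z) (twist (take n a)).
Proof.
move=> le_n; rewrite -{1}(cat_take_drop n a) twist_cat take_size_cat ?size_drop //.
by rewrite size_map size_twist size_take_min; apply/minn_idPl.
Qed.

Lemma drop_twist n a : (n <= size a)%N -> drop n (twist a) = twist (drop n a).
Proof.
move=> le_n; rewrite -{1}(cat_take_drop n a) twist_cat drop_size_cat //.
by rewrite size_map size_twist size_take_min; apply/minn_idPl.
Qed.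

(** On the letters of the first factor, [tensor] contributes the later degrees and [twist] the later
    arities; they add up to [opsize os'], which [op_law] brings outside. *)
Lemma tensor_twist (V : zmodType) (K : seq B -> V) os a :
  multiadditive K -> List.Forall op_law os -> size a = arities os ->
  K (twist (tensor os (twist a))) = K (twisted_blocks os a) *~ sg (tensor_sgn os).
Proof.
move=> + osL; elim: osL K a => [|o os' oL _ IH] K a KD.
  by case: a => //; rewrite /= mulr1z.
rewrite /arities /= => size_a.
have le_a : (arity o <= size a)%N by rewrite size_a leq_addr.
rewrite take_twist // drop_twist // size_tensor -map_comp.
rewrite (eq_map (g := koszul (opsize os'))); last first.
  by move=> y; rewrite /= koszulD opsizeE addrC size_a addKn.
rewrite oL; last by rewrite size_twist size_takel.
rewrite raddfMz /= koszulD (additive_funMz (KD [::] _)) /= [_ + opsize _]addrC.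
set y := koszul _ _; rewrite (IH (fun w => K (y :: w))); first by rewrite -mulrzA sgD mulrC.
- exact: multiadditive_cons.
- by rewrite size_drop size_a addKn.
Qed.

Lemma blocks_even os a : List.Forall op_even os -> twisted_blocks os a = blocks os a.
Proof.
move=> osE; elim: osE a => //= o os' _ osE IH a.
by rewrite IH opsize_even // -[_ + _]mulr2n -mulr_natl koszul_even.
Qed.

Lemma twisted_blocks_cat os os' a a' :
  List.Forall op_even os -> size a = arities os ->
  twisted_blocks (os ++ os') (a ++ a')
  = map (koszul (opsize os' + (size os')%:Z)) (blocks os a)
    ++ twisted_blocks os' a'.
Proof.
move=> osE; elim: osE a => [|o os1 oE osE IH] a; first by case: a.
rewrite /arities /= => size_a.
have le_a : (arity o <= size a)%N by rewrite size_a leq_addr.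
rewrite takel_cat // drop_cat; case: ltnP => [_|ge_a].
  rewrite IH; last by rewrite size_drop size_a addKn.
  rewrite size_cat opsize_cat opsize_even //; congr (_ :: _).
  by apply: (koszul_eq (c := (size os1)%:Z)); rewrite PoszD; ring.
(* Here [o] uses up [a], so the remaining factors of the left part have total arity 0, and induction
   is applied to the empty word. *)
have aE : size a = arity o by apply/eqP; rewrite eqn_leq le_a ge_a.
have os10 : arities os1 = 0%N by move: size_a; rewrite aE /arities; lia.
have -> : drop (arity o) a = [::] by rewrite drop_oversize // aE.
rewrite aE subnn drop0 -[a' in LHS](cat0s a') IH ?os10 //.
rewrite size_cat opsize_cat opsize_even //; congr (_ :: _).
by apply: (koszul_eq (c := (size os1)%:Z)); rewrite PoszD; ring.
Qed.

Lemma tensor_sgn_cat os os' :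
  tensor_sgn (os ++ os')
  = tensor_sgn os + tensor_sgn os' + opsize os' * odegs os.
Proof.
elim: os => [|o os IH] /=.
  by rewrite /odegs big_nil mulr0 addr0 add0r.
by rewrite IH /odegs big_cons opsize_cat -/(odegs os); ring.
Qed.

Section Ops.
Variables (dg : nat -> int) (e : int) (f : seq A -> B).
Hypothesis dgE : forall n, dg n.+1 = e - n%:Z.
Hypothesis fe : bifamily e f.

Lemma op_law_bifamily n : (0 < n)%N -> op_law (Op n (dg n) f).
Proof.
case: n => // n _ c [|y a] //= [size_a]; rewrite dgE -size_a.
case: fe => [[fL _] fe']; exact: (rfamily_koszul (conj fL fe')).
Qed.

Lemma ops_law c : all (leq 1) c -> List.Forall op_law (ops dg f c).
Proof.
elim: c => [|i c IH] /=; first by constructor.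
by move=> /andP[i0 /IH]; constructor => //; apply: op_law_bifamily.
Qed.

Lemma arities_ops c : arities (ops dg f c) = sumn c.
Proof. by rewrite /arities /ops -map_comp; congr sumn; apply: map_id. Qed.

Lemma blocks_ops c a :
  blocks (ops dg f c) a = map (fun a => f (twist a)) (reshape c a).
Proof. by elim: c a => //= i c IH a; rewrite IH. Qed.

Lemma odegs_ops c : odegs (ops dg f c) = \sum_(i <- c) dg i.
Proof. by rewrite /odegs /ops big_map. Qed.

End Ops.

Lemma ops_even f c : List.Forall op_even (ops deg_f f c).
Proof.
elim: c => [|i c IH] /=; constructor => //.
by rewrite /op_even /= /deg_f; ring.
Qed.

Lemma sgn_cons i c : sgn (i :: c) = (size c)%:Z * (i%:Z - 1) + sgn c.
Proof.
by rewrite /sgn /= big_ord_recl /=; congr (_ + _); congr (_ * _); lia.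
Qed.

(** This is where [sgn] comes from: it cancels the leftover sign, so composition and restriction
    carry no sign after twisting. *)
Lemma tensor_sgn_ops f c : tensor_sgn (ops deg_f f c) = - sgn c.
Proof.
elim: c => [|i c IH] /=; first by rewrite /sgn big_ord0 oppr0.
rewrite IH opsize_even; last exact: ops_even.
by rewrite sgn_cons size_map /deg_f; ring.
Qed.

End TensorTwist.

Section IdOps.
Variables (k : fieldType) (S : falgType k) (A : grBimod S).

Lemma id_op_law n : List.Forall (@op_law k S A A) (nseq n (id_op A)).
Proof.
elim: n => [|n IH] /=; constructor=> // c [|y [|z a]] //= _.
by rewrite mulr0 mulr1z.
Qed.

Lemma id_op_even n : List.Forall (@op_even k S A A) (nseq n (id_op A)).
Proof. by elim: n => [|n IH] /=; constructor. Qed.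

Lemma arities_id n : arities (nseq n (id_op A)) = n.
Proof. by rewrite /arities; elim: n => //= n ->. Qed.

Lemma odegs_id n : odegs (nseq n (id_op A)) = 0.
Proof. by rewrite /odegs big_nseq; elim: n => //= n ->. Qed.

Lemma blocks_id (a : seq A) : blocks (nseq (size a) (id_op A)) a = a.
Proof. by elim: a => //= y a IH; rewrite take0 drop0 IH koszul0. Qed.

Lemma tensor_sgn_id n : tensor_sgn (nseq n (id_op A)) = 0.
Proof. by elim: n => //= n ->; rewrite mulr0. Qed.

End IdOps.

Lemma sum_pairs (V : zmodType) (N n r : nat) (phi : nat -> nat -> V) :
  (r <= n)%N -> (n < N)%N ->
  \sum_(s < N | (1 <= s)%N) \sum_(t < N | (r + s + t == n)%N) phi s t
  = \sum_(j < n - r) phi j.+1 (n - r - j.+1)%N.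
Proof.
move=> le_rn; case: N => // N; rewrite ltnS => le_nN.
rewrite big_mkcond big_ord_recl /= add0r.
rewrite (big_ord_widen N (fun j => phi j.+1 (n - r - j.+1)%N)); last by lia.
rewrite [RHS]big_mkcond; apply: eq_bigr => j _ /=; rewrite /bump /= add1n.
case: ifP => lt_j; last by rewrite big_pred0 // => t; apply/eqP; lia.
have t_lt : (n - r - j.+1 < N.+1)%N by lia.
rewrite (big_pred1 (Ordinal t_lt)) // => t /=.
by apply/eqP/eqP => [?|->]; [apply: val_inj => /=; lia|rewrite /=; lia].
Qed.

(** The bound [N] is left free because the inner sums of the module formulas run one further than
    those of the algebra formulas, the module element counting as a factor. *)
Lemma sum_triples (V : zmodType) (X : Type) (phi : nat -> nat -> nat -> V)
    (F : seq X -> X -> seq X -> seq X -> V) N a :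
  (size a < N)%N ->
  (forall a1 y a2 a3, a1 ++ (y :: a2) ++ a3 = a ->
     phi (size a1) (size a2).+1 (size a3) = F a1 y a2 a3) ->
  \sum_(r < (size a).+1) \sum_(s < N | (1 <= s)%N)
    \sum_(t < N | (r + s + t == size a)%N) phi r s t
  = split_sum (fun a1 a' =>
      if a' is y :: a'' then split_sum (F a1 y) a'' else 0) a.
Proof.
move=> lt_N phiE; apply: eq_bigr => r _.
have le_r : (r <= size a)%N by rewrite -ltnS.
rewrite sum_pairs //.
have := cat_take_drop r a; have size_drop_a := size_drop r a.
have size_take_a := size_takel le_r.
case: (drop r a) size_drop_a => [|y a''] /= size_a'' aE.
  by rewrite -size_a'' big_ord0.
rewrite -size_a''; apply: eq_bigr => j _.
have le_j : (j <= size a'')%N by rewrite -ltnS.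
rewrite -(phiE _ _ (take j a'') (drop j a'')); last by rewrite /= cat_take_drop.
by rewrite size_take_a size_takel // size_drop.
Qed.

(** * The A-infinity formulas after twisting *)

Section TensorFormulas.
Variables (k : fieldType) (S : falgType k).
Implicit Types (M N P : grMod S) (A B C : grBimod S).

(** The factor [o] is the only one of odd suspended degree, as [m] and [h] are (with [c] equal to 1
    and 0), so only the blocks to its left feel a sign. *)
Lemma twisted_blocks_mid A B (V : zmodType) (K : seq B -> V)
    (os1 os2 : seq (op A B)) o (c : int) (a1 b a2 : seq A) :
  multiadditive K ->
  List.Forall (@op_even k S A B) os1 -> List.Forall (@op_even k S A B) os2 ->
  (arity o)%:Z + odeg o = 2 * c ->
  size a1 = arities os1 -> size b = arity o ->
  K (twisted_blocks (os1 ++ o :: os2) (a1 ++ b ++ a2))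
    *~ sg (tensor_sgn (os1 ++ o :: os2))
  = K (map (@susp_sgn k S B) (blocks os1 a1)
         ++ ofun o (twist b) :: blocks os2 a2)
    *~ sg (tensor_sgn os1 + tensor_sgn os2 + (size os1)%:Z
           + (size os2)%:Z * (odeg o + odegs os1)).
Proof.
move=> KD os1E os2E oE size_a1 size_b.
rewrite twisted_blocks_cat // (eq_map (g := koszul 1)); last first.
  move=> y; rewrite opsize_cons oE opsize_even //=.
  by apply: (koszul_eq (c := c + (size os2)%:Z)); lia.
rewrite /= take_size_cat // drop_size_cat // blocks_even //.
rewrite opsize_even // -[_ + _]mulr2n -mulr_natl koszul_even.
rewrite (multiadditive_susp _ _ KD) size_blocks -mulrzA -sgD; congr (_ *~ _).
rewrite tensor_sgn_cat opsize_cons oE /= opsize_even //.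
apply: (sg_eq (c := c * odegs os1 - (size os1)%:Z)); ring.
Qed.

(** [d] is the degree with which [F] lets Koszul signs pass: 0 for the identity of [M], the degree
    of the component for a genuine family. *)
Lemma rtensor_twist M N P A B e (G : N -> seq B -> P) (F : M -> seq A -> N)
    (d : int) i (os : seq (op A B)) x a1 a2 :
  rfamily e G ->
  (forall c, F (koszul c (koszul (size a1)%:Z x)) (map (koszul c) (twist a1))
     = koszul c (twf F x a1) *~ sg (c * d)) ->
  List.Forall (@op_law k S A B) os -> size a2 = arities os ->
  size a1 = i.-1 ->
  rtensor G i F os (koszul (size (a1 ++ a2))%:Z x) (twist (a1 ++ a2))
  = twf G (koszul (opsize os + (size os)%:Z) (twf F x a1)) (twisted_blocks os a2)
    *~ sg (tensor_sgn os + opsize os * d).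
Proof.
move=> Ge FE osL size_a2 size_a1.
have GlD := rfamily_left_additive Ge.
rewrite /rtensor twist_cat take_size_cat ?size_map ?size_twist //.
rewrite drop_size_cat ?size_map ?size_twist //.
rewrite -map_comp (eq_map (g := koszul (opsize os))); last first.
  by move=> y; rewrite /= koszulD opsizeE size_a2 addrC.
have -> : koszul (odegs os) (koszul (size (a1 ++ a2))%:Z x)
    = koszul (opsize os) (koszul (size a1)%:Z x).
  by rewrite !koszulD opsizeE size_cat PoszD -size_a2; congr koszul; ring.
rewrite FE (additive_funMz (GlD _)).
(* As twisting is an involution, [G] can be expressed by [twf G] on a word of [size os] letters,
   which has the shape of [tensor_twist]. *)
have -> z : G z (tensor os (twist a2))
    = twf G (koszul (size os)%:Z z) (twist (tensor os (twist a2))).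
  rewrite /twf size_twist size_tensor twistK koszulD -[_ + _]mulr2n -mulr_natl.
  by rewrite koszul_even.
have GtD := rfamily_multiadditive _ (rfamily_twf Ge).
rewrite (tensor_twist (GtD _) osL size_a2) koszulD -mulrzA -sgD.
by rewrite [_ + opsize _]addrC.
Qed.

Lemma rtensor1_twist M P A B e (G : M -> seq B -> P) (os : seq (op A B)) x a :
  rfamily e G -> List.Forall (@op_law k S A B) os -> size a = arities os ->
  rtensor G 1 (fun y (_ : seq A) => y) os (koszul (size a)%:Z x) (twist a)
  = twf G (koszul (opsize os + (size os)%:Z) x) (twisted_blocks os a)
    *~ sg (tensor_sgn os).
Proof.
move=> Ge osL size_a.
rewrite -[a in LHS]cat0s (rtensor_twist (d := 0) Ge) //.
  by rewrite /twf /= koszul0 mulr0 addr0.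
by move=> c; rewrite mulr0 mulr1z /twf /= koszul0.
Qed.

Lemma arities_cat A B (os os' : seq (op A B)) :
  arities (os ++ os') = (arities os + arities os')%N.
Proof. by rewrite /arities map_cat sumn_cat. Qed.

Lemma deg_mS n : deg_m n.+1 = 1 - n%:Z.
Proof. by rewrite /deg_m; lia. Qed.

Lemma deg_fS n : deg_f n.+1 = 0 - n%:Z.
Proof. by rewrite /deg_f; lia. Qed.

Lemma deg_hS n : deg_h n.+1 = -1 - n%:Z.
Proof. by rewrite /deg_h; lia. Qed.

Definition insert_ops A (m : seq A -> A) r s t : seq (op A A) :=
  nseq r (id_op A) ++ Op s (deg_m s) m :: nseq t (id_op A).

Lemma insert_ops_law A (m : seq A -> A) r s t :
  bifamily 1 m -> List.Forall (@op_law k S A A) (insert_ops m r s.+1 t).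
Proof.
move=> m1; apply/List.Forall_app; split; first exact: id_op_law.
constructor; last exact: id_op_law.
exact: (op_law_bifamily deg_mS m1).
Qed.

Lemma arities_insert_ops A (m : seq A -> A) r s t :
  arities (insert_ops m r s t) = (r + (s + t))%N.
Proof. by rewrite arities_cat arities_id /arities /= -/(arities _) arities_id. Qed.

Lemma insert_ops_mid A (V : zmodType) (K : seq A -> V) (m : seq A -> A) a1 y a2 a3 :
  multiadditive K ->
  let os := insert_ops m (size a1) (size a2).+1 (size a3) in
  K (twisted_blocks os (a1 ++ (y :: a2) ++ a3)) *~ sg (tensor_sgn os)
  = K (map (@susp_sgn k S A) a1 ++ m (twist (y :: a2)) :: a3)
    *~ sg (size a1 + (size a2).+1 * size a3)%N.
Proof.
move=> KD os; rewrite (twisted_blocks_mid (c := 1)) //.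
- rewrite !blocks_id !tensor_sgn_id !size_nseq odegs_id /=; congr (_ *~ _).
  by apply: (sg_eq (c := (size a3)%:Z * (1 - (size a2).+1%:Z)));
    rewrite PoszD PoszM /deg_m; ring.
- exact: id_op_even.
- exact: id_op_even.
- by rewrite /= /deg_m; ring.
- by rewrite arities_id.
Qed.

Lemma insert_twist A B e (m : seq A -> A) (F : seq A -> B) a :
  bifamily 1 m -> bifamily e F ->
  insert m F (twist a)
  = insert_sum (@susp_sgn k S A) (fun a => m (twist a)) (fun a => F (twist a)) a.
Proof.
move=> m1 Fe; pose K w := F (twist w).
have KD : multiadditive K := bifamily_multiadditive (bifamily_twist Fe).
rewrite insert_sumE /insert size_twist.
pose phi r s t := F (tensor (insert_ops m r s t) (twist a)) *~ sg (r + s * t)%N.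
apply: (sum_triples (phi := phi)) => // a1 y a2 a3 aE; rewrite /phi.
rewrite -[tensor _ _]twistK -/(K _) (tensor_twist KD).
(* The sign left by twisting equals the one prescribed by [insert], so the total exponent is twice
   that number. *)
- rewrite -aE insert_ops_mid // -mulrzA -sgD
    [sg _](sg_eq (e := 0) (c := (size a1 + (size a2).+1 * size a3)%N)).
    by rewrite mulr1z.
  by ring.
- exact: insert_ops_law.
- by rewrite arities_insert_ops -aE !size_cat.
Qed.

Lemma acomp_twist A B C e (g : seq B -> C) (f : seq A -> B) a :
  bifamily e g -> bifamily 0 f ->
  acomp g f (twist a)
  = block_sum (fun a => f (twist a)) (fun w => g (twist w)) a.
Proof.
move=> ge f0; pose K w := g (twist w).
have KD : multiadditive K := bifamily_multiadditive (bifamily_twist ge).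
rewrite /acomp size_twist; apply: eq_big_seq => c.
rewrite mem_compositions => /andP[c_pos /eqP c_a].
rewrite -[tensor _ _]twistK -/(K _) (tensor_twist KD).
- rewrite blocks_even; last exact: ops_even.
  by rewrite tensor_sgn_ops blocks_ops -mulrzA -sgD addNr mulr1z.
- exact: (ops_law deg_fS f0).
- by rewrite arities_ops c_a.
Qed.

Lemma ahtp_sgnE i s j :
  ahtp_sgn i s j = (size i)%:Z * ((size j)%:Z + 1) + s%:Z * (size j)%:Z - sgn i
    + (size j)%:Z * \sum_(u <- i) u%:Z - sgn j.
Proof.
(* In the triangular sum each [u] is counted once for every larger [alpha], which gives the weights
   of [sgn]. *)
have tri c : \sum_(alpha < size c) \sum_(u < alpha) (1 - (nth 0%N c u)%:Z)
    = - sgn c.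
  rewrite /sgn; elim: (size c) => [|n IH]; first by rewrite !big_ord0 oppr0.
  rewrite big_ord_recr IH /= -sumrN -[RHS]sumrN -big_split /= [RHS]big_ord_recr.
  rewrite /= subrr mul0r oppr0 addr0; apply: eq_bigr => u _; rewrite /=; ring.
rewrite /ahtp_sgn !tri (big_nth 0%N) big_mkord PoszM PoszM -addn1 PoszD; ring.
Qed.

End TensorFormulas.

Section AlgebraFormulas.
Variables (k : fieldType) (S : falgType k).
Implicit Types (A B : ainf_alg S).

Definition hat_m A (a : seq A) : A := am (twist a).
Definition hat_op A B (f : seq A -> B) (a : seq A) : B := f (twist a).

Lemma am_bifamily A : bifamily 1 (@am k S A).
Proof. exact/(bimod_familyP _ deg_mS)/am_family. Qed.

Lemma htp_ops_twist A B (f h g : seq A -> B) a :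
  bifamily 0 f -> bifamily (-1) h -> bifamily 0 g ->
  ahtp_insert f h g (twist a)
  = htp_sum (@susp_sgn k S B) (hat_op f) (hat_op h) (hat_op g) (@hat_m B) a.
Proof.
move=> f0 h1 g0; pose K := @hat_m B.
have KD : multiadditive K := bifamily_multiadditive (bifamily_twist (am_bifamily B)).
rewrite /ahtp_insert size_twist.
pose phi p s q := \sum_(i <- compositions p) \sum_(j <- compositions q)
    am (tensor (ops deg_f f i ++ Op s (deg_h s) h :: ops deg_f g j) (twist a))
      *~ sg (ahtp_sgn i s j).
apply: (sum_triples (phi := phi)) => // a1 y a2 a3 aE; rewrite /phi.
apply: eq_big_seq => i; rewrite mem_compositions => /andP[i_pos /eqP i_a1].
apply: eq_big_seq => j; rewrite mem_compositions => /andP[j_pos /eqP j_a3].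
rewrite -[tensor _ _]twistK -/(hat_m _) -/(K _) (tensor_twist KD).
- rewrite -aE (twisted_blocks_mid (c := 0)) //.
  + rewrite !blocks_ops -mulrzA -sgD !tensor_sgn_ops !size_map /=.
    rewrite odegs_ops ahtp_sgnE.
    have -> : \sum_(u <- i) deg_f u = (size i)%:Z - \sum_(u <- i) u%:Z.
      rewrite /deg_f sumrB; congr (_ - _).
      by elim: (i) => [|u c IH]; rewrite ?big_nil // big_cons IH /= intS.
    (* The terms with [s] and with the sum over [i] cancel against [ahtp_sgn]; all others occur
       twice and make up this constant. *)
    rewrite [sg _](sg_eq (e := 0)
      (c := (size i)%:Z + (size i)%:Z * (size j)%:Z - sgn i - sgn j)).
      by rewrite mulr1z.
    by rewrite /deg_h; ring.
  + exact: ops_even.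
  + exact: ops_even.
  + by rewrite /= /deg_h; ring.
  + by rewrite arities_ops.
- apply/List.Forall_app; split; first exact: (ops_law deg_fS f0).
  constructor; last exact: (ops_law deg_fS g0).
  exact: (op_law_bifamily deg_hS h1).
- rewrite arities_cat arities_ops /arities /= -/(arities _) arities_ops.
  by rewrite -aE !size_cat i_a1 j_a3.
Qed.

Section Modules.
Variable A : ainf_alg S.
Implicit Types (M N P : grMod S).

(** The signs for structure maps, morphisms and homotopies are one rule: the component of [F] on [r]
    letters has degree [e - r] and passes [s] identity factors. *)
Lemma mcompose_twist M N P d e (sgn : nat -> nat -> nat)
    (G : N -> seq A -> P) (F : M -> seq A -> N) x a :
  (forall r s, sg (sgn r.+1 s) = sg (s%:Z * (e - r%:Z))) ->
  rfamily d G -> rfamily e F ->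
  mcompose sgn G F (koszul (size a)%:Z x) (twist a) = fmul (twf G) (twf F) x a.
Proof.
move=> sgnE Gd Fe; rewrite /mcompose size_twist big_mkcond big_ord_recl /= add0r.
apply: eq_bigr => i _; rewrite /= /bump /= add1n.
have le_i : (i <= size a)%N by rewrite -ltnS.
have s_lt : (size a - i < (size a).+2)%N by lia.
rewrite (big_pred1 (Ordinal s_lt)) => [|s] /=; last first.
  by apply/eqP/eqP => [?|->]; [apply: val_inj => /=; lia|rewrite /=; lia].
have size_d : size (drop i a) = (size a - i)%N by rewrite size_drop.
transitivity (rtensor G i.+1 F (nseq (size (drop i a)) (id_op A))
    (koszul (size (take i a ++ drop i a))%:Z x) (twist (take i a ++ drop i a))
    *~ sg (sgn i.+1 (size (drop i a)))).
  by rewrite cat_take_drop size_d.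
rewrite (rtensor_twist (d := e - i%:Z) Gd) => [|c|||].
- rewrite blocks_even; last exact: id_op_even.
  rewrite blocks_id tensor_sgn_id opsize_even; last exact: id_op_even.
  rewrite size_nseq -[X in koszul X]mulr2n -mulr_natl koszul_even.
  rewrite -mulrzA sgnE -sgD add0r -mulr2n -mulr_natl sg_even mulr1z.
  by [].
- by rewrite (rfamily_koszul Fe) size_twist /twf size_takel.
- exact: id_op_law.
- by rewrite arities_id.
- by rewrite size_takel.
Qed.

Lemma minsert_twist M N e (F : M -> seq A -> N) x a : rfamily e F ->
  minsert F (koszul (size a)%:Z x) (twist a)
  = fdif (@susp_sgn k S A) (@hat_m A) (@susp_sgn k S M) (twf F) x a.
Proof.
move=> Fe; rewrite /fdif insert_sumE /minsert size_twist.
rewrite big_mkcond big_ord_recl /= add0r.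
pose phi r s t := rtensor F 1 (fun y (_ : seq A) => y) (insert_ops (@am k S A) r s t)
  (koszul (size a)%:Z x) (twist a) *~ sg (r.+1 + s * t)%N.
transitivity (\sum_(r < (size a).+1) \sum_(s < (size a).+2 | (1 <= s)%N)
    \sum_(t < (size a).+2 | (r + s + t == size a)%N) phi r s t).
  by apply: eq_bigr => r _; apply: eq_bigr => s _; apply: eq_bigl.
apply: sum_triples => // a1 y a2 a3 aE; rewrite /phi.
rewrite (rtensor1_twist _ Fe); first last.
- by rewrite arities_insert_ops -aE !size_cat.
- exact/insert_ops_law/am_bifamily.
have FtD z : multiadditive (twf F z) := rfamily_multiadditive z (rfamily_twf Fe).
have FlD := rfamily_left_additive (rfamily_twf Fe).
rewrite -aE (insert_ops_mid _ _ _ _ _ (FtD _)).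
(* All factors except the structure map are even after suspension, so [x] keeps one [koszul 1]; the
   missing minus sign of [susp_sgn] comes from counting [x] in [r]. *)
rewrite (koszul_eq (c := (size a1 + size a3)%N%:Z + 1) (e := 1)).
  rewrite /susp_sgn (additive_funN (FlD _)) -mulrzA -sgD.
  rewrite [sg _](sg_eq (e := 1) (c := (size a1 + (size a2).+1 * size a3)%N)).
    by rewrite mulrN1z.
  by rewrite addSn -addn1 !PoszD; ring.
rewrite opsize_cat opsize_cons !opsize_even ?size_cat /=; try exact: id_op_even.
by rewrite !size_nseq /deg_m; lia.
Qed.

End Modules.

Lemma restr_twist A B (phi : ainf_mor A B) (M N : grMod S) e
    (p : M -> seq B -> N) x a : rfamily e p ->
  restr phi p (koszul (size a)%:Z x) (twist a) = fres (hat_op phi) (twf p) x a.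
Proof.
move=> pe; rewrite /restr size_twist; apply: eq_big_seq => c.
rewrite mem_compositions => /andP[c_pos /eqP c_a].
have phi0 : bifamily 0 phi by apply/(bimod_familyP _ deg_fS)/af_family.
rewrite (rtensor1_twist _ pe).
- rewrite blocks_even; last exact: ops_even.
  rewrite blocks_ops tensor_sgn_ops opsize_even; last exact: ops_even.
  rewrite -[X in koszul X]mulr2n -mulr_natl koszul_even -mulrzA -sgD addNr.
  by rewrite mulr1z.
- exact: (ops_law deg_fS phi0).
- by rewrite arities_ops c_a.
Qed.

End AlgebraFormulas.

(** * Modules as twisted complexes *)

Section TwistedComplexes.
Variables (k : fieldType) (S : falgType k) (A : ainf_alg S).
Implicit Types (L M N P : grMod S).

Definition fam_dif M N (p : M -> seq A -> N) : M -> seq A -> N :=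
  fdif (@susp_sgn k S A) (@hat_m k S A) (@susp_sgn k S M) p.

Lemma rfamily_mul0r M N P d (q : N -> seq A -> P) (p : M -> seq A -> N) :
  rfamily d q -> rfamily 0 p -> rfamily d (fmul q p).
Proof. by move=> qd p0; rewrite -[d]addr0; apply: rfamily_mul. Qed.

Lemma rfamily_mul0l M N P d (q : N -> seq A -> P) (p : M -> seq A -> N) :
  rfamily 0 q -> rfamily d p -> rfamily d (fmul q p).
Proof. by move=> q0 pd; rewrite -[d]add0r; apply: rfamily_mul. Qed.

Lemma rfamilyB M N e (p q : M -> seq A -> N) :
  rfamily e p -> rfamily e q -> rfamily e (p - q).
Proof. by move=> pe qe; apply: rfamilyD => //; apply: rfamilyN. Qed.

Lemma fam_difD M N (p q : M -> seq A -> N) :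
  fam_dif (p + q) = fam_dif p + fam_dif q.
Proof. exact: fdifD. Qed.

Lemma fam_difN M N (p : M -> seq A -> N) : fam_dif (- p) = - fam_dif p.
Proof. exact: fdifN. Qed.

Lemma fam_dif1 M : fam_dif (@fid A M) = 0.
Proof. exact: fdif1. Qed.

Lemma fam_dif_mul_even M N P d (q : N -> seq A -> P) (p : M -> seq A -> N) :
  rfamily d q -> rfamily 0 p ->
  fam_dif (fmul q p) = fmul q (fam_dif p) + fmul (fam_dif q) p.
Proof.
move=> qd p0; apply: fdif_mul_even; first exact: rfamily_left_additive qd.
by move=> x a; rewrite (rfamily_susp p0) mulr1z.
Qed.

Lemma fam_dif_mul_odd M N P d e (q : N -> seq A -> P) (p : M -> seq A -> N) :
  rfamily d q -> rfamily e p -> sg e = -1 ->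
  fam_dif (fmul q p) = fmul q (fam_dif p) - fmul (fam_dif q) p.
Proof.
move=> qd pe e_odd; apply: fdif_mul_odd; first exact: rfamily_left_additive qd.
by move=> x a; rewrite (rfamily_susp pe) e_odd mulrN1z.
Qed.

Definition maurer_cartan M (mu : M -> seq A -> M) : Prop :=
  rfamily 1 mu /\ fam_dif mu + fmul mu mu = 0.

Section Hom.
Variables (M N : grMod S) (mu : M -> seq A -> M) (nu : N -> seq A -> N).

Definition closed_family (p : M -> seq A -> N) : Prop :=
  rfamily 0 p /\ fam_dif p + fmul p mu - fmul nu p = 0.

Definition homotopic_families (p q : M -> seq A -> N) : Prop :=
  exists2 h, rfamily (-1) h & p - q = fmul nu h + fmul h mu + fam_dif h.

Lemma closed_family_dif p :
  closed_family p -> fam_dif p = fmul nu p - fmul p mu.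
Proof. by case=> _ pC; rewrite -[RHS]add0r -pC; zmod. Qed.

Hypotheses (mu1 : rfamily 1 mu) (nu1 : rfamily 1 nu).

Let nuD := rfamily_left_additive nu1.

Lemma homotopic_families_refl p : homotopic_families p p.
Proof.
exists 0; first exact: rfamily0.
by rewrite fmul0r // fmul0l /fam_dif fdif0 subrr !addr0.
Qed.

Lemma homotopic_families_sym p q :
  homotopic_families p q -> homotopic_families q p.
Proof.
case=> h h1 pq; exists (- h); first exact: rfamilyN.
by rewrite fmulNr // fmulNl fam_difN -opprB pq; zmod.
Qed.

Lemma homotopic_families_trans p q r :
  homotopic_families p q -> homotopic_families q r -> homotopic_families p r.
Proof.
case=> h h1 pq [h' h'1 qr]; exists (h + h'); first exact: rfamilyD.
rewrite fmulDr // fmulDl fam_difD.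
have -> : p - r = (p - q) + (q - r) by zmod.
by rewrite pq qr; zmod.
Qed.

End Hom.

Lemma closed_family1 M (mu : M -> seq A -> M) :
  rfamily 1 mu -> closed_family mu mu (@fid A M).
Proof.
move=> mu1; split; first exact: rfamily1.
rewrite fmul1l fmul1r ?addrK; first exact: fam_dif1.
exact: rfamily_left_additive mu1.
Qed.

Lemma closed_family_mul L M N (la : L -> seq A -> L) (mu : M -> seq A -> M)
    (nu : N -> seq A -> N) (q : M -> seq A -> N) (p : L -> seq A -> M) :
  rfamily 1 nu -> closed_family mu nu q -> closed_family la mu p ->
  closed_family la nu (fmul q p).
Proof.
move=> nu1 qC pC; have [[q0 _] [p0 _]] := (qC, pC).
have qD := rfamily_left_additive q0; have nuD := rfamily_left_additive nu1.
split; first exact: rfamily_mul0r.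
rewrite (fam_dif_mul_even q0 p0) (closed_family_dif qC) (closed_family_dif pC).
by rewrite fmulBr // fmulBl !fmulA //; zmod.
Qed.

Lemma homotopic_families_mul L M N (la : L -> seq A -> L)
    (mu : M -> seq A -> M) (nu : N -> seq A -> N)
    (q q' : M -> seq A -> N) (p p' : L -> seq A -> M) :
  rfamily 1 nu ->
  closed_family mu nu q' -> closed_family la mu p ->
  homotopic_families mu nu q q' -> homotopic_families la mu p p' ->
  homotopic_families la nu (fmul q p) (fmul q' p').
Proof.
move=> nu1 qC pC [h h1 qq'] [h' h'1 pp'].
have [[q0 _] [p0 _]] := (qC, pC).
have qD := rfamily_left_additive q0; have nuD := rfamily_left_additive nu1.
have hD := rfamily_left_additive h1.
(* The difference splits as (q - q') p + q' (p - p'), and a primitive times a closed family of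
   degree 0 is again a primitive. *)
exists (fmul h p + fmul q' h').
  by apply: rfamilyD; [apply: rfamily_mul0r|apply: rfamily_mul0l].
have -> : fmul q p - fmul q' p' = fmul (q - q') p + fmul q' (p - p').
  by rewrite fmulBl fmulBr //; zmod.
rewrite qq' pp' fam_difD.
rewrite (fam_dif_mul_even h1 p0) (fam_dif_mul_odd q0 h'1) //.
rewrite (closed_family_dif qC) (closed_family_dif pC).
by rewrite !(fmulDl, fmulNl, fmulDr nuD, fmulDr qD, fmulBr hD, fmulA) //; zmod.
Qed.

Section Inverse.
Variables (M : grMod S) (P : M -> seq A -> M).
Hypotheses (P0 : rfamily 0 P) (P_nil : forall x, P x [::] = 0).

Let PD := rfamily_left_additive P0.

Definition fpow n : M -> seq A -> M := iter n (fmul P) (@fid A M).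

Lemma rfamily_fpow n : rfamily 0 (fpow n).
Proof.
by elim: n => [|n IH]; [apply: rfamily1|apply: rfamily_mul0l].
Qed.

(** Every factor [P] must consume a letter, since it vanishes on the empty word. *)
Lemma fpow_small n x (a : seq A) : (size a < n)%N -> fpow n x a = 0.
Proof.
elim: n x a => // n IH x a lt_a; apply: split_sum0 => a1 [|y a2] aE.
  exact: P_nil.
have lt_a1 : (size a1 < n)%N by move: lt_a; rewrite -aE size_cat /=; lia.
by rewrite [X in P X _](IH x a1 lt_a1) (additive_fun0 (PD _)).
Qed.

Lemma fpowSr n : fpow n.+1 = fmul (fpow n) P.
Proof.
elim: n => [|n IH]; first by rewrite /fpow /= fmul1r // fmul1l.
exact: (etrans (congr1 (fmul P) IH) (fmulA PD _ _)).
Qed.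

Definition fgeom n : M -> seq A -> M := \sum_(i < n) fpow i.

Lemma fgeomS n : fgeom n.+1 = fgeom n + fpow n.
Proof. exact: big_ord_recr. Qed.

Lemma rfamily_fgeom n : rfamily 0 (fgeom n).
Proof.
elim: n => [|n IH]; first by rewrite /fgeom big_ord0; apply: rfamily0.
by rewrite fgeomS; apply: rfamilyD => //; apply: rfamily_fpow.
Qed.

Let rfamily_1P : rfamily 0 (@fid A M - P).
Proof. by apply: rfamilyB => //; apply: rfamily1. Qed.

Let oneD := rfamily_left_additive (rfamily1 M A).
Let subD := rfamily_left_additive rfamily_1P.

Lemma fgeom_r n : fmul (@fid A M - P) (fgeom n) = @fid A M - fpow n.
Proof.
elim: n => [|n IH]; first by rewrite /fgeom big_ord0 fmul0r // subrr.
rewrite fgeomS fmulDr // IH fmulBl fmul1l.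
by rewrite [fpow n.+1]/(fmul P (fpow n)); zmod.
Qed.

Lemma fgeom_l n : fmul (fgeom n) (@fid A M - P) = @fid A M - fpow n.
Proof.
elim: n => [|n IH]; first by rewrite /fgeom big_ord0 fmul0l subrr.
have pD := rfamily_left_additive (rfamily_fpow n).
by rewrite fgeomS fmulDl IH fmulBr // fmul1r // fpowSr; zmod.
Qed.

(* The full geometric series: [fpow] n vanishes on words of size less than n. *)
Definition fam_inv (x : M) (a : seq A) : M := fgeom (size a).+1 x a.

Lemma fam_invE n x (a : seq A) : (size a < n)%N -> fam_inv x a = fgeom n x a.
Proof.
move=> lt_a; rewrite -(subnKC lt_a) /fam_inv; elim: (n - _)%N => [|m IH].
  by rewrite addn0.
have small : fpow ((size a).+1 + m) x a = 0.
  by rewrite fpow_small // addSn ltnS leq_addr.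
by rewrite addnS IH -[LHS]addr0 -small [in RHS]fgeomS.
Qed.

(** On words of size at most [n] the series is a fixed finite sum, so the bounded form of the laws
    carries over. *)
Lemma rfamily_fam_inv : rfamily 0 fam_inv.
Proof.
split=> [n|i x xi ds a dsa]; last by case: (rfamily_fgeom (size a).+1) => _; apply.
apply: (@eq_lawful _ _ n _ _ _ (fgeom n.+1)) => [x a le_a|].
  by rewrite (fam_invE _ (n := n.+1)).
by case: (rfamily_fgeom n.+1).
Qed.

Lemma fam_inv_r : fmul (@fid A M - P) fam_inv = @fid A M.
Proof.
apply/funext => x; apply/funext => a.
transitivity (fmul (@fid A M - P) (fgeom (size a).+1) x a).
  apply: eq_split_sum => a1 a2 aE; rewrite (fam_invE _ (n := (size a).+1)) //.
  by rewrite -aE ltnS size_cat leq_addr.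
transitivity (fid x a - fpow (size a).+1 x a); first by rewrite fgeom_r.
by rewrite fpow_small // subr0.
Qed.

Lemma fam_inv_l : fmul fam_inv (@fid A M - P) = @fid A M.
Proof.
apply/funext => x; apply/funext => a.
transitivity (fmul (fgeom (size a).+1) (@fid A M - P) x a).
  apply: eq_split_sum => a1 a2 aE; rewrite (fam_invE _ (n := (size a).+1)) //.
  by rewrite -aE ltnS size_cat leq_addl.
transitivity (fid x a - fpow (size a).+1 x a); first by rewrite fgeom_l.
by rewrite fpow_small // subr0.
Qed.

End Inverse.

(** Applying D to p q = 1 expresses p (D q) through D p, and multiplying by q isolates D q. *)
Lemma closed_family_inv M N (mu : M -> seq A -> M) (nu : N -> seq A -> N)
    (p : M -> seq A -> N) (q : N -> seq A -> M) :
  rfamily 1 mu -> rfamily 1 nu -> closed_family mu nu p -> rfamily 0 q ->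
  fmul p q = @fid A N -> fmul q p = @fid A M -> closed_family nu mu q.
Proof.
move=> mu1 nu1 pC q0 pq1 qp1; split=> //; have [p0 _] := pC.
have qD := rfamily_left_additive q0; have pD := rfamily_left_additive p0.
have muD := rfamily_left_additive mu1; have nuD := rfamily_left_additive nu1.
have /eqP : fam_dif (fmul p q) = 0 by rewrite pq1 fam_dif1.
rewrite (fam_dif_mul_even p0 q0) (closed_family_dif pC) addr_eq0 => /eqP dq.
have -> : fam_dif q = fmul q (fmul p (fam_dif q)) by rewrite fmulA // qp1 fmul1l.
have -> : fmul p (fam_dif q) = fmul p (fmul mu q) - nu.
  rewrite dq fmulBl -(fmulA nuD) pq1 fmul1r // -(fmulA pD); zmod.
by rewrite fmulBr // fmulA // qp1 fmul1l; zmod.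
Qed.

End TwistedComplexes.

(** * Algebra morphisms and restriction *)

Section AlgebraMorphisms.
Variables (k : fieldType) (S : falgType k).
Implicit Types (A B C : ainf_alg S).

Definition closed_word A B (f : seq A -> B) : Prop :=
  bifamily 0 f /\ forall y a,
    insert_sum (@susp_sgn k S A) (@hat_m k S A) f (y :: a)
    = block_sum f (@hat_m k S B) (y :: a).

Definition homotopy_word A B (f g h : seq A -> B) : Prop :=
  bifamily (-1) h /\ forall y a, f (y :: a) - g (y :: a)
    = insert_sum (@susp_sgn k S A) (@hat_m k S A) h (y :: a)
      + htp_sum (@susp_sgn k S B) f h g (@hat_m k S B) (y :: a).

Lemma bifamily_hat A B e (f : seq A -> B) : bifamily e f -> bifamily e (hat_op f).
Proof. exact: bifamily_twist. Qed.

Lemma bifamily_hat_m A : bifamily 1 (@hat_m k S A).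
Proof. exact/bifamily_twist/am_bifamily. Qed.

Lemma afun_bifamily A B (f : ainf_mor A B) : bifamily 0 f.
Proof. exact/(bimod_familyP _ deg_fS)/af_family. Qed.

Lemma closed_word_hat A B (f : seq A -> B) : bifamily 0 f ->
  (forall a, (1 <= size a)%N -> insert (@am k S A) f a = acomp (@am k S B) f a) <->
  closed_word (hat_op f).
Proof.
move=> f0; split=> [f_rel|[_ f_rel] a].
  split=> [|y a]; first exact: bifamily_hat.
  rewrite -(insert_twist _ (am_bifamily A) f0) f_rel ?size_twist //.
  exact: (acomp_twist _ (am_bifamily B) f0).
rewrite -(twistK a) size_twist; case: (twist a) => // y {}a _.
rewrite (insert_twist _ (am_bifamily A) f0) (acomp_twist _ (am_bifamily B) f0).
exact: f_rel.
Qed.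

Lemma afun_closed_word A B (f : ainf_mor A B) : closed_word (hat_op f).
Proof. by apply/closed_word_hat; [apply: afun_bifamily|apply: af_rel]. Qed.

Lemma bifamily_even A B (f : seq A -> B) y a : bifamily 0 f ->
  f (susp_sgn y :: map (@susp_sgn k S A) a) = susp_sgn (f (y :: a)).
Proof. by move=> [[fL _] fe]; rewrite (rfamily_susp (conj fL fe)) mulr1z. Qed.

Lemma bifamily_odd A B e (f : seq A -> B) y a : bifamily e f -> sg e = -1 ->
  f (susp_sgn y :: map (@susp_sgn k S A) a) = - susp_sgn (f (y :: a)).
Proof. by move=> [[fL _] fe] e1; rewrite (rfamily_susp (conj fL fe)) e1 mulrN1z. Qed.

(** Only the division into single letters survives, because [aid] vanishes on longer blocks. *)
Lemma block_sum_aid A (V : zmodType) (K : seq A -> V) : multiadditive K ->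
  block_sum (@aid k S A) K =1 K.
Proof.
move=> + a; elim/size_ind: a K => [|y a IH] K KD; first by rewrite block_sum_nil.
have KD1 w : additive_fun (fun x => K (x :: w)) by apply: (KD [::] w).
rewrite block_sum_cons (split_sum_size (G := fun a1 a2 => K (aid (y :: a1) :: a2))).
  case: a {IH} => [|z a]; first by rewrite split_sum_nil.
  rewrite split_sum_cons split_sum0 ?addr0 // => a1 a2 _.
  exact: (additive_fun0 (KD1 a2)).
by move=> a1 a2 le_a2; rewrite (IH _ le_a2) //; apply: multiadditive_cons.
Qed.

Lemma aid_bifamily A : bifamily 0 (@aid k S A).
Proof.
have aidE : (fun (y : A) a => aid (y :: a)) = @fid A A.
  by apply/funext => y; apply/funext => -[].
have [idL id0] := rfamily1 A A; split; rewrite ?aidE //.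
by split=> [n|s y [|z a]]; rewrite ?aidE ?raddf0.
Qed.

Lemma hat_aid A : hat_op (@aid k S A) = @aid k S A.
Proof. by apply/funext => -[|y [|z a]] //; rewrite /hat_op /= koszul0. Qed.

Lemma aid_closed_word A : closed_word (@aid k S A).
Proof.
split=> [|y a]; first exact: aid_bifamily.
have mD := bifamily_multiadditive (bifamily_hat_m A).
(* Insertions behind the first letter leave at least two letters, which [aid] kills. *)
rewrite block_sum_aid //= [X in _ + X]insert_sum0 => [|[|z w]] //.
rewrite addr0; exact: (congr1 (fun F => F y a)
  (fmul1l (fun (y : A) a => hat_m (y :: a)))).
Qed.

Lemma eq_block_sum_cons (T : Type) B (V : zmodType) (f : seq T -> B)
    (K K' : seq B -> V) y a :
  (forall x w, K (x :: w) = K' (x :: w)) ->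
  block_sum f K (y :: a) = block_sum f K' (y :: a).
Proof.
move=> KK'; rewrite !block_sum_cons; apply: eq_split_sum => a1 a2 _.
by apply: eq_block_sum => w; apply: KK'.
Qed.

(** The relation of [f], extended to words, turns the insertion in A into one in B, where the
    relation of [g] takes over. *)
Lemma acomp_closed_word A B C (g : seq B -> C) (f : seq A -> B) :
  closed_word g -> closed_word f -> closed_word (block_sum f g).
Proof.
move=> [g0 g_rel] [f0 f_rel]; split=> [|y a]; first exact: bifamily_res.
have gD := bifamily_multiadditive g0.
have mD := bifamily_multiadditive (bifamily_hat_m C).
have f_even y' a' := bifamily_even y' a' f0.
rewrite -(insert_block_sum f_even f_rel _ gD) block_sum_comp //.
exact: eq_block_sum_cons.
Qed.

Lemma hat_acomp A B C (g : seq B -> C) (f : seq A -> B) :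
  bifamily 0 g -> bifamily 0 f ->
  hat_op (acomp g f) = block_sum (hat_op f) (hat_op g).
Proof. by move=> g0 f0; apply/funext => a; apply: acomp_twist g0 f0. Qed.

Lemma hat_opK A B (f : seq A -> B) : hat_op (hat_op f) = f.
Proof. by apply/funext => a; rewrite /hat_op twistK. Qed.

Lemma acomp_bifamily A B C (g : seq B -> C) (f : seq A -> B) :
  bifamily 0 g -> bifamily 0 f -> bifamily 0 (acomp g f).
Proof.
move=> g0 f0; rewrite -[acomp g f]hat_opK; apply: bifamily_hat.
by rewrite hat_acomp //; apply: bifamily_res; apply: bifamily_hat.
Qed.

Lemma ainf_homotopic_word A B (f g : seq A -> B) :
  bifamily 0 f -> bifamily 0 g -> ainf_homotopic f g ->
  exists h, homotopy_word (hat_op f) (hat_op g) h.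
Proof.
move=> f0 g0 [h /(bimod_familyP _ deg_hS) h1 fg]; exists (hat_op h).
split=> [|y a]; first exact: bifamily_hat.
have := fg (twist (y :: a)); rewrite size_twist => /(_ isT).
rewrite (insert_twist _ (am_bifamily A) h1) (htp_ops_twist _ f0 h1 g0).
exact.
Qed.

End AlgebraMorphisms.

Section RestrictedFamilies.
Variables (k : fieldType) (S : falgType k) (A B : ainf_alg S).
Implicit Types (L M N P : grMod S).

Section Closed.
Variables (f : seq A -> B) (fC : closed_word f).

Let f0 : bifamily 0 f := proj1 fC.

Lemma fam_dif_res M N e (p : M -> seq B -> N) :
  rfamily e p -> fres f (fam_dif p) = fam_dif (fres f p).
Proof.
move=> pe; apply: fres_fdif.
- by move=> y a; apply: bifamily_even.
- by case: fC.
- by move=> x; apply: rfamily_multiadditive pe.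
Qed.

Lemma maurer_cartan_res M (mu : M -> seq B -> M) :
  maurer_cartan mu -> maurer_cartan (fres f mu).
Proof.
move=> [mu1 mu_rel]; have muD := rfamily_left_additive mu1.
split; first exact: rfamily_res.
by rewrite -(fam_dif_res mu1) -fres_mul // -fresD mu_rel fres0.
Qed.

Lemma closed_family_res M N (mu : M -> seq B -> M) (nu : N -> seq B -> N) p :
  rfamily 1 nu -> closed_family mu nu p ->
  closed_family (fres f mu) (fres f nu) (fres f p).
Proof.
move=> nu1 [p0 p_rel]; split; first exact: rfamily_res.
have [nuD pD] := (rfamily_left_additive nu1, rfamily_left_additive p0).
by rewrite -(fam_dif_res p0) -!fres_mul // -fresN -!fresD p_rel fres0.
Qed.

Lemma homotopic_families_res M N (mu : M -> seq B -> M) (nu : N -> seq B -> N)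
    p q : rfamily 1 nu -> homotopic_families mu nu p q ->
  homotopic_families (fres f mu) (fres f nu) (fres f p) (fres f q).
Proof.
move=> nu1 [h h1 pq]; exists (fres f h); first exact: rfamily_res.
have [nuD hD] := (rfamily_left_additive nu1, rfamily_left_additive h1).
by rewrite -(fam_dif_res h1) -!fres_mul // -fresN -!fresD pq.
Qed.

End Closed.

Section Homotopic.
Variables (f g h : seq A -> B).
Hypotheses (fC : closed_word f) (gC : closed_word g) (hC : homotopy_word f g h).

Let f0 : bifamily 0 f := proj1 fC.
Let g0 : bifamily 0 g := proj1 gC.
Let h1 : bifamily (-1) h := proj1 hC.

Definition fam_htp M N (p : M -> seq B -> N) : M -> seq A -> N :=
  fhtp (@susp_sgn k S B) f h g (@susp_sgn k S M) p.

Lemma rfamily_fam_htp M N d e (p : M -> seq B -> N) :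
  d = e - 1 -> rfamily e p -> rfamily d (fam_htp p).
Proof. by move=> -> pe; apply: rfamily_htp. Qed.

Lemma fam_htp_mul_even M N P d (q : N -> seq B -> P) (p : M -> seq B -> N) :
  rfamily d q -> rfamily 0 p ->
  fam_htp (fmul q p) = fmul (fres g q) (fam_htp p) + fmul (fam_htp q) (fres f p).
Proof.
move=> qd p0; apply: fhtp_mul_even.
- exact: rfamily_left_additive qd.
- exact: susp_sgnD.
- by move=> x a; rewrite (rfamily_susp p0) mulr1z.
Qed.

Lemma fam_htp_mul_odd M N P d e (q : N -> seq B -> P) (p : M -> seq B -> N) :
  rfamily d q -> rfamily e p -> sg e = -1 ->
  fam_htp (fmul q p) = fmul (fres g q) (fam_htp p) - fmul (fam_htp q) (fres f p).
Proof.
move=> qd pe e_odd; apply: fhtp_mul_odd.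
- exact: rfamily_left_additive qd.
- exact: susp_sgnD.
- by move=> x a; rewrite (rfamily_susp pe) e_odd mulrN1z.
Qed.

Lemma fam_dif_htp M N e (p : M -> seq B -> N) : rfamily e p ->
  fam_dif (fam_htp p) = fres f p - fres g p - fam_htp (fam_dif p).
Proof.
move=> pe; apply/funext => x; apply/funext => a.
have htp := block_sum_homotopy (@susp_sgnD _ _ _) (@susp_sgnK _ _ _)
  (fun y a => bifamily_odd y a (bifamily_hat_m B) erefl)
  (fun y a => bifamily_even y a f0) (fun y a => bifamily_even y a g0)
  (fun y a => bifamily_odd y a h1 erefl) (proj2 fC) (proj2 gC) (proj2 hC)
  a (rfamily_multiadditive x pe).
(* The differential and the homotopy operator each apply [susp_sgn] to [x]; the two cancel, leaving
   the formula on words for [p x]. *)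
transitivity (insert_sum (@susp_sgn k S A) (@hat_m k S A)
  (htp_sum (@susp_sgn k S B) f h g (p x)) a).
  by rewrite /fam_dif /fdif /fam_htp /fhtp susp_sgnK.
transitivity (fres f p x a - fres g p x a - htp_sum (@susp_sgn k S B) f h g
    (insert_sum (@susp_sgn k S B) (@hat_m k S B) (p x)) a).
  by rewrite [fres f p x a - _]htp; zmod.
have -> : insert_sum (@susp_sgn k S B) (@hat_m k S B) (p x)
    = fam_dif p (susp_sgn x) by apply/funext => w; rewrite /fam_dif /fdif susp_sgnK.
by [].
Qed.

Definition theta M (mu : M -> seq B -> M) : M -> seq A -> M :=
  @fid A M - fam_htp mu.

Section Theta.
Variables (M : grMod S) (mu : M -> seq B -> M) (muC : maurer_cartan mu).

Let mu1 : rfamily 1 mu := proj1 muC.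

Lemma rfamily_htp_mu : rfamily 0 (fam_htp mu).
Proof. by apply: rfamily_fam_htp mu1; rewrite subrr. Qed.

Lemma fam_dif_htp_mu : fam_dif (fam_htp mu)
  = fres f mu - fres g mu + fmul (fres g mu) (fam_htp mu)
    - fmul (fam_htp mu) (fres f mu).
Proof.
rewrite (fam_dif_htp mu1).
have -> : fam_dif mu = - fmul mu mu.
  by apply/eqP; rewrite -addr_eq0; apply/eqP; case: muC.
rewrite [fam_htp (- _)]fhtpN -/(fam_htp (fmul mu mu)).
by rewrite (fam_htp_mul_odd mu1 mu1) //; zmod.
Qed.

Lemma theta_closed : closed_family (fres f mu) (fres g mu) (theta mu).
Proof.
split; first by apply: rfamilyB; [apply: rfamily1|apply: rfamily_htp_mu].
have gD := rfamily_left_additive (rfamily_res g0 mu1).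
rewrite /theta fam_difD fam_difN fam_dif1 fam_dif_htp_mu.
by rewrite fmulBl fmulBr // fmul1l fmul1r //; zmod.
Qed.

Let htp_nil x : fam_htp mu x [::] = 0.
Proof. exact: htp_sum_nil. Qed.

Lemma theta_inv : exists2 q, closed_family (fres g mu) (fres f mu) q &
  fmul (theta mu) q = @fid A M /\ fmul q (theta mu) = @fid A M.
Proof.
have inv_r := fam_inv_r rfamily_htp_mu htp_nil.
have inv_l := fam_inv_l rfamily_htp_mu htp_nil.
exists (fam_inv (fam_htp mu)) => //.
apply: (closed_family_inv (rfamily_res f0 mu1) (rfamily_res g0 mu1) theta_closed)
  => //.
exact: rfamily_fam_inv rfamily_htp_mu htp_nil.
Qed.

End Theta.

Lemma theta_natural M N (mu : M -> seq B -> M) (nu : N -> seq B -> N) p :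
  maurer_cartan mu -> maurer_cartan nu -> closed_family mu nu p ->
  homotopic_families (fres f mu) (fres g nu)
    (fmul (theta nu) (fres f p)) (fmul (fres g p) (theta mu)).
Proof.
move=> [mu1 _] [nu1 _] pC; have [p0 _] := pC.
(* Expanding H(D p) in D H(p) = R_f(p) - R_g(p) - H(D p) yields the products of H(p) with the
   restricted structures with a minus sign; the homotopy relation adds these back, and the
   naturality defect remains. *)
exists (fam_htp p); first by apply: rfamily_fam_htp p0; rewrite sub0r.
have gpD := rfamily_left_additive (rfamily_res g0 p0).
rewrite (fam_dif_htp p0) (closed_family_dif pC).
have -> : fam_htp (fmul nu p - fmul p mu)
    = fam_htp (fmul nu p) - fam_htp (fmul p mu).
  by rewrite /fam_htp fhtpD fhtpN.
rewrite (fam_htp_mul_even nu1 p0) (fam_htp_mul_odd p0 mu1) //.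
by rewrite /theta fmulBl fmulBr // fmul1l fmul1r //; zmod.
Qed.

End Homotopic.
End RestrictedFamilies.

(** * The categories and functors *)

Section ModuleCategory.
Variables (k : fieldType) (S : falgType k) (A : ainf_alg S).
Implicit Types (L M N P : grMod S).

Lemma twf_eq0 M N (F : M -> seq A -> N) : (forall x a, F x a = 0) <-> twf F = 0.
Proof.
split=> [F0|F0 x a]; first by apply/funext => x; apply/funext => a; apply: F0.
by rewrite -[F]twfK F0.
Qed.

Lemma rfamily_twfP M N e (F : M -> seq A -> N) : rfamily e (twf F) <-> rfamily e F.
Proof.
by split; [rewrite -{2}[F]twfK|]; apply: rfamily_twf.
Qed.

Lemma twf1 M : twf (@fid A M) = @fid A M.
Proof. by apply/funext => x; apply/funext => -[|y a]; rewrite /twf //= koszul0. Qed.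

Lemma twf_mcompose M N P d e (sgn : nat -> nat -> nat)
    (G : N -> seq A -> P) (F : M -> seq A -> N) :
  (forall r s, sg (sgn r.+1 s) = sg (s%:Z * (e - r%:Z))) ->
  rfamily d G -> rfamily e F ->
  twf (mcompose sgn G F) = fmul (twf G) (twf F).
Proof.
by move=> sgnE Gd Fe; apply/funext => x; apply/funext => a; apply: mcompose_twist Gd Fe.
Qed.

Lemma twf_minsert M N e (F : M -> seq A -> N) :
  rfamily e F -> twf (minsert F) = fam_dif (twf F).
Proof.
by move=> Fe; apply/funext => x; apply/funext => a; apply: minsert_twist Fe.
Qed.

Section Composition.
Variables (M N P : grMod S) (d : int).
Variables (G : N -> seq A -> P) (F : M -> seq A -> N).
Hypothesis Gd : rfamily d G.

Lemma twf_mcompose0 : rfamily 0 F ->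
  twf (mcompose (fun r s => r.+1 * s)%N G F) = fmul (twf G) (twf F).
Proof.
apply: twf_mcompose Gd => r s.
by apply: (sg_eq (c := ((r * s)%N + s)%:Z)); lia.
Qed.

Lemma twf_mcompose1 : rfamily 1 F ->
  twf (mcompose (fun r s => r * s)%N G F) = fmul (twf G) (twf F).
Proof.
by apply: twf_mcompose Gd => r s; apply: (sg_eq (c := (r * s)%:Z)); lia.
Qed.

Lemma twf_mcomposeN1 : rfamily (-1) F ->
  twf (mcompose (fun r s => r * s)%N G F) = fmul (twf G) (twf F).
Proof.
apply: twf_mcompose Gd => r s.
by apply: (sg_eq (c := ((r * s)%N + s)%:Z)); lia.
Qed.

End Composition.

Lemma maurer_cartanP (M : premod A) :
  is_ainf_mod M <-> maurer_cartan (twf (@mm k S A M)).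
Proof.
rewrite /is_ainf_mod /maurer_cartan (right_familyP _ deg_mS) -/(rfamily _ _).
rewrite rfamily_twfP; split=> -[m1 m_rel]; split=> //.
  rewrite -(twf_minsert m1) -(twf_mcompose1 m1 m1).
  exact: (proj1 (twf_eq0 (_ + _)) m_rel).
apply/(twf_eq0 (_ + _)); rewrite -[RHS]m_rel.
by rewrite -(twf_minsert m1) -(twf_mcompose1 m1 m1).
Qed.

Section Hom.
Variables M N : premod A.
Hypotheses (MA : is_ainf_mod M) (NA : is_ainf_mod N).
Implicit Types p q : M -> seq A -> N.

Let mu := twf (@mm k S A M).
Let nu := twf (@mm k S A N).

Let M1 : rfamily 1 (@mm k S A M).
Proof. by apply/rfamily_twfP; case/maurer_cartanP: MA. Qed.

Let N1 : rfamily 1 (@mm k S A N).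
Proof. by apply/rfamily_twfP; case/maurer_cartanP: NA. Qed.

Lemma closed_familyP p : is_mod_mor p <-> closed_family mu nu (twf p).
Proof.
rewrite /is_mod_mor /closed_family /mu /nu (right_familyP _ deg_fS) -/(rfamily _ _).
rewrite rfamily_twfP; split=> -[p0 p_rel]; split=> //.
  rewrite -(twf_minsert p0) -(twf_mcompose1 p0 M1).
  rewrite -(twf_mcompose0 N1 p0).
  exact: (proj1 (twf_eq0 (_ + _ - _)) p_rel).
apply/(twf_eq0 (_ + _ - _)); rewrite -[RHS]p_rel -(twf_minsert p0).
by rewrite -(twf_mcompose1 p0 M1) -(twf_mcompose0 N1 p0).
Qed.

Lemma homotopic_familiesP p q :
  mod_homotopic p q <-> homotopic_families mu nu (twf p) (twf q).
Proof.
rewrite /mu /nu; split=> -[h].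
  move=> /(right_familyP _ deg_hS) h1 pq.
  exists (twf h); first exact: rfamily_twf.
  rewrite -(twf_minsert h1) -(twf_mcompose1 h1 M1).
  rewrite -(twf_mcomposeN1 N1 h1).
  apply/funext => x; apply/funext => a; exact: pq.
move=> h1 pq; have h1' : rfamily (-1) (twf h) := rfamily_twf h1.
exists (twf h); first exact/(right_familyP _ deg_hS).
have : twf (p - q) = twf (mcompose (fun r s => r * s)%N (@mm k S A N) (twf h)
      + mcompose (fun s t => s * t)%N (twf h) (@mm k S A M) + minsert (twf h)).
  apply: etrans (etrans pq _) => //.
  rewrite -{1 2 3}[h]twfK -(twf_minsert h1') -(twf_mcompose1 h1' M1).
  by rewrite -(twf_mcomposeN1 N1 h1').
move=> /(congr1 (@twf k S M A N)); rewrite !twfK => E x a.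
exact: (congr1 (fun F => F x a) E).
Qed.

End Hom.

Lemma twf_mcomp (M N P : premod A) d (q : N -> seq A -> P) (p : M -> seq A -> N) :
  rfamily d q -> rfamily 0 p -> twf (mcomp q p) = fmul (twf q) (twf p).
Proof. exact: twf_mcompose0. Qed.

Lemma is_homP (M N : premod A) (p : M -> seq A -> N) :
  @is_hom (hMod A) M N p <->
  [/\ maurer_cartan (twf (@mm k S A M)), maurer_cartan (twf (@mm k S A N)) &
      closed_family (twf (@mm k S A M)) (twf (@mm k S A N)) (twf p)].
Proof.
split=> [[MA NA pC]|[/maurer_cartanP MA /maurer_cartanP NA pC]].
  by split; [apply/maurer_cartanP|apply/maurer_cartanP|apply/closed_familyP].
by split=> //; apply/closed_familyP.
Qed.

Lemma is_hom_rfamily (M N : premod A) (p : M -> seq A -> N) :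
  @is_hom (hMod A) M N p -> rfamily 0 p.
Proof. by case/is_homP => _ _ [/rfamily_twfP]. Qed.

(** Unit, associativity and functor laws hold as equalities of families, so they need no more than
    reflexivity of homotopy. *)
Lemma eqv_refl (M N : premod A) (p q : M -> seq A -> N) :
  is_ainf_mod M -> is_ainf_mod N -> p = q -> @eqv (hMod A) M N p q.
Proof.
move=> MA NA ->; apply/homotopic_familiesP => //.
by apply: homotopic_families_refl; case/maurer_cartanP: NA.
Qed.

Lemma mcomp_hom (M N P : premod A) (q : N -> seq A -> P) (p : M -> seq A -> N) :
  @is_hom (hMod A) N P q -> @is_hom (hMod A) M N p ->
  @is_hom (hMod A) M P (mcomp q p).
Proof.
move=> qH pH; have [q0 p0] := (is_hom_rfamily qH, is_hom_rfamily pH).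
move: qH pH => /is_homP[_ PA qC] /is_homP[MA NA pC]; apply/is_homP; split=> //.
rewrite (twf_mcomp q0 p0); apply: closed_family_mul qC pC.
by case: PA.
Qed.

Lemma hMod_is_category : is_category (hMod A).
Proof.
split=> [M MA|L M N q p|M N p|M N p q|M N p q r|L M N q q' p p'|M N p|M N p|
  L M N P r q p].
- have MC := (maurer_cartanP M).1 MA; apply/is_homP; split=> //.
  by have := closed_family1 (proj1 MC); rewrite -twf1.
- exact: mcomp_hom.
- by case=> MA NA _; apply: eqv_refl.
- case=> MA NA _ _ /(homotopic_familiesP MA NA) pq.
  apply/homotopic_familiesP => //; apply: homotopic_families_sym pq.
  by case/maurer_cartanP: NA.
- case=> MA NA _ _ _ /(homotopic_familiesP MA NA) pq /(homotopic_familiesP MA NA) qr.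
  apply/homotopic_familiesP => //; apply: homotopic_families_trans pq qr.
  by case/maurer_cartanP: NA.
- move=> qH q'H pH p'H; have [[MA NA _] [LA _ _]] := (qH, pH).
  have [q0 q'0] := (is_hom_rfamily qH, is_hom_rfamily q'H).
  have [p0 p'0] := (is_hom_rfamily pH, is_hom_rfamily p'H).
  move=> /(homotopic_familiesP MA NA) qq' /(homotopic_familiesP LA MA) pp'.
  apply/homotopic_familiesP => //.
  rewrite (twf_mcomp q0 p0) (twf_mcomp q'0 p'0).
  apply: homotopic_families_mul qq' pp'.
  + by case/maurer_cartanP: NA.
  + by case/is_homP: q'H.
  + by case/is_homP: pH.
- move=> pH; have [MA NA _] := pH; apply: eqv_refl => //.
  apply: (can_inj (@twfK k S M A N)).
  by rewrite (twf_mcomp (rfamily1 _ _) (is_hom_rfamily pH)) twf1 fmul1l.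
- move=> pH; have [MA NA _] := pH; apply: eqv_refl => //.
  have p0 := is_hom_rfamily pH.
  apply: (can_inj (@twfK k S M A N)).
  rewrite (twf_mcomp p0 (rfamily1 _ _)) twf1 fmul1r //.
  exact: rfamily_left_additive (rfamily_twf p0).
- move=> rH qH pH; have [LA _ _] := pH; have [_ PA _] := rH.
  have [r0 q0] := (is_hom_rfamily rH, is_hom_rfamily qH).
  have p0 := is_hom_rfamily pH.
  have [rq0 qp0] := (is_hom_rfamily (mcomp_hom rH qH), is_hom_rfamily (mcomp_hom qH pH)).
  apply: eqv_refl => //; apply: (can_inj (@twfK k S L A P)).
  rewrite (twf_mcomp r0 qp0) (twf_mcomp q0 p0) (twf_mcomp rq0 p0) (twf_mcomp r0 q0).
  rewrite fmulA //; exact: rfamily_left_additive (rfamily_twf r0).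
Qed.

End ModuleCategory.

(** * Identity and composite functors *)

Section GeneralFunctors.

Lemma id_is_functor (C : precat) : is_category C -> is_functor (id_functor C).
Proof.
move=> CC; split=> //.
- by move=> x xC; apply: cat_refl => //; apply: cat_id.
- by move=> x y z g f gH fH; apply: cat_refl => //; apply: cat_comp.
Qed.

Lemma comp_is_functor (C D E : precat) (G : prefunctor D E) (F : prefunctor C D) :
  is_functor G -> is_functor F -> is_functor (comp_functor G F).
Proof.
move=> GF FF; have [DC EC] := (fun_dom GF, fun_cod GF); have CC := fun_dom FF.
have idH (x : ob C) : isob x -> is_hom (idc x) by apply: (cat_id CC).
split=> //=.
- by move=> x xC; apply: fun_ob => //; apply: fun_ob.
- by move=> x y f fH; apply: fun_ar => //; apply: fun_ar.
- move=> x y f g fH gH fg.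
  by apply: fun_eqv => //; [apply: fun_ar|apply: fun_ar|apply: fun_eqv].
- move=> x xC; have FxD := fun_ob FF xC.
  apply: (cat_trans EC (g := far G (idc (F x)))).
  + by apply: fun_ar => //; apply: fun_ar => //; apply: idH.
  + by apply: fun_ar => //; apply: cat_id.
  + by apply: cat_id => //; apply: fun_ob.
  + apply: fun_eqv => //; [by apply: fun_ar => //; apply: idH|exact: cat_id|].
    exact: fun_id.
  + exact: fun_id.
- move=> x y z g f gH fH; have [FgH FfH] := (fun_ar FF gH, fun_ar FF fH).
  have FgfH := fun_ar FF (cat_comp CC gH fH).
  apply: (cat_trans EC (g := far G (Defs.comp (far F g) (far F f)))).
  + exact: fun_ar.
  + by apply: fun_ar => //; apply: cat_comp.
  + by apply: cat_comp => //; apply: fun_ar.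
  + by apply: fun_eqv => //; [apply: cat_comp|apply: fun_comp].
  + exact: fun_comp.
Qed.

End GeneralFunctors.

Section RestrictionFunctors.
Variables (k : fieldType) (S : falgType k).

Lemma twf_restr (A B : ainf_alg S) (phi : ainf_mor A B) (M N : grMod S) e
    (p : M -> seq B -> N) :
  rfamily e p -> twf (restr phi p) = fres (hat_op phi) (twf p).
Proof.
by move=> pe; apply/funext => x; apply/funext => a; apply: restr_twist pe.
Qed.

Section Functor.
Variables (A B : ainf_alg S) (phi : ainf_mor A B).

Let phiC : closed_word (hat_op phi) := afun_closed_word phi.

Lemma mm_rfamily (M : premod B) : is_ainf_mod M -> rfamily 1 (@mm k S B M).
Proof. by case/maurer_cartanP => /rfamily_twfP. Qed.

Lemma restr_mod_is_ainf_mod (M : premod B) :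
  is_ainf_mod M -> is_ainf_mod (restr_mod phi M).
Proof.
move=> MB; apply/maurer_cartanP; rewrite /= (twf_restr _ (mm_rfamily MB)).
by apply: maurer_cartan_res => //; apply/maurer_cartanP.
Qed.

Lemma restr_hom (M N : premod B) (p : M -> seq B -> N) :
  @is_hom (hMod B) M N p ->
  @is_hom (hMod A) (restr_mod phi M) (restr_mod phi N) (restr phi p).
Proof.
move=> pH; have [MB NB _] := pH; have p0 := is_hom_rfamily pH.
split; [exact: restr_mod_is_ainf_mod|exact: restr_mod_is_ainf_mod|].
apply/closed_familyP; [exact: restr_mod_is_ainf_mod|exact: restr_mod_is_ainf_mod|].
rewrite /= (twf_restr _ (mm_rfamily MB)) (twf_restr _ (mm_rfamily NB)).
rewrite (twf_restr _ p0); case/is_homP: pH => _ [nu1 _] pC.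
exact: closed_family_res.
Qed.

Lemma hRestr_is_functor : is_functor (hRestr phi).
Proof.
split.
- exact: hMod_is_category.
- exact: hMod_is_category.
- exact: restr_mod_is_ainf_mod.
- exact: restr_hom.
- move=> M N p q pH qH; have [MB NB _] := pH.
  have [p0 q0] := (is_hom_rfamily pH, is_hom_rfamily qH).
  move=> /(homotopic_familiesP MB NB) pq; apply/homotopic_familiesP.
  + exact: restr_mod_is_ainf_mod.
  + exact: restr_mod_is_ainf_mod.
  + rewrite /= (twf_restr _ (mm_rfamily MB)) (twf_restr _ (mm_rfamily NB)).
    rewrite (twf_restr _ p0) (twf_restr _ q0); apply: homotopic_families_res pq => //.
    by case/maurer_cartanP: NB.
- move=> M MB; apply: eqv_refl; try exact: restr_mod_is_ainf_mod.
  apply: (can_inj (@twfK k S M A M)).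
  by rewrite [LHS](twf_restr _ (rfamily1 _ _)) [RHS]twf1 twf1 fres1.
- move=> L M N q p qH pH; have [[LB MB _] [_ NB _]] := (pH, qH).
  have [p0 q0] := (is_hom_rfamily pH, is_hom_rfamily qH).
  apply: eqv_refl; try exact: restr_mod_is_ainf_mod.
  apply: (can_inj (@twfK k S L A N)).
  rewrite [LHS](twf_restr _ (is_hom_rfamily (mcomp_hom qH pH))).
  rewrite [RHS](twf_mcomp (is_hom_rfamily (restr_hom qH)) (is_hom_rfamily (restr_hom pH))).
  rewrite (twf_mcomp q0 p0) (twf_restr _ p0) (twf_restr _ q0) fres_mul //.
  exact: rfamily_left_additive (rfamily_twf q0).
Qed.

End Functor.

Section Homotopic.
Variables (A B : ainf_alg S) (f g h : seq A -> B).
Hypotheses (fC : closed_word f) (gC : closed_word g) (hC : homotopy_word f g h).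

Definition mod_theta (M : premod B) : M -> seq A -> M :=
  twf (theta f g h (twf (@mm k S B M))).

(** The structures [m] and [m'] are known only through their twists, so that the lemma also covers
    an iterated restriction and the unrestricted module, which are restrictions only up to a
    provable equality. *)
Lemma mod_theta_iso (M : premod B) (m m' : M -> seq A -> M) :
  is_ainf_mod M -> twf m = fres f (twf (@mm k S B M)) ->
  twf m' = fres g (twf (@mm k S B M)) ->
  @is_iso (hMod A) (Premod m) (Premod m') (@mod_theta M).
Proof.
move=> /maurer_cartanP MC mE m'E.
have homC (n n' : M -> seq A -> M) p :
    maurer_cartan (twf n) -> maurer_cartan (twf n') ->
    closed_family (twf n) (twf n') p ->
    @is_hom (hMod A) (Premod n) (Premod n') (twf p).
  by move=> nC n'C pC; apply/is_homP; rewrite twfK.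
have mC : maurer_cartan (twf m) by rewrite mE; apply: maurer_cartan_res.
have m'C : maurer_cartan (twf m') by rewrite m'E; apply: maurer_cartan_res.
have thC : closed_family (twf m) (twf m') (theta f g h (twf (@mm k S B M))).
  by rewrite mE m'E; apply: theta_closed.
have [q] := theta_inv fC gC hC MC; rewrite -mE -m'E => qC [thq qth].
have [[th0 _] [q0 _]] := (thC, qC).
have [mA m'A] := ((maurer_cartanP (Premod m)).2 mC, (maurer_cartanP (Premod m')).2 m'C).
split; first exact: homC.
exists (twf q); split; first exact: homC.
- apply: eqv_refl => //; apply: (can_inj (@twfK k S M A M)).
  rewrite [LHS](twf_mcomp (M := Premod m) (N := Premod m') (P := Premod m)
    (rfamily_twf q0) (rfamily_twf th0)).
  by rewrite !twfK qth [RHS]twf1.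
- apply: eqv_refl => //; apply: (can_inj (@twfK k S M A M)).
  rewrite [LHS](twf_mcomp (M := Premod m') (N := Premod m) (P := Premod m')
    (rfamily_twf th0) (rfamily_twf q0)).
  by rewrite !twfK thq [RHS]twf1.
Qed.

Lemma mod_theta_natural (M N : premod B) (m m' : M -> seq A -> M)
    (n n' : N -> seq A -> N) (p : M -> seq B -> N) (r r' : M -> seq A -> N) :
  @is_hom (hMod B) M N p ->
  twf m = fres f (twf (@mm k S B M)) -> twf m' = fres g (twf (@mm k S B M)) ->
  twf n = fres f (twf (@mm k S B N)) -> twf n' = fres g (twf (@mm k S B N)) ->
  twf r = fres f (twf p) -> twf r' = fres g (twf p) ->
  @eqv (hMod A) (Premod m) (Premod n')
    (@Defs.comp (hMod A) (Premod m) (Premod n) (Premod n') (@mod_theta N) r)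
    (@Defs.comp (hMod A) (Premod m) (Premod m') (Premod n') r' (@mod_theta M)).
Proof.
move=> pH mE m'E nE n'E rE r'E; have p0 := is_hom_rfamily pH.
case/is_homP: pH => MC NC pC.
have mA : is_ainf_mod (Premod m).
  by apply/maurer_cartanP; rewrite [twf _]mE; apply: maurer_cartan_res.
have n'A : is_ainf_mod (Premod n').
  by apply/maurer_cartanP; rewrite [twf _]n'E; apply: maurer_cartan_res.
have r0 : rfamily 0 r.
  apply/rfamily_twfP; rewrite rE; apply: rfamily_res; first by case: fC.
  exact: rfamily_twf.
have r'0 : rfamily 0 r'.
  apply/rfamily_twfP; rewrite r'E; apply: rfamily_res; first by case: gC.
  exact: rfamily_twf.
have [thM0 _] := theta_closed fC gC hC MC.
have [thN0 _] := theta_closed fC gC hC NC.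
apply/homotopic_familiesP => //=.
rewrite (twf_mcomp (M := Premod m) (N := Premod n) (P := Premod n')
  (rfamily_twf thN0) r0).
rewrite (twf_mcomp (M := Premod m) (N := Premod m') (P := Premod n')
  r'0 (rfamily_twf thM0)).
rewrite !twfK mE n'E rE r'E; exact: theta_natural.
Qed.

End Homotopic.

Lemma restr_homotopic_iso (A B : ainf_alg S) (f g : ainf_mor A B) :
  ainf_homotopic f g -> isomorphic_functors (hRestr f) (hRestr g).
Proof.
have [fC gC] := (afun_closed_word f, afun_closed_word g).
move=> /(ainf_homotopic_word (afun_bifamily f) (afun_bifamily g)) [h hC].
split; [exact: hRestr_is_functor|exact: hRestr_is_functor|].
exists (@mod_theta A B (hat_op f) (hat_op g) h); split=> [M MB|M N p pH].
  by apply: (mod_theta_iso fC gC hC) => //; apply: twf_restr (mm_rfamily MB).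
have [MB NB _] := pH; have p0 := is_hom_rfamily pH.
by apply: (mod_theta_natural fC gC hC pH); apply: twf_restr;
  try exact: mm_rfamily; apply: p0.
Qed.

Lemma restr_comp_iso (A B : ainf_alg S) (f : ainf_mor A B) (g : ainf_mor B A) :
  ainf_homotopic (acomp f g) (@aid k S B) ->
  isomorphic_functors (comp_functor (hRestr g) (hRestr f)) (id_functor (hMod B)).
Proof.
have [f0 g0] := (afun_bifamily f, afun_bifamily g).
have [fC gC] := (afun_closed_word f, afun_closed_word g).
move=> /(ainf_homotopic_word (acomp_bifamily f0 g0) (aid_bifamily B)) [h].
rewrite hat_acomp // hat_aid => hC.
have fgC := acomp_closed_word fC gC; have idC := aid_closed_word B.
split.
- by apply: comp_is_functor; apply: hRestr_is_functor.
- exact/id_is_functor/hMod_is_category.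
have res_comp (M N : grMod S) e (p : M -> seq B -> N) : rfamily e p ->
    twf (restr g (restr f p)) = fres (block_sum (hat_op g) (hat_op f)) (twf p).
  move=> pe; have fpe : rfamily e (restr f p).
    apply/rfamily_twfP; rewrite (twf_restr _ pe).
    by apply: rfamily_res; [apply: bifamily_hat|apply: rfamily_twf].
  rewrite (twf_restr _ fpe) (twf_restr _ pe).
  apply/funext => x; apply/funext => a; rewrite /fres block_sum_comp //.
  exact: rfamily_multiadditive (rfamily_twf pe).
have res_id (M N : grMod S) e (p : M -> seq B -> N) : rfamily e p ->
    twf p = fres (@aid k S B) (twf p).
  move=> pe; apply/funext => x; apply/funext => a; rewrite /fres block_sum_aid //.
  exact: rfamily_multiadditive (rfamily_twf pe).
exists (@mod_theta B B (block_sum (hat_op g) (hat_op f)) (@aid k S B) h).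
(* Opening the modules makes the value of the identity functor literally a [Premod], as
   [mod_theta_iso] requires. *)
split=> [[M m] MB|[M m] [N n] p pH].
  have m1 := mm_rfamily MB.
  by apply: (mod_theta_iso fgC idC hC MB); [apply: res_comp m1|apply: res_id m1].
have [MB NB _] := pH; have p0 := is_hom_rfamily pH.
have [m1 n1] := (mm_rfamily MB, mm_rfamily NB).
apply: (mod_theta_natural fgC idC hC pH).
- exact: res_comp m1.
- exact: res_id m1.
- exact: res_comp n1.
- exact: res_id n1.
- exact: res_comp p0.
- exact: res_id p0.
Qed.

End RestrictionFunctors.

Theorem corollary10p4 (k : fieldType) (S : falgType k)
    (S_semisimple : semisimple (fun x y : S => GRing.mul x y))
    (Se_semisimple : semisimple (@env_mul k S))
    (A B : ainf_alg S) :
  (forall f g : ainf_mor A B, ainf_homotopic f g ->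
     isomorphic_functors (hRestr f) (hRestr g)) /\
  (forall f : ainf_mor A B, ainf_homotopy_equivalence f ->
     is_equivalence (hRestr f)).
Proof.
split=> [f g|f [g [gf fg]]]; first exact: restr_homotopic_iso.
split; first exact: hRestr_is_functor.
exists (hRestr g); split; first exact: hRestr_is_functor.
(* Restriction is contravariant: the homotopy for [f] after [g] settles the composite on modules
   over [B], the other one that on modules over [A]. *)
- exact: restr_comp_iso.
- exact: restr_comp_iso.
Qed.
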